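(* Let $n\ge 0$ be an integer and let $f_n$ be a globally regular solution with exactly $n$ zeros in $(0,\infty)$ of $$f''+\frac{f^3}{\sinh^2(x)}=0,\qquad x>0 .$$ Let $$L_n=-\frac{d^2}{dx^2}+V_n(x),\qquad V_n(x)=-\frac{3f_n(x)^2}{\sinh^2(x)},$$ be regarded as a self-adjoint operator on $L^2([0,\infty))$ with Dirichlet boundary condition $\xi(0)=0$. Then $L_n$ has continuous spectrum $[0,\infty)$ and exactly $n+1$ negative eigenvalues. One of these is $-1$, with eigenfunction $\xi^{(n)}(x)=\sinh(x)f_n'(x)$ (the gauge mode generated by time translation), and exactly $n$ eigenvalues lie below $-1$. In particular, for $n=0$ and $f_0(x)=\sqrt{2}\tanh(x)$, one has $V_0(x)=-6/\cosh^2(x)$ and the gauge mode $\xi^{(0)}(x)=\sinh(x)/\cosh^2(x)$ is (up to a constant factor) the only eigenfunction of $L_0$.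
   Context: A globally regular solution is a solution $f$ of the ODE on $(0,\infty)$, smooth up to $x=0$, with $f(0)=0$ and $f'(0)=c\ne 0$ (so $f(x)=cx+\mathcal{O}(x^3)$ as $x\to0$), such that $f(x)$ tends to a finite limit $b$ and $f'(x)\to 0$ as $x\to\infty$. In that case $f(x)=b-b^3e^{-2x}+\mathcal{O}(e^{-4x})$ as $x\to\infty$. Such functions are static solutions of $\partial_{ss}f-\partial_{xx}f-f^3/\sinh^2(x)=0$, which is the spherically symmetric focusing cubic wave equation $\partial_{tt}u-\partial_{rr}u-\frac2r\partial_ru-u^3=0$ written in the coordinates $T-t=e^{-s}\cosh x$, $r=e^{-s}\sinh x$ (with $T>0$ a constant, the blowup time) with $f=ru$. They correspond to self-similar solutions of the cubic wave equation. The operator $L_n$ arises by linearizing around $f_n$: a perturbation $w(s,x)=e^{iks}\xi(x)$ satisfies the linearized equation when $L_n\xi=k^2\xi$. The domain of $L_n$ is the set of functions in $H^2(0,\infty)$ with $\xi(0)=0$. *)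

(* Defs.v *)
From HB Require Import structures.
From mathcomp Require Import all_boot all_order all_algebra.
From mathcomp Require Import complex.
From mathcomp Require Import all_classical all_reals all_analysis.
Import Order.TTheory GRing.Theory Num.Theory.
Import numFieldNormedType.Exports.

Set Implicit Arguments.
Unset Strict Implicit.
Unset Printing Implicit Defensive.

Local Open Scope classical_set_scope.
Local Open Scope complex_scope.
Local Open Scope ring_scope.

Definition sinh (R : realType) (x : R) : R := (expR x - expR (- x)) / 2.
Definition cosh (R : realType) (x : R) : R := (expR x + expR (- x)) / 2.
Definition tanh (R : realType) (x : R) : R := sinh x / cosh x.

(* Only the values of f on [0, +oo[ are constrained: the iterated derivatives
   are taken at x > 0, and the behaviour at 0 is expressed by right limits. *)
Definition smooth_up_to_zero (R : realType) (f : R -> R) : Prop :=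
  forall k : nat,
    (forall x, 0 < x -> derivable (derive1n k f) x 1) /\
    cvg (derive1n k f x @[x --> 0^'+]).

Definition globally_regular (R : realType) (f : R -> R) : Prop :=
  smooth_up_to_zero f /\
  (forall x, 0 < x -> derive1n 2 f x + f x ^+ 3 / sinh x ^+ 2 = 0) /\
  f 0 = 0 /\
  f x @[x --> 0^'+] --> 0 /\
  (exists c : R, c != 0 /\ derive1 f x @[x --> 0^'+] --> c) /\
  (exists b : R, f x @[x --> +oo] --> b) /\
  derive1 f x @[x --> +oo] --> 0.

Definition positive_zeros (R : realType) (f : R -> R) : set R :=
  [set x | 0 < x /\ f x = 0].

(* The Hilbert space L^2([0, +oo[, C).  Its elements are represented by functions
   R -> R[i]; their values outside [0, +oo[ are irrelevant. *)

Definition half_line (R : realType) : set R := [set x | 0 <= x].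
Arguments half_line : clear implicits.

Definition ae_half_line (R : realType) (P : R -> Prop) : Prop :=
  {ae @lebesgue_measure R, forall x, half_line R x -> P x}.

Definition cnorm2 (R : realType) (z : R[i]) : R :=
  complex.Re z ^+ 2 + complex.Im z ^+ 2.

Definition in_L2 (R : realType) (u : R -> R[i]) : Prop :=
  measurable_fun (half_line R) (fun x => complex.Re (u x)) /\
  measurable_fun (half_line R) (fun x => complex.Im (u x)) /\
  (\int[@lebesgue_measure R]_(x in half_line R) (cnorm2 (u x))%:E < +oo)%E.

Definition cintegral (R : realType) (D : set R) (u : R -> R[i]) : R[i] :=
  (\int[@lebesgue_measure R]_(x in D) complex.Re (u x)) +i*
  (\int[@lebesgue_measure R]_(x in D) complex.Im (u x)).

Definition L2inner (R : realType) (u v : R -> R[i]) : R[i] :=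
  cintegral (half_line R) (fun x => u x * conjc (v x)).

Definition L2norm (R : realType) (u : R -> R[i]) : R :=
  Num.sqrt (\int[@lebesgue_measure R]_(x in half_line R) cnorm2 (u x)).

(* u is absolutely continuous on each [0, x], with a.e. derivative u'. *)
Definition primitive_of (R : realType) (u u' : R -> R[i]) : Prop :=
  forall x, 0 <= x -> u x = u 0 + cintegral `[0, x] u'.

(* The Sobolev space H^2(0, +oo): u and u' are absolutely continuous and
   u, u', u'' lie in L^2.  An element of H^2 is represented by its continuous
   representative, so that u 0 is its boundary value. *)
Definition in_H2 (R : realType) (u u' u'' : R -> R[i]) : Prop :=
  [/\ in_L2 u, in_L2 u', in_L2 u'', primitive_of u u' & primitive_of u' u''].

(* An (unbounded) operator on L^2, given by its graph; T u v reads
   "u is in the domain and T u = v almost everywhere". *)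
Definition L2operator (R : realType) := (R -> R[i]) -> (R -> R[i]) -> Prop.

(* - d^2/dx^2 + V on {u in H^2(0, +oo) | u(0) = 0} *)
Definition dirichlet_schrodinger (R : realType) (V : R -> R) : L2operator R :=
  fun u v => exists u' u'' : R -> R[i],
    [/\ in_H2 u u' u'', u 0 = 0, in_L2 v &
        ae_half_line (fun x => v x = - u'' x + (V x)%:C * u x)].

(* The graph of T is the graph of its adjoint.  As a self-adjoint relation, T has
   a dense domain as soon as it is single-valued. *)
Definition self_adjoint (R : realType) (T : L2operator R) : Prop :=
  forall v w : R -> R[i], in_L2 v -> in_L2 w ->
    ((forall u Tu, T u Tu -> L2inner Tu v = L2inner u w) <->
     (exists v0, ae_half_line (fun x => v x = v0 x) /\ T v0 w)).

Definition eigenfunction (R : realType) (T : L2operator R)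
    (lambda : R[i]) (u : R -> R[i]) : Prop :=
  T u (fun x => lambda * u x) /\ ~ ae_half_line (fun x => u x = 0).

Definition eigenvalue_of (R : realType) (T : L2operator R) (lambda : R[i]) : Prop :=
  exists u, eigenfunction T lambda u.

(* the range of T - lambda *)
Definition shifted_range (R : realType) (T : L2operator R) (lambda : R[i]) :
    set (R -> R[i]) :=
  [set g | exists u, T u (fun x => g x + lambda * u x)].

(* T - lambda is injective, with a range that is dense in, but not equal to, L^2 *)
Definition continuous_spectrum (R : realType) (T : L2operator R) : set R[i] :=
  [set lambda |
    [/\ ~ eigenvalue_of T lambda,
        forall g, in_L2 g -> forall e : R, 0 < e ->
          exists h, [/\ shifted_range T lambda h, in_L2 h &
                        L2norm (fun x => g x - h x) < e]
      & ~ (forall g, in_L2 g -> shifted_range T lambda g)]].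

Definition potential (R : realType) (f : R -> R) (x : R) : R :=
  - (3 * f x ^+ 2 / sinh x ^+ 2).

Definition linearized_operator (R : realType) (f : R -> R) : L2operator R :=
  dirichlet_schrodinger (potential f).

Definition gauge_mode (R : realType) (f : R -> R) (x : R) : R := sinh x * derive1 f x.

(* Main.v *)
Require Import Defs.
From HB Require Import structures.
From mathcomp Require Import all_boot all_order all_algebra.
From mathcomp Require Import complex.
From mathcomp Require Import all_classical all_reals all_analysis.
From mathcomp Require Import measurable_realfun.
From mathcomp Require Import ring lra.
Import Order.TTheory GRing.Theory Num.Theory.
Import numFieldNormedType.Exports.

Set Implicit Arguments.
Unset Strict Implicit.
Unset Printing Implicit Defensive.

Local Open Scope classical_set_scope.
Local Open Scope complex_scope.
Local Open Scope ring_scope.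

(** Let q be the potential V = -3 f^2 / sinh^2, continued by its limit at 0 to a
    bounded continuous function on the line; it is O(e^{-2x}) because f is
    bounded. For real lambda let y be the regular solution: y'' = (q - lambda)
    y, y(0) = 0, y'(0) = 1. An eigenfunction for lambda is a multiple of y, so
    that lambda is an eigenvalue if and only if y is square integrable
    ([eigenvalueP]).

    Self-adjointness ([dirichlet_self_adjoint]). Since q is bounded, it suffices
    to treat -d^2/dx^2. If <-u'', v> = <u, w> for all u in the domain, one tests
    with u'' = -h, where h is v minus a suitable solution of z'' = -w, cut off,
    and gets that the integral of h^2 is 0; so v has two derivatives and v'' =
    -w.

    Continuous spectrum ([dirichlet_continuous_spectrum]). For lambda >= 0 a
    Gronwall argument with the integrable weight |q| shows that a solution that
    tends to 0 with its derivative vanishes, so lambda is not an eigenvalue. The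
    range of L - lambda is not everything, for the same reason, and it contains
    every h of compact support that is orthogonal to y; these are dense, y not
    being square integrable. For lambda off the half line some rotation (1 +
    ik)(-lambda) has positive real part, and then the solutions of the boundary
    value problems on [0, X] are bounded independently of X and have a limit
    that solves the equation on the half line ([resolvent_surjective]).

    Counting eigenvalues. The angle theta of (y', y) satisfies theta' = cos^2
    theta + (lambda - q) sin^2 theta. It is nondecreasing in lambda, and as a
    function of x it never comes back through a multiple of pi. Say that lambda
    reaches k if theta exceeds k pi somewhere. If some lambda < 0 reach k + 1,
    then their infimum is an eigenvalue that reaches k but not k + 1
    ([threshold_eigenvalue]); and if an eigenvalue reaches k, then every larger
    number reaches k + 1 ([reaches_step]). So k numbers the eigenvalues
    ([count_eigenvalues]), and it remains to see what -1 and 0 reach.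

    The gauge mode sinh f' solves the equation for lambda = -1 and is O(e^{-x}),
    so that -1 is an eigenvalue. Between 0 and the n zeros of f there are n
    zeros of f', so -1 reaches n. On the other hand 0 does not reach n + 2,
    whence -1 does not reach n + 1: between two consecutive zeros of the regular
    solution z for lambda = 0 there is a zero of f ([profile_zero_between]).
    Indeed W = z' f - z f' is negative on (0, oo) when f'(0) > 0, so that z / f
    decreases wherever f does not vanish. To see this, let X be a first zero of
    W. The equation is almost invariant under scaling: A = z (x f')' - z' (x f')
    satisfies A' = - tau W' with tau = x coth x - 1, so A + tau W, with
    derivative tau' W, decreases up to X and A(X) < 0. But A f^2 = - z f E at X,
    where E = x f'^2 - f f' + x f^4 / sinh^2 is nonnegative ([virial_ge0]);
    hence z f is positive just before X, where W' = - 2 f^2 / sinh^2 z f makes W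
    decrease, and W cannot vanish at X.

    For f_0 = sqrt 2 tanh the case n = 0 leaves -1 as the only eigenvalue. *)

(** * Derivatives and continuity in one variable *)

Section Calculus.
Variable R : realType.
Implicit Types (f g h : R -> R) (x y a b : R).

Definition ct f x := {for x, continuous f}.
Definition dd f x a := is_derive x (1:R) f a.

Lemma dcst a x : dd (fun=> a) x 0.
Proof. exact: is_derive_cst. Qed.

Lemma did x : dd (fun t : R => t) x 1.
Proof. exact: is_derive_id. Qed.

Lemma dadd f g x a b : dd f x a -> dd g x b ->
  dd (fun t => f t + g t) x (a + b).
Proof. exact: is_deriveD. Qed.

Lemma dopp f x a : dd f x a -> dd (fun t => - f t) x (- a).
Proof. exact: is_deriveN. Qed.

Lemma dmul f g x a b : dd f x a -> dd g x b ->
  dd (fun t => f t * g t) x (a * g x + f x * b).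
Proof.
move=> df dg; apply: (is_derive_eq (is_deriveM df dg)).
by rewrite /GRing.scale /= addrC [g x * a]mulrC.
Qed.

Lemma dexp f x a n : dd f x a ->
  dd (fun t => f t ^+ n) x (n%:R * f x ^+ n.-1 * a).
Proof.
rewrite /dd => df; apply: (@is_derive_eq R R R (fun t => f t ^+ n) x 1).
  rewrite (_ : (fun t => f t ^+ n) = f ^+ n); first exact: is_deriveX.
  by apply/funext => t; rewrite fctE.
by rewrite /GRing.scale /= -mulr_natl.
Qed.

Lemma dinv f x a : f x != 0 -> dd f x a ->
  dd (fun t => (f t)^-1) x (- a / f x ^+ 2).
Proof.
move=> fx0 df; apply: (is_derive_eq (is_deriveV fx0 df)).
by rewrite /GRing.scale /= !mulNr mulrC.
Qed.

Lemma dcomp f g x a b : dd f x a -> dd g (f x) b ->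
  dd (fun t => g (f t)) x (b * a).
Proof. move=> df dg; exact: (@is_derive1_comp R g f x b a). Qed.

Lemma dexpR f x a : dd f x a ->
  dd (fun t => expR (f t)) x (expR (f x) * a).
Proof. by move=> df; apply: (dcomp df); rewrite /dd; exact: is_derive_expR. Qed.

Lemma dcos f x a : dd f x a ->
  dd (fun t => cos (f t)) x (- sin (f x) * a).
Proof. by move=> df; apply: (dcomp df); rewrite /dd; exact: is_derive_cos. Qed.

Lemma dsin f x a : dd f x a ->
  dd (fun t => sin (f t)) x (cos (f x) * a).
Proof. by move=> df; apply: (dcomp df); rewrite /dd; exact: is_derive_sin. Qed.

Lemma deq f x a b : dd f x a -> a = b -> dd f x b.
Proof. by move=> df <-. Qed.

Lemma dnear f g x a : (\forall t \near x, f t = g t) ->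
  dd f x a -> dd g x a.
Proof. by rewrite /dd => fg; apply: near_eq_is_derive => //; rewrite ?oner_neq0. Qed.

Lemma dcont f x a : dd f x a -> ct f x.
Proof.
move=> [df _]; exact/differentiable_continuous/derivable1_diffP.
Qed.

Lemma cadd f g x : ct f x -> ct g x ->
  ct (fun t => f t + g t) x.
Proof. exact: continuousD. Qed.
Lemma copp f x : ct f x -> ct (fun t => - f t) x.
Proof. exact: continuousN. Qed.
Lemma cmul f g x : ct f x -> ct g x ->
  ct (fun t => f t * g t) x.
Proof. exact: continuousM. Qed.
Lemma ccomp f g x : ct f x -> ct g (f x) ->
  ct (fun t => g (f t)) x.
Proof. by move=> cf cg; exact: continuous_comp. Qed.
Lemma cexp f n x : ct f x -> ct (fun t => f t ^+ n) x.
Proof. by move=> cf; apply: (@ccomp f (fun t => t ^+ n)) => //; exact: exprn_continuous. Qed.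
Lemma cinv f x : f x != 0 -> ct f x ->
  ct (fun t => (f t)^-1) x.
Proof. by move=> fx cf; exact: cvgV. Qed.
Lemma ccst a x : ct (fun=> a : R) x.
Proof. exact: cvg_cst. Qed.
Lemma cid x : ct (fun t : R => t) x.
Proof. exact: cvg_id. Qed.
Lemma cexpR f x : ct f x -> ct (fun t => expR (f t)) x.
Proof. by move=> cf; apply: ccomp => //; exact: continuous_expR. Qed.
Lemma csin f x : ct f x -> ct (fun t => sin (f t)) x.
Proof. by move=> cf; apply: ccomp => //; exact: continuous_sin. Qed.
Lemma ccos f x : ct f x -> ct (fun t => cos (f t)) x.
Proof. by move=> cf; apply: ccomp => //; exact: continuous_cos. Qed.
Lemma cnorm f x : ct f x -> ct (fun t => `|f t|) x.
Proof. by move=> cf; apply: ccomp => //; exact: norm_continuous. Qed.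

Definition contin f := forall x, ct f x.

Lemma within_of_for f (A : set R) : (forall x, A x -> ct f x) ->
  {within A, continuous f}.
Proof.
by move=> cf; apply: continuous_in_subspaceT => x /set_mem /cf.
Qed.

Lemma mvt f f' a b : a < b ->
  (forall x, a < x < b -> dd f x (f' x)) ->
  (forall x, a <= x <= b -> ct f x) ->
  exists2 c, a < c < b & f b - f a = f' c * (b - a).
Proof.
move=> ab df cf.
have h1 x : x \in `]a, b[ -> dd f x (f' x) by rewrite in_itv; exact: df.
have h2 : {within `[a, b], continuous f}.
  by apply: within_of_for => x /=; rewrite in_itv; exact: cf.
have [c] := MVT ab h1 h2.
by rewrite in_itv /=; exists c.
Qed.

Lemma mono_le f f' a b : a <= b ->
  (forall x, a < x < b -> dd f x (f' x)) ->
  (forall x, a <= x <= b -> ct f x) ->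
  (forall x, a < x < b -> 0 <= f' x) -> f a <= f b.
Proof.
rewrite le_eqVlt => /predU1P[->//|ab] df cf f0.
have [c cab e] := mvt ab df cf.
by rewrite -subr_ge0 e mulr_ge0 ?f0 // subr_ge0 ltW.
Qed.

Lemma mono_lt f f' a b : a < b ->
  (forall x, a < x < b -> dd f x (f' x)) ->
  (forall x, a <= x <= b -> ct f x) ->
  (forall x, a < x < b -> 0 < f' x) -> f a < f b.
Proof.
move=> ab df cf f0.
have [c cab e] := mvt ab df cf.
by rewrite -subr_gt0 e mulr_gt0 ?f0 // subr_gt0.
Qed.

Lemma ivt f a b v : a <= b -> (forall x, a <= x <= b -> ct f x) ->
  f a <= v <= f b -> exists2 c, a <= c <= b & f c = v.
Proof.
move=> ab cf /andP[fa fb].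
have h2 : {within `[a, b], continuous f}.
  by apply: within_of_for => x /=; rewrite in_itv; exact: cf.
have := @IVT R f a b v ab h2.
rewrite ge_min fa le_max fb orbT => /(_ isT) [c].
by rewrite in_itv /=; exists c.
Qed.

End Calculus.

Ltac cnt := lazymatch goal with
  | |- ct (fun t => t) _ => apply cid
  | |- ct (fun _ => ?a) _ => apply ccst
  | |- ct (fun t => @?f t + @?g t) _ => apply (@cadd _ f g); cnt
  | |- ct (fun t => - @?f t) _ => apply (@copp _ f); cnt
  | |- ct (fun t => @?f t * @?g t) _ => apply (@cmul _ f g); cnt
  | |- ct (fun t => @?f t ^+ ?n) _ => apply (@cexp _ f n); cnt
  | |- ct (fun t => expR (@?f t)) _ => apply (@cexpR _ f); cnt
  | |- ct (fun t => sin (@?f t)) _ => apply (@csin _ f); cnt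
  | |- ct (fun t => cos (@?f t)) _ => apply (@ccos _ f); cnt
  | |- ct (fun t => `| @?f t |) _ => apply (@cnorm _ f); cnt
  | |- ct (GRing.mul ?c) _ => apply (@cmul _ (fun=> c) (fun t => t)); cnt
  | |- ct (GRing.add ?c) _ => apply (@cadd _ (fun=> c) (fun t => t)); cnt
  | |- ct GRing.opp _ => apply (@copp _ (fun t => t)); cnt
  | |- ct expR _ => apply (@cexpR _ (fun t => t)); cnt
  | |- _ => try solve [auto | match goal with H : contin ?f |- ct ?f _ => exact (H _) end]
  end.

(** Leaves the derivative as an existential variable, to be compared with the
    wanted value by [deq]; the derivatives of opaque functions are taken from
    the context. *)
Ltac der := lazymatch goal with
  | |- dd (fun t => t) _ _ => eapply did
  | |- dd (fun _ => ?a) _ _ => eapply dcst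
  | |- dd (fun t => @?f t + @?g t) _ _ => eapply (@dadd _ f g); der
  | |- dd (fun t => - @?f t) _ _ => eapply (@dopp _ f); der
  | |- dd (fun t => @?f t * @?g t) _ _ => eapply (@dmul _ f g); der
  | |- dd (fun t => @?f t ^+ ?n) _ _ => eapply (@dexp _ f _ _ n); der
  | |- dd (fun t => expR (@?f t)) _ _ => eapply (@dexpR _ f); der
  | |- dd (fun t => sin (@?f t)) _ _ => eapply (@dsin _ f); der
  | |- dd (fun t => cos (@?f t)) _ _ => eapply (@dcos _ f); der
  | |- dd (GRing.mul ?c) _ _ => eapply (@dmul _ (fun=> c) (fun t => t)); der
  | |- dd (GRing.add ?c) _ _ => eapply (@dadd _ (fun=> c) (fun t => t)); der
  | |- dd GRing.opp _ _ => eapply (@dopp _ (fun t => t)); der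
  | |- dd expR _ _ => eapply (@dexpR _ (fun t => t)); der
  | |- _ => try solve [eauto]
  end.

(** * Primitives *)

Section Primitive.
Variable R : realType.
Local Notation mu := (@lebesgue_measure R).
Local Notation H := (half_line R).
Implicit Types (p q f g : R -> R) (x y a b : R).

Lemma ae_imp (P Q : R -> Prop) : (forall x, P x -> Q x) ->
  {ae mu, forall x, P x} -> {ae mu, forall x, Q x}.
Proof. by move=> PQ; apply: negligibleS => x /= h /PQ. Qed.

Lemma ae_and (P Q : R -> Prop) : {ae mu, forall x, P x} ->
  {ae mu, forall x, Q x} -> {ae mu, forall x, P x /\ Q x}.
Proof.
move=> nP nQ; apply: negligibleS (negligibleU nP nQ) => x /=.
by move=> /not_andP.
Qed.

(** Integrates from 0, and is 0 to the left of 0: solutions become continuous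
    functions on the whole line that are differentiable on (0, oo), and no
    one-sided notion at 0 is needed. *)
Definition prim p x := \int[mu]_(t in `[0, x]) p t.
Definition integrable_on (D : set R) p := mu.-integrable D (EFin \o p).
Definition locint p := forall X, integrable_on `[0, X] p.

Lemma half_lineE : H = `[0, +oo[%classic.
Proof. by apply/seteqP; split => x /=; rewrite in_itv /= andbT. Qed.

Lemma measurable_half : measurable (H : set (measurableTypeR R)).
Proof. by rewrite half_lineE. Qed.

Lemma measurable_contin p (D : set R) : measurable (D : set (measurableTypeR R)) ->
  contin p -> measurable_fun (D : set (measurableTypeR R)) p.
Proof. by move=> mD cp; apply: measurable_funTS; exact: continuous_measurable_fun. Qed.

Lemma contin_integrable p x y : contin p -> integrable_on `[x, y] p.
Proof.
move=> cp; apply: continuous_compact_integrable; first exact: segment_compact.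
exact: continuous_subspaceT.
Qed.

Lemma contin_locint p : contin p -> locint p.
Proof. by move=> cp X; exact: contin_integrable. Qed.

Section intg.
Variables (D : set R) (mD : measurable (D : set (measurableTypeR R))).

Lemma intgD p q : integrable_on D p -> integrable_on D q ->
  integrable_on D (fun t => p t + q t).
Proof.
move=> ip iq; rewrite /integrable_on.
rewrite (_ : _ \o _ = (EFin \o p) \+ (EFin \o q)); first exact: integrableD.
by apply/funext => t /=; rewrite EFinD.
Qed.

Lemma intgZ k p : integrable_on D p -> integrable_on D (fun t => k * p t).
Proof.
move=> ip; rewrite /integrable_on.
rewrite (_ : _ \o _ = (fun t => k%:E * (EFin \o p) t)%E); first exact: integrableZl.
by apply/funext => t /=; rewrite EFinM.
Qed.

Lemma intgN p : integrable_on D p -> integrable_on D (fun t => - p t).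
Proof.
by move=> /(intgZ (-1)); congr integrable_on; apply/funext => t; rewrite mulN1r.
Qed.

Lemma intgB p q : integrable_on D p -> integrable_on D q ->
  integrable_on D (fun t => p t - q t).
Proof. by move=> ip iq; apply: intgD => //; exact: intgN. Qed.

Lemma intg_norm p : integrable_on D p -> integrable_on D (fun t => `|p t|).
Proof. exact: integrable_norm. Qed.

Lemma intg_le p q : measurable_fun (D : set (measurableTypeR R)) p ->
  (forall x, D x -> `|p x| <= q x) -> integrable_on D q -> integrable_on D p.
Proof.
move=> mp pq iq; apply: (le_integrable mD) iq => //.
  exact/measurable_EFinP.
move=> x Dx /=; rewrite lee_fin (le_trans (pq _ Dx)) ?ler_norm //.
Qed.

Lemma intg_meas p : integrable_on D p -> measurable_fun (D : set (measurableTypeR R)) p.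
Proof. by move=> /integrableP[/measurable_EFinP]. Qed.

Lemma intg_eq p q : (forall x, D x -> p x = q x) -> integrable_on D p ->
  integrable_on D q.
Proof.
move=> pq; apply: eq_integrable => // x /set_mem Dx /=; by rewrite pq.
Qed.

Lemma RintN p : integrable_on D p ->
  \int[mu]_(t in D) (- p t) = - \int[mu]_(t in D) p t.
Proof.
move=> ip; rewrite -mulN1r -RintegralZl //.
by apply: eq_Rintegral => t _; rewrite mulN1r.
Qed.

Lemma Rint_ae p q : measurable_fun (D : set (measurableTypeR R)) p ->
  measurable_fun (D : set (measurableTypeR R)) q ->
  {ae mu, forall x, D x -> p x = q x} ->
  \int[mu]_(t in D) p t = \int[mu]_(t in D) q t.
Proof.
move=> mp mq pq; congr fine; apply: ae_eq_integral => //.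
- exact/measurable_EFinP.
- exact/measurable_EFinP.
- by apply: ae_imp pq => x h Dx; rewrite /= h.
Qed.

End intg.

Lemma intgS (D E : set R) p : measurable (D : set (measurableTypeR R)) ->
  measurable (E : set (measurableTypeR R)) -> D `<=` E ->
  integrable_on E p -> integrable_on D p.
Proof. by move=> mD mE DE ip; exact: integrableS ip. Qed.

Lemma measurable_segment x y : measurable (`[x, y]%classic : set (measurableTypeR R)).
Proof. by []. Qed.
#[local] Hint Resolve measurable_segment measurable_half : core.

Lemma locint_half p : integrable_on H p -> locint p.
Proof.
move=> ip X; apply: intgS ip => // x /=; rewrite in_itv /= => /andP[].
by rewrite /half_line.
Qed.

Lemma locintD p q : locint p -> locint q -> locint (fun t => p t + q t).
Proof. by move=> ip iq X; exact: intgD. Qed.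
Lemma locintB p q : locint p -> locint q -> locint (fun t => p t - q t).
Proof. by move=> ip iq X; exact: intgB. Qed.
Lemma locintN p : locint p -> locint (fun t => - p t).
Proof. by move=> ip X; exact: intgN. Qed.
Lemma locintZ k p : locint p -> locint (fun t => k * p t).
Proof. by move=> ip X; exact: intgZ. Qed.
Lemma locint_norm p : locint p -> locint (fun t => `|p t|).
Proof. by move=> ip X; exact: intg_norm. Qed.

Lemma primD p q x : locint p -> locint q ->
  prim (fun t => p t + q t) x = prim p x + prim q x.
Proof. by move=> ip iq; apply: RintegralD => //; [exact: ip|exact: iq]. Qed.
Lemma primB p q x : locint p -> locint q ->
  prim (fun t => p t - q t) x = prim p x - prim q x.
Proof. by move=> ip iq; apply: RintegralB => //; [exact: ip|exact: iq]. Qed.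
Lemma primN p x : locint p -> prim (fun t => - p t) x = - prim p x.
Proof. by move=> ip; apply: RintN => //; exact: ip. Qed.
Lemma primZ k p x : locint p -> prim (fun t => k * p t) x = k * prim p x.
Proof. by move=> ip; apply: RintegralZl => //; exact: ip. Qed.

Lemma prim_eq p q x : (forall t, 0 <= t <= x -> p t = q t) -> prim p x = prim q x.
Proof.
by move=> pq; apply: eq_Rintegral => t /set_mem /=; rewrite in_itv; exact: pq.
Qed.

Lemma prim_neg p x : x <= 0 -> prim p x = 0.
Proof.
rewrite le_eqVlt => /predU1P[->|x0]; rewrite /prim.
  by rewrite set_itv1 Rintegral_set1.
by rewrite set_itv_ge ?Rintegral_set0 // -leNgt bnd_simp.
Qed.

Lemma prim0 p : prim p 0 = 0. Proof. exact: prim_neg. Qed.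

Lemma prim_incr p x y : 0 <= x <= y -> locint p ->
  prim p y - prim p x = \int[mu]_(t in `]x, y]) p t.
Proof.
move=> /andP[x0 xy] ip; rewrite /prim; apply: Rintegral_itvB; rewrite ?bnd_simp //; exact: ip.
Qed.

Lemma prim_incr_le p q x y : 0 <= x <= y -> locint p -> locint q ->
  (forall t, x < t <= y -> p t <= q t) ->
  prim p y - prim p x <= prim q y - prim q x.
Proof.
move=> xy ip iq pq; rewrite !prim_incr //.
have sub : `]x, y]%classic `<=` `[0, y]%classic.
  move=> t /=; rewrite !in_itv /= => /andP[xt ->]; rewrite andbT.
  by move: xy => /andP[x0 _]; lra.
apply: le_Rintegral => //; first exact: intgS (ip y).
exact: intgS (iq y).
Qed.

Lemma prim_le p q x : locint p -> locint q ->
  (forall t, 0 < t <= x -> p t <= q t) -> prim p x <= prim q x.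
Proof.
move=> ip iq pq; have [x0|x0] := leP 0 x; last by rewrite !prim_neg // ltW.
have := @prim_incr_le p q 0 x; rewrite lexx x0 !prim0 !subr0; exact.
Qed.

Lemma prim_ge0 p x : (forall t, 0 <= t <= x -> 0 <= p t) -> 0 <= prim p x.
Proof.
by move=> p0; apply: Rintegral_ge0 => t /=; rewrite in_itv; exact: p0.
Qed.

Lemma prim_incr_norm p x y : 0 <= x <= y -> locint p ->
  `|prim p y - prim p x| <= prim (fun t => `|p t|) y - prim (fun t => `|p t|) x.
Proof.
move=> xy ip; rewrite !prim_incr //; last exact: locint_norm.
apply: le_normr_Rintegral => //.
have sub : `]x, y]%classic `<=` `[0, y]%classic.
  move=> t /=; rewrite !in_itv /= => /andP[xt ->]; rewrite andbT.
  by move: xy => /andP[x0 _]; lra.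
exact: intgS (ip y).
Qed.

Lemma prim_ndecr p x y : x <= y -> locint p -> (forall t, 0 < t -> 0 <= p t) ->
  prim p x <= prim p y.
Proof.
move=> xy ip p0; have [x0|x0] := leP 0 x; last first.
  rewrite (@prim_neg _ x); last exact: ltW.
  have [y0|y0] := leP 0 y; last by rewrite prim_neg // ltW.
  have i0 : locint (fun=> 0) by apply: contin_locint => t; exact: ccst.
  have -> : 0 = prim (fun=> 0) y.
    rewrite -[LHS](mul0r (prim (fun=> 0) y)) -primZ //.
    by apply: prim_eq => t _; rewrite mul0r.
  by apply: prim_le => // t /andP[t0 _]; exact: p0.
rewrite -subr_ge0 prim_incr ?x0 //; apply: Rintegral_ge0 => t /=.
rewrite in_itv /= => /andP[xt _]; apply: p0; lra.
Qed.

Lemma prim_contin p : locint p -> contin (prim p).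
Proof.
move=> ip x.
have [x0|x0] := ltP x 0.
  apply: (@dcont _ _ x 0); apply: (@dnear _ (fun=> 0 : R)); last exact: dcst.
  near=> t; rewrite prim_neg // ltW //; near: t; exact: lt_nbhsl.
have c : {within `[0, x + 1], continuous (prim p)}.
  by apply: parameterized_integral_continuous; [lra|exact: ip].
have [x00|x00] := eqVneq x 0.
  subst x; apply/left_right_continuousP; split.
    rewrite prim0.
    apply: (@cvg_trans _ ((fun=> 0) @ 0^'-)); last exact: cvg_cst.
    apply: near_eq_cvg; near=> t.
    have t0 : t < 0 by near: t; exact: nbhs_left_lt.
    by rewrite prim_neg // ltW.
  have ab : (0:R) < 0 + 1 by lra.
  by move/(continuous_within_itvP _ ab) : c => [].
have xx : 0 < x < x + 1 by lra.
have ab : 0 < x + 1 by lra.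
by move/(continuous_within_itvP _ ab) : c => [+ _ _]; apply; rewrite in_itv.
Unshelve. all: by end_near. Qed.

Lemma prim_ftc p x : locint p -> 0 < x -> ct p x ->
  dd (prim p) x (p x).
Proof.
move=> ip x0 cp.
have x1 : x < x + 1 by rewrite ltrDl.
have [d e] := @continuous_FTC1_closed R p 0 x (x + 1) x1 (ip (x + 1)) x0 cp.
by apply: DeriveDef; [|rewrite -derive1E e].
Qed.

Lemma derive0_const f x : contin f ->
  (forall t : R, 0 < t -> dd f t 0) -> 0 <= x -> f x = f 0.
Proof.
move=> cf df; rewrite le_eqVlt => /predU1P[<-//|x0].
have [|t _|c _ /eqP] := @mvt R f (fun=> 0) 0 x x0.
- by move=> t /andP[t0 _]; exact: df.
- exact: cf.
- by rewrite mul0r subr_eq0 => /eqP.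
Qed.

Lemma prim_of_derive f f1 x : contin f -> locint f1 ->
  (forall t, 0 < t -> ct f1 t) ->
  (forall t : R, 0 < t -> dd f t (f1 t)) -> 0 <= x ->
  f x = f 0 + prim f1 x.
Proof.
move=> cf i1 c1 df x0.
suff : f x + - prim f1 x = f 0 + - prim f1 0.
  by rewrite prim0 oppr0 addr0 => <-; rewrite subrK.
apply: (@derive0_const (fun t => f t + - prim f1 t)) => //.
- by move=> t; apply: cadd => //; apply: copp; exact: prim_contin.
- move=> t t0; apply: deq; last exact: (subrr (f1 t)).
  by apply: dadd; [exact: df|apply: dopp; apply: prim_ftc => //; exact: c1].
Qed.

Lemma prim_ae p q x : locint p -> locint q ->
  ae_half_line (fun t => p t = q t) -> prim p x = prim q x.
Proof.
move=> ip iq pq; apply: Rint_ae => //; [exact: intg_meas|exact: intg_meas|].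
apply: ae_imp pq => t h /=; rewrite in_itv /= => /andP[t0 _]; exact: h.
Qed.

Lemma prim_cvg p : integrable_on H p ->
  prim p x @[x --> +oo] --> \int[mu]_(t in H) p t.
Proof.
move=> ip; apply/cvg_pinftyP => u uoo.
have mp : measurable_fun (H : set (measurableTypeR R)) p by exact: intg_meas.
have mpn n : measurable_fun (H : set (measurableTypeR R)) (p \_ `[0, u n]).
  apply/(measurable_restrict _ _ _).1 => //.
  by apply: measurable_funS mp => // x [].
have [|||||_ _ h] := @dominated_convergence _ (measurableTypeR R) R mu H measurable_half
  (fun n t => ((p \_ `[0, u n]) t)%:E) (EFin \o p) (fun t => `|p t|%:E).
- by move=> n; apply/measurable_EFinP.
- exact/measurable_EFinP.
- apply: aeW => t tH.
  apply: cvg_near_cst; near=> n.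
  rewrite /patch mem_set //= in_itv /=; apply/andP; split => //.
  near: n; exact: (cvgry_ge uoo).
- exact: intg_norm.
- apply: aeW => t n tH; rewrite /= lee_fin /patch; case: ifP => // _.
  by rewrite normr0.
have e2 : (\int[mu]_(x in H) p x)%:E = (\int[mu]_(x in H) (p x)%:E)%E.
  by rewrite /Rintegral fineK //; apply: integrable_fin_num.
have {}h := h : _ --> (\int[mu]_(x in H) (p x)%:E)%E.
rewrite -e2 in h; move/fine_cvgP : h => [_ h].
apply: cvg_trans h; apply: near_eq_cvg; apply: nearW => n /=.
rewrite /prim /Rintegral; congr fine.
have hE : `[0, u n]%classic = H `&` `[0, u n]%classic.
  apply/seteqP; split => [t ut|t [] //]; split => //.
  by move: ut; rewrite /= in_itv /= => /andP[].
rewrite [in RHS]hE integral_mkcondr; apply: eq_integral => t _; rewrite restrict_EFin //.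
Unshelve. all: by end_near. Qed.

End Primitive.

(** * Square integrable functions *)

Section L2.
Variable R : realType.
Local Notation mu := (@lebesgue_measure R).
Local Notation H := (half_line R).
Implicit Types (p q r f g : R -> R) (x y a b : R).
#[local] Hint Resolve measurable_segment measurable_half : core.

Lemma contin_bounded p X : contin p -> exists M, forall x, 0 <= x <= X -> `|p x| <= M.
Proof.
move=> cp; have [X0|X0] := leP 0 X; last first.
  by exists 0 => x /andP[? ?]; lra.
have [|c _ h] := @EVT_max R (fun t => `|p t|) 0 X X0.
  by apply: within_of_for => x _; exact: cnorm.
by exists `|p c| => x x0X; apply: h; rewrite in_itv.
Qed.

Lemma locintM p q : locint p -> contin q -> locint (fun t => p t * q t).
Proof.
move=> ip cq X; have [M hM] := contin_bounded X cq.
apply: (@intg_le _ _ _ _ (fun t => M * `|p t|)) => //.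
- apply: measurable_funM; first exact: intg_meas.
  exact: measurable_contin.
- move=> x /=; rewrite in_itv /= => xX; rewrite normrM mulrC.
  by rewrite ler_wpM2r // hM.
- by apply: intgZ => //; exact: intg_norm.
Qed.

Lemma locint_cst c : locint (fun=> c : R).
Proof.  by apply: contin_locint => t; exact: ccst. Qed.
#[local] Hint Resolve locint_cst : core.

Lemma prim_cst c x : 0 <= x -> prim (fun=> c) x = c * x.
Proof.
move=> x0; suff : (fun t => c * t) x = (fun t => c * t) 0 + prim (fun=> c) x.
  by rewrite /= mulr0 add0r => ->.
apply: prim_of_derive => //.
- by move=> t; cnt.
- by move=> t _; cnt.
- by move=> t _; apply: deq; [der|rewrite mul0r add0r mulr1].
Qed.

Lemma prim_le_half g x : integrable_on H g -> (forall t : R, 0 <= t -> 0 <= g t) ->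
  prim g x <= \int[mu]_(t in H) g t.
Proof.
move=> ig g0; apply: fine_le.
- by apply: integrable_fin_num => //; exact: locint_half.
- exact: integrable_fin_num.
apply: ge0_subset_integral => //.
- by apply/measurable_EFinP; exact: intg_meas.
- by move=> t /=; rewrite in_itv /= => /andP[].
Qed.

(** Monotone convergence along the segments [0, n]. *)
Lemma integrable_of_bound g B : measurable_fun (H : set (measurableTypeR R)) g ->
  locint g -> (forall t : R, 0 <= t -> 0 <= g t) -> (forall x : R, 0 <= x -> prim g x <= B) ->
  integrable_on H g.
Proof.
move=> mg ig g0 gB; apply/integrableP; split; first exact/measurable_EFinP.
have e : \bigcup_n `[0, n%:R]%classic = H.
  apply/seteqP; split => [x [n _]|x x0]; first by rewrite /= in_itv /= => /andP[].
  exists (Num.bound x) => //=; rewrite in_itv /=; apply/andP; split => //.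
  exact/ltW/archi_boundP.
rewrite -e.
have c : (\int[mu]_(x in `[0%R, n%:R]%classic) `|(g x)%:E| @[n --> \oo] -->
    \int[mu]_(x in \bigcup_n `[0%R, n%:R]%classic) `|(g x)%:E|)%E.
  apply: (@ge0_nondecreasing_set_cvg_integral _ (measurableTypeR R) R
    (fun n => `[0, n%:R]%classic) (fun x => `|(g x)%:E|%E) mu) => //.
  - move=> m n mn; apply/subsetPset => x /=; rewrite !in_itv /= => /andP[-> xm] /=.
    by rewrite (le_trans xm) // ler_nat.
  - move=> n; apply/measurable_EFinP; apply: measurableT_comp => //.
    by apply: intg_meas; exact: ig.
rewrite -(cvg_lim _ c) //; apply: (@le_lt_trans _ _ B%:E); last by rewrite ltry.
apply: lime_le; first by apply/cvg_ex; eexists; exact: c.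
apply: nearW => n.
have : prim g n%:R <= B by apply: gB.
rewrite -lee_fin; apply: le_trans.
rewrite /prim /Rintegral fineK; last by apply: integrable_fin_num => //; exact: ig.
rewrite le_eqVlt; apply/orP; left; apply/eqP; apply: eq_integral => t.
by rewrite inE /= in_itv /= => /andP[t0 _]; rewrite ger0_norm // g0.
Qed.

Definition L2 p := measurable_fun (H : set (measurableTypeR R)) p /\
  integrable_on H (fun t => p t ^+ 2).

Lemma L2_mul_int p q : L2 p -> L2 q -> integrable_on H (fun t => p t * q t).
Proof.
move=> [mp ip] [mq iq].
apply: (@intg_le _ _ _ _ (fun t => p t ^+ 2 + q t ^+ 2)) => //.
- exact: measurable_funM.
- move=> x _; rewrite ler_norml; apply/andP; split; nra.
- exact: intgD.
Qed.

Lemma L2D p q : L2 p -> L2 q -> L2 (fun t => p t + q t).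
Proof.
move=> [mp ip] [mq iq]; split; first exact: measurable_funD.
apply: (@intg_le _ _ _ _ (fun t => 2 * (p t ^+ 2) + 2 * q t ^+ 2)) => //.
- by apply: measurable_funX; exact: measurable_funD.
- move=> x _; rewrite ger0_norm ?sqr_ge0 //; have := sqr_ge0 (p x - q x); nra.
- by apply: intgD => //; exact: intgZ.
Qed.

Lemma L2_bmul p q K : measurable_fun (H : set (measurableTypeR R)) q ->
  (forall x : R, 0 <= x -> `|q x| <= K) -> L2 p -> L2 (fun t => q t * p t).
Proof.
move=> mq qK [mp ip]; split; first exact: measurable_funM.
apply: (@intg_le _ _ _ _ (fun t => K ^+ 2 * (p t ^+ 2))) => //.
- by apply: measurable_funX; exact: measurable_funM.
- move=> x x0; rewrite ger0_norm ?sqr_ge0 // exprMn ler_wpM2r ?sqr_ge0 //.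
  by rewrite -(real_normK (num_real (q x))) ler_sqr ?nnegrE // ?qK // (le_trans _ (qK x x0)).
- exact: intgZ.
Qed.

Lemma L2Z k p : L2 p -> L2 (fun t => k * p t).
Proof.  by apply: (@L2_bmul _ _ `|k|). Qed.

Lemma L2N p : L2 p -> L2 (fun t => - p t).
Proof.  by move=> /(L2Z (-1)); congr L2; apply/funext => t; rewrite mulN1r. Qed.

Lemma L2B p q : L2 p -> L2 q -> L2 (fun t => p t - q t).
Proof.  by move=> hp /L2N; exact: L2D. Qed.

Lemma L2_eq p q : (forall x : R, 0 <= x -> p x = q x) -> L2 p -> L2 q.
Proof.
move=> pq [mp ip]; split.
  by apply: eq_measurable_fun mp => x /set_mem; exact: pq.
by apply: intg_eq ip => // x x0; rewrite pq.
Qed.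

Definition locL2 p := locint p /\ locint (fun t => p t ^+ 2).

Lemma L2_locL2 p : L2 p -> locL2 p.
Proof.
move=> [mp ip]; split; last exact: locint_half.
move=> X; apply: (@intg_le _ _ _ _ (fun t => 1 + p t ^+ 2)) => //.
- by apply: measurable_funS mp => // x /=; rewrite in_itv /= => /andP[].
- move=> x _; rewrite ler_norml; apply/andP; split; nra.
- by apply: intgD => //; [exact: locint_cst|exact: locint_half].
Qed.

Lemma contin_locL2 p : contin p -> locL2 p.
Proof.
by move=> cp; split; apply: contin_locint => // t; apply: cexp; exact: cp.
Qed.

Section product.
Variables (p q : R -> R) (a b : R).
Hypotheses (lp : locL2 p) (lq : locL2 q).
Let P x := a + prim p x.
Let Q x := b + prim q x.
Let gam := prim (fun t => p t ^+ 2 + q t ^+ 2).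

Let cP : contin P. Proof.  by move=> x; rewrite /P; cnt; exact: (prim_contin lp.1). Qed.
Let cQ : contin Q. Proof.  by move=> x; rewrite /Q; cnt; exact: (prim_contin lq.1). Qed.

Let cauchy_schwarz u x y : locL2 u -> 0 <= x < y ->
  (prim (fun t => `|u t|) y - prim (fun t => `|u t|) x) ^+ 2 <=
  (y - x) * (prim (fun t => u t ^+ 2) y - prim (fun t => u t ^+ 2) x).
Proof.
move=> [iu iu2] /andP[x0 xy].
have in_ := locint_norm iu.
set A := _ - _; set m := A / (y - x).
have yx : 0 < y - x by rewrite subr_gt0.
have xy' : 0 <= x <= y by rewrite x0 ltW.
have := @prim_incr_le _ (fun t => 2 * m * `|u t|) (fun t => u t ^+ 2 + m ^+ 2) x y xy'.
rewrite !primZ // !primD // !prim_cst //; last by rewrite (le_trans x0) // ltW.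
move=> /(_ (locintZ _ in_) (locintD iu2 (locint_cst _))).
have h t : x < t <= y -> 2 * m * `|u t| <= u t ^+ 2 + m ^+ 2.
  by move=> _; rewrite -(real_normK (num_real (u t))); have := sqr_ge0 (`|u t| - m); nra.
move=> /(_ h); rewrite -mulrBr -/A.
set B := prim _ y - prim _ x; rewrite [X in _ <= X -> _](_ : _ = B + m ^+ 2 * (y - x)).
  move=> h2; have e : m * (y - x) = A by rewrite /m divfK // gt_eqF.
  rewrite -e; rewrite -e in h2; nra.
by rewrite /B; ring.
Qed.

Let est x y : 0 <= x < y ->
  `|(P y * Q y - prim (fun t => p t * Q t + q t * P t) y) -
    (P x * Q x - prim (fun t => p t * Q t + q t * P t) x)| <=
  3 * (y - x) * (gam y - gam x).
Proof.
move=> xy; have [ip ip2] := lp; have [iq iq2] := lq.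
have xy' : 0 <= x <= y by case/andP: xy => -> /ltW ->.
have inp := locint_norm ip; have inq := locint_norm iq.
set al := prim (fun t => `|p t|) y - prim (fun t => `|p t|) x.
set be := prim (fun t => `|q t|) y - prim (fun t => `|q t|) x.
have al2 := cauchy_schwarz lp xy; have be2 := cauchy_schwarz lq xy.
rewrite -/al -/be in al2 be2.
have -> : gam y - gam x = (prim (fun t => p t ^+ 2) y - prim (fun t => p t ^+ 2) x) +
  (prim (fun t => q t ^+ 2) y - prim (fun t => q t ^+ 2) x).
  by rewrite /gam !primD //; ring.
have hP : `|P y - P x| <= al by rewrite /P opprD addrACA subrr add0r; exact: prim_incr_norm.
have hQ : `|Q y - Q x| <= be by rewrite /Q opprD addrACA subrr add0r; exact: prim_incr_norm.
have one u v (U := fun t => (prim v t)) c : locint u -> locint v -> contin (fun t => c + U t) ->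
  `|(prim (fun t => u t * (c + U t)) y - prim (fun t => u t * (c + U t)) x)
    - (c + U x) * (prim u y - prim u x)| <=
  (prim (fun t => `|u t|) y - prim (fun t => `|u t|) x) *
  (prim (fun t => `|v t|) y - prim (fun t => `|v t|) x).
  move=> iu iv cU.
  have inu := locint_norm iu; have inv_ := locint_norm iv.
  set w := prim (fun t => `|v t|) y - _.
  have iuU := locintM iu cU.
  have k t : x < t <= y -> `|(c + U t) - (c + U x)| <= w.
    move=> /andP[xt ty]; rewrite opprD addrACA subrr add0r.
    have xt' : 0 <= x <= t by case/andP: xy' => -> _; rewrite ltW.
    apply: (le_trans (prim_incr_norm xt' iv)); rewrite lerB //.
    by apply: prim_ndecr.
  have e : (prim (fun t => u t * (c + U t)) y - prim (fun t => u t * (c + U t)) x)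
    - (c + U x) * (prim u y - prim u x) =
    prim (fun t => u t * (c + U t) - (c + U x) * u t) y -
    prim (fun t => u t * (c + U t) - (c + U x) * u t) x.
    by rewrite !primB ?primZ //; [ring|exact: locintZ..].
  have iA : locint (fun t => u t * (c + U t) - (c + U x) * u t).
    by apply: locintB => //; exact: locintZ.
  rewrite e; apply: (le_trans (prim_incr_norm xy' iA)).
  rewrite mulrC -/w mulrBr -!primZ //.
  apply: prim_incr_le => //; [exact: locint_norm|exact: locintZ|].
  by move=> t /k kt; rewrite [u t * _]mulrC -mulrBl normrM ler_wpM2r.
have iPQ := locintM ip cQ; have iQP := locintM iq cP.
have o1 := one p q b ip iq cQ; have o2 := one q p a iq ip cP.
rewrite -/al -/be -/(Q x) -/(P x) in o1 o2.
rewrite !primD //.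
have ep : prim p y - prim p x = P y - P x by rewrite /P; ring.
have eq_ : prim q y - prim q x = Q y - Q x by rewrite /Q; ring.
rewrite ep in o1; rewrite eq_ in o2.
set B1 := prim _ y - prim _ x in al2 *; set B2 := prim _ y - prim _ x in be2 *.
move: (prim (fun t => p t * Q t) y) (prim (fun t => p t * Q t) x)
  (prim (fun t => q t * P t) y) (prim (fun t => q t * P t) x) o1 o2
  => u1 u2 v1 v2; set A1 := u1 - u2; set A2 := v1 - v2 => o1 o2.
rewrite [X in `|X|](_ : _ = - (A1 - Q x * (P y - P x)) - (A2 - P x * (Q y - Q x))
   + (P y - P x) * (Q y - Q x)); last first.
  rewrite /A1 /A2; move: (P x) (Q x) (P y) (Q y) => *; ring.
have k3 : `|(P y - P x) * (Q y - Q x)| <= al * be.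
  by rewrite normrM ler_pM.
have : `|- (A1 - Q x * (P y - P x)) - (A2 - P x * (Q y - Q x))
   + (P y - P x) * (Q y - Q x)| <= al * be + be * al + al * be.
  rewrite (le_trans (ler_normD _ _)) // lerD //.
  by rewrite (le_trans (ler_normB _ _)) // normrN lerD.
have := sqr_ge0 (al - be); nra.
Qed.

(** Integration by parts when the derivatives are only locally square
    integrable. By Cauchy-Schwarz, the increment over [x, y] of the difference
    of the two sides is at most 3 (y - x) times that of the integral of p^2 +
    q^2; summed over n equal steps this is O(1/n). *)
Lemma prim_mul x : 0 <= x ->
  (a + prim p x) * (b + prim q x) =
  a * b + prim (fun t => p t * (b + prim q t) + q t * (a + prim p t)) x.
Proof.
move=> x0; rewrite -/(P x) -/(Q x).
set D := fun x => P x * Q x - prim (fun t => p t * Q t + q t * P t) x.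
suff e : D x = D 0.
  by rewrite -[LHS](subrK (prim (fun t => p t * Q t + q t * P t) x)) -/(D x) e
    /D /P /Q !prim0 !addr0 subr0.
have gge y z : y <= z -> gam y <= gam z.
  move=> yz; apply: prim_ndecr => //; first by apply: locintD; [case: lp|case: lq].
  by move=> t _; rewrite addr_ge0 // sqr_ge0.
have step (n k : nat) : `|D (k%:R * (x / n.+1%:R)) - D 0| <=
    3 * (x / n.+1%:R) * (gam (k%:R * (x / n.+1%:R)) - gam 0).
  have d0 : 0 <= x / n.+1%:R by rewrite divr_ge0.
  elim: k => [|k IH]; first by rewrite mul0r !subrr normr0 mulr0.
  have [dz|dz] := eqVneq (x / n.+1%:R) 0.
    by rewrite dz !mulr0 !subrr normr0 mul0r.
  have d1 : 0 < x / n.+1%:R by rewrite lt_neqAle eq_sym dz.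
  have kd : 0 <= k%:R * (x / n.+1%:R) < k.+1%:R * (x / n.+1%:R).
    by rewrite mulr_ge0 //= ltr_pM2r // ltr_nat.
  have e := est kd.
  have e2 : k.+1%:R * (x / n.+1%:R) - k%:R * (x / n.+1%:R) = x / n.+1%:R.
    by rewrite -mulrBl -natrB // subSnn mul1r.
  rewrite e2 in e.
  rewrite -(subrKA (D (k%:R * (x / n.+1%:R)))) (le_trans (ler_normD _ _)) //.
  by rewrite (le_trans (lerD e IH)) // -mulrDr addrA subrK.
have fin n : `|D x - D 0| <= 3 * x * (gam x - gam 0) / n.+1%:R.
  have := step n n.+1; rewrite mulrCA divff ?pnatr_eq0 // mulr1.
  by move/le_trans; apply; rewrite le_eqVlt; apply/orP; left; apply/eqP; ring.
apply/eqP; rewrite -subr_eq0 -normr_le0; apply/ler_addgt0Pl => e e0; rewrite addr0.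
set K := 3 * x * (gam x - gam 0) in fin.
have K0 : 0 <= K by rewrite !mulr_ge0 // subr_ge0 gge.
apply: (le_trans (fin (Num.bound (K / e)))).
rewrite ler_pdivrMr ?ltr0n // mulrC -ler_pdivrMr //.
have := archi_boundP (divr_ge0 K0 (ltW e0)) => h.
by rewrite (le_trans (ltW h)) // ler_nat.
Qed.

End product.
End L2.

(** * Behaviour at infinity *)

Section Tail.
Variable R : realType.
Local Notation mu := (@lebesgue_measure R).
Local Notation H := (half_line R).
Implicit Types (p q r f g P Q : R -> R) (x y a b : R).
#[local] Hint Resolve measurable_segment measurable_half : core.
#[local] Hint Resolve locint_cst : core.

Lemma near_pinfty_ex (A : R -> Prop) : (\forall x \near +oo, A x) ->
  exists2 N, 0 <= N & forall x, N <= x -> A x.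
Proof.
move=> [M [_ hM]]; exists (Num.max 0 (M + 1)); first by rewrite le_max lexx.
by move=> x; rewrite ge_max => /andP[_ xM]; apply: hM; lra.
Qed.

Lemma near_pinfty_in N (A : R -> Prop) : (forall x, N <= x -> A x) ->
  \forall x \near +oo, A x.
Proof. by move=> h; exists N; split; [exact: num_real|move=> x /ltW; exact: h]. Qed.

Lemma cvgy_eq f g (l : R) : (forall x : R, 0 <= x -> f x = g x) ->
  f x @[x --> +oo] --> l -> g x @[x --> +oo] --> l.
Proof.
by move=> fg; apply: cvg_trans; apply: near_eq_cvg; apply: (@near_pinfty_in 0) => x x0; exact: fg.
Qed.

Lemma cvgy_dist f (l : R) : f x @[x --> +oo] --> l -> forall e, 0 < e ->
  exists2 N, 0 <= N & forall x, N <= x -> `|f x - l| < e.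
Proof.
move=> /cvgrPdist_lt h e /h /near_pinfty_ex [N N0 k]; exists N => // x /k.
by rewrite distrC.
Qed.

Lemma dist_cvgy f (l : R) : (forall e, 0 < e ->
  exists N, forall x, N <= x -> `|f x - l| < e) -> f x @[x --> +oo] --> l.
Proof.
move=> h; apply/cvgrPdist_lt => e /h [N k]; apply: (@near_pinfty_in N) => x /k.
by rewrite distrC.
Qed.

Definition is_primitive P p := forall x, 0 <= x -> P x = P 0 + prim p x.

Lemma is_primitive_mul P Q p q : is_primitive P p -> is_primitive Q q -> locL2 p -> locL2 q ->
  is_primitive (fun t => P t * Q t) (fun t => p t * Q t + q t * P t).
Proof.
move=> hP hQ lp lq x x0.
rewrite hP // hQ // prim_mul //; congr (_ + _); apply: prim_eq => t /andP[t0 _].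
by rewrite -hP // -hQ.
Qed.

Lemma prim_unbounded g c N B : locint g -> 0 < c -> 0 <= N ->
  (forall t, 0 <= t -> 0 <= g t) -> (forall t, N <= t -> c <= g t) ->
  exists2 x, 0 <= x & B < prim g x.
Proof.
move=> ig c0 N0 g0 gc.
set x := N + (`|B| + 1) / c.
have d0 : 0 < (`|B| + 1) / c by rewrite divr_gt0 // ltr_wpDl.
exists x; first by rewrite addr_ge0 // ltW.
have xN : 0 <= N <= x by rewrite N0 lerDl ltW.
have := @prim_incr_le _ (fun=> c) g N x xN (locint_cst c) ig.
rewrite !prim_cst ?addr_ge0 ?(ltW d0) // => h.
have {h} : c * x - c * N <= prim g x - prim g N.
  by apply: h => t /andP[/ltW Nt _]; exact: gc.
have -> : c * x - c * N = `|B| + 1.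
  by rewrite /x mulrDr mulrCA divff ?gt_eqF // mulr1; ring.
have : 0 <= prim g N by apply: prim_ge0 => t /andP[t0 _]; exact: g0.
have := ler_norm B; lra.
Qed.

(** P^2 has the integrable derivative 2 P p, so it converges; its limit is 0
    because P^2 is integrable. *)
Lemma H1_vanishes_at_infinity P p : is_primitive P p -> L2 P -> L2 p -> P x @[x --> +oo] --> 0.
Proof.
move=> hP LP Lp.
have lp := L2_locL2 Lp; have lP := L2_locL2 LP.
have hPP := is_primitive_mul hP hP lp lp.
set g := (fun t => p t * P t + p t * P t) in hPP.
have ig : integrable_on H g by apply: intgD => //; exact: L2_mul_int.
have c1 : prim g x @[x --> +oo] --> \int[mu]_(t in H) g t by exact: prim_cvg.
set l := P 0 * P 0 + \int[mu]_(t in H) g t.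
have c2 : P x * P x @[x --> +oo] --> l.
  apply: cvgy_eq (cvgD (cvg_cst (P 0 * P 0)) c1) => x x0.
  by rewrite /= [RHS]hPP.
have l0 : l = 0.
  apply/eqP; apply: contrapT => /negP l0.
  have l2 : 0 < `|l| / 2 by rewrite divr_gt0 // normr_gt0.
  have [N N0 hN] := cvgy_dist c2 l2.
  have hc x : N <= x -> `|l| / 2 <= P x ^+ 2.
    move=> /hN; rewrite -expr2; have := sqr_ge0 (P x).
    rewrite ltr_norml => sq /andP[h1 h2]; move: h1 h2.
    by have [l3|l3] := leP 0 l; [rewrite ger0_norm //|rewrite ltr0_norm //]; lra.
  have sq0 t : 0 <= t -> 0 <= P t ^+ 2 by move=> _; exact: sqr_ge0.
  have [x x0] := @prim_unbounded _ _ _ (\int[mu]_(t in H) P t ^+ 2) lP.2 l2 N0 sq0 hc.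
  by rewrite ltNge prim_le_half //; exact: LP.2.
apply: dist_cvgy => e e0.
have e2 : 0 < e ^+ 2 by rewrite exprn_gt0.
have [N _ hN] := cvgy_dist c2 e2; exists N => x /hN.
rewrite l0 !subr0 -expr2 normrX => h.
by rewrite ltNge; apply/negP => h2; move: h; rewrite ltNge ler_sqr ?nnegrE // ?h2 // ltW.
Qed.

(** P P' is the integral of P'^2 + P P'' up to a constant. If the integral of
    P'^2 were infinite, P P' would eventually be at least 1 and P^2 would grow
    linearly. *)
Lemma L2_interpolation P P1 r : is_primitive P P1 -> is_primitive P1 r -> L2 P -> L2 r ->
  L2 P1.
Proof.
move=> hP hP1 LP Lr.
have lr := L2_locL2 Lr; have lP := L2_locL2 LP.
pose P1' t := P1 0 + prim r t.
have cP1' : contin P1' by move=> t; rewrite /P1'; cnt; exact: (prim_contin lr.1).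
have e1 t : 0 <= t -> P1' t = P1 t by move=> t0; rewrite [RHS]hP1.
have lP1 : locL2 P1'. by exact: contin_locL2.
have hP' : is_primitive P P1'.
  by move=> x x0; rewrite hP //; congr (_ + _); apply: prim_eq => t /andP[t0 _]; rewrite e1.
have hP1' : is_primitive P1' r by move=> x x0; rewrite /P1' prim0 addr0.
apply: (L2_eq e1); split; first exact: measurable_contin.
have hPP1 := is_primitive_mul hP' hP1' lP1 lr.
have hPP := is_primitive_mul hP' hP' lP1 lP1.
have iPr : integrable_on H (fun t => `|P t * r t|).
  by apply: intg_norm => //; exact: L2_mul_int.
set K := \int[mu]_(t in H) `|P t * r t|.
set J := prim (fun t => P1' t ^+ 2).
have sq0 t : 0 <= t -> 0 <= P1' t ^+ 2 by move=> _; exact: sqr_ge0.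
have ilow x : 0 <= x -> P 0 * P1' 0 + J x - K <= P x * P1' x.
  move=> x0; rewrite [leRHS]hPP1 // -addrA lerD2l.
  have iPr' : locint (fun t => r t * P t).
    by apply: locint_half; apply: L2_mul_int.
  have e : prim (fun t => P1' t * P1' t + r t * P t) x = J x + prim (fun t => r t * P t) x.
    have i1 : locint (fun t => P1' t * P1' t).
      by have := lP1.2; congr locint; apply/funext => t; rewrite expr2.
    by rewrite (primD _ i1 iPr'); congr (_ + _); apply: prim_eq => t _; rewrite expr2.
  rewrite e lerD2l.
  apply: (@le_trans _ _ (- prim (fun t => `|P t * r t|) x)).
    by rewrite lerN2; apply: prim_le_half.
  rewrite -primN; last exact: locint_half.
  apply: prim_le => //; first by apply: locintN; exact: locint_half.
  by move=> t _; rewrite [r t * _]mulrC lerNl -normrN ler_norm.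
have [B hB] : exists B, forall x, 0 <= x -> J x <= B.
  apply: contrapT => /forallNP unb.
  have /existsNP [x1] := unb (K + 1 - P 0 * P1' 0).
  move=> /not_implyP[x10 /negP]; rewrite -ltNge => hx1.
  have big x : x1 <= x -> 1 <= P x * P1' x.
    move=> x1x; have x0 : 0 <= x by rewrite (le_trans x10).
    apply: le_trans (ilow x x0).
    have : J x1 <= J x by apply: prim_ndecr => // [|t /ltW]; [exact: lP1.2|exact: sq0].
    by lra.
  have gro x : x1 + 1 <= x -> 2 <= P x ^+ 2.
    move=> x1x; have x0 : 0 <= x by lra.
    have x1x' : 0 <= x1 <= x by apply/andP; split; lra.
    rewrite expr2 hPP //.
    have ii : locint (fun t => P1' t * P t + P1' t * P t).
      have i : locint (fun t => P t * P1' t) by exact: (locintM lP.1 cP1').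
      have : locint (fun t => P1' t * P t).
        by move: i; congr locint; apply/funext => t; rewrite mulrC.
      by move=> i2; exact: locintD.
    have := @prim_incr_le _ (fun=> 2) _ x1 x x1x' (locint_cst 2) ii.
    rewrite !prim_cst // => h.
    have {h} := h _; set A := prim _ x; set A1 := prim _ x1 => h.
    have {h} : 2 * x - 2 * x1 <= A - A1.
      by apply: h => t /andP[/ltW /big + _]; rewrite mulrC; lra.
    have := hPP _ x10; rewrite -/A1 => e.
    have := sqr_ge0 (P x1); rewrite expr2 e; lra.
  have h2 : 0 < 2 :> R by [].
  have N0 : 0 <= x1 + 1 by lra.
  have sq1 t : 0 <= t -> 0 <= P t ^+ 2 by move=> _; exact: sqr_ge0.
  have [x x0] := @prim_unbounded _ _ _ (\int[mu]_(t in H) P t ^+ 2) lP.2 h2 N0 sq1 gro.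
  by rewrite ltNge prim_le_half //; exact: LP.2.
apply: integrable_of_bound hB => //; last exact: lP1.2.
by apply: measurable_funX; exact: measurable_contin.
Qed.

End Tail.

(** * Picard iteration *)

Section Picard.
Variable R : realType.
Implicit Types (x : R).

Lemma geometric_small (C e : R) : 0 <= C -> 0 < e -> exists n, C / 2 ^+ n < e.
Proof.
move=> C0 e0; exists (Num.bound (C / e)).
rewrite ltr_pdivrMr ?exprn_gt0 // mulrC -ltr_pdivrMr //.
apply: (lt_le_trans (archi_boundP (divr_ge0 C0 (ltW e0)))).
by rewrite -natrX ler_nat ltnW // ltn_expl.
Qed.

Lemma geometric_lim (u : nat -> R) (C : R) :
  (forall n, `|u n.+1 - u n| <= C / 2 ^+ n) ->
  forall n, `|lim (u @ \oo) - u n| <= 2 * C / 2 ^+ n.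
Proof.
move=> hu.
have C0 : 0 <= C by have := hu 0; rewrite expr0 divr1; apply: le_trans.
have p2 n : 0 < (2 : R) ^+ n by rewrite exprn_gt0.
have tel n k : `|u (n + k)%N - u n| <= 2 * C / 2 ^+ n - 2 * C / 2 ^+ (n + k).
  elim: k => [|k IH]; first by rewrite addn0 !subrr normr0.
  rewrite addnS -(subrKA (u (n + k)%N)) (le_trans (ler_normD _ _)) //.
  rewrite (le_trans (lerD (hu _) IH)) // exprS.
  have := p2 (n + k)%N; move: ((2:R) ^+ (n + k)) => z z0.
  rewrite invfM; have -> : 2 * C * (2^-1 / z) = C / z by field; rewrite gt_eqF.
  lra.
have bnd n k : `|u (n + k)%N - u n| <= 2 * C / 2 ^+ n.
  by apply: (le_trans (tel n k)); rewrite lerBlDr lerDl divr_ge0 ?mulr_ge0 // ltW.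
have cu : cvg (u @ \oo).
  apply: cauchy_cvg; apply/cauchy_exP => e e0.
  have [n hn] := geometric_small (mulr_ge0 (ler0n R 2) C0) e0.
  exists (u n); exists n => // k /= nk.
  rewrite /ball /= distrC; apply: le_lt_trans hn.
  by rewrite -(subnKC nk).
move=> n; rewrite distrC.
have c2 : `|u n - u k| @[k --> \oo] --> `|u n - lim (u @ \oo)|.
  by apply: cvg_norm; apply: cvgB => //; exact: cvg_cst.
rewrite -(cvg_lim (@Rhausdorff R) c2); apply: limr_le.
  by apply/cvg_ex; eexists; exact: c2.
by exists n => // k /= nk; rewrite distrC -(subnKC nk).
Qed.

Variables (m : nat) (F : 'I_m -> R -> ('I_m -> R) -> R) (K : R) (y0 : 'I_m -> R).
Hypothesis K0 : 0 <= K.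
Hypothesis Fc : forall y : 'I_m -> R -> R, (forall i, contin (y i)) ->
  forall i, contin (fun s => F i s (fun j => y j s)).
Hypothesis FL : forall i s a b, 0 <= s ->
  `|F i s a - F i s b| <= K * \sum_j `|a j - b j|.

Fixpoint picard_iter n (i : 'I_m) x : R := match n with
  | 0 => y0 i
  | n'.+1 => y0 i + prim (fun s => F i s (fun j => picard_iter n' j s)) x
  end.

Let cY n : forall i, contin (picard_iter n i).
Proof.
elim: n => [|n IH] i x /=; cnt.
by apply: prim_contin; apply: contin_locint; exact: Fc.
Qed.

Let iY n i : locint (fun s => F i s (fun j => picard_iter n j s)).
Proof. by apply: contin_locint; apply: Fc; exact: cY. Qed.

Let Yneg n i x : x <= 0 -> picard_iter n i x = y0 i.
Proof. by case: n => //= n x0; rewrite prim_neg ?addr0. Qed.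

Let L := m%:R * K + 1.
Let L0 : 0 < L. Proof. by rewrite ltr_wpDl // mulr_ge0. Qed.

Lemma prim_expR (c x : R) : c != 0 -> 0 <= x ->
  prim (fun s => expR (c * s)) x = (expR (c * x) - 1) / c.
Proof.
move=> c0 x0.
have ce : contin (fun s => expR (c * s)) by move=> t; cnt.
have h : forall f : R -> R, f = (fun t => expR (c * t) / c) ->
  f x = f 0 + prim (fun s => expR (c * s)) x.
  move=> f ->; apply: (@prim_of_derive R (fun t => expR (c*t)/c) (fun s => expR (c*s)) x) => //; first by move=> t; cnt.
  - exact: contin_locint.
  - by move=> t _; apply: deq; [der|field].
by have := h _ erefl; rewrite mulr0 expR0 mulrBl => ->; ring.
Qed.

Let locY X : exists2 C, 0 <= C & forall x n i, x <= X ->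
  `|picard_iter n.+1 i x - picard_iter n i x| <= C / 2 ^+ n.
Proof.
have cs (i : 'I_m) : exists M, forall x, 0 <= x <= X -> `|picard_iter 1 i x - picard_iter 0 i x| <= M.
  by apply: contin_bounded => x; apply: cadd; [exact: cY|apply: copp; exact: cY].
have [M hM] := choice cs.
set D := \sum_i `|M i|.
have D0 : 0 <= D by exact: sumr_ge0.
have main n x : 0 <= x <= X ->
    \sum_i `|picard_iter n.+1 i x - picard_iter n i x| <= D / 2 ^+ n * expR (2 * L * x).
  elim: n x => [|n IH] x x0X.
    rewrite expr0 divr1; apply: (@le_trans _ _ D).
      by apply: ler_sum => i _; rewrite (le_trans (hM i x x0X)) // ler_norm.
    have /andP[x00 _] := x0X.
    by rewrite ler_peMr // -expR0 ler_expR mulr_ge0 // mulr_ge0 // ltW.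
  have /andP[x0 xX] := x0X.
  have L2 : 2 * L != 0 by rewrite mulf_neq0 // gt_eqF.
  have iE : locint (fun s => D / 2 ^+ n * K * expR (2 * L * s)).
    by apply: locintZ; apply: contin_locint => t; cnt.
  have iE1 : locint (fun s => expR (2 * L * s)) by apply: contin_locint => t; cnt.
  have one i : `|picard_iter n.+2 i x - picard_iter n.+1 i x| <=
      D / 2 ^+ n * K * ((expR (2 * L * x) - 1) / (2 * L)).
    rewrite -prim_expR // -primZ //=.
    rewrite opprD addrACA subrr add0r -primB; [|exact: (iY n.+1)|exact: (iY n)].
    set g := fun s : R => _ - _.
    have ig : locint g by apply: locintB; [exact: (iY n.+1)|exact: (iY n)].
    have := @prim_incr_norm _ g 0 x; rewrite lexx x0 !prim0 !subr0.
    move=> /(_ isT ig) /le_trans; apply; apply: prim_le => //.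
      exact: locint_norm.
    move=> s /andP[s0 sx]; apply: (le_trans (FL _ _ _ (ltW s0))).
    rewrite [leRHS](_ : _ = K * (D / 2 ^+ n * expR (2 * L * s))); last by ring.
    by rewrite ler_wpM2l //; apply: IH; rewrite (ltW s0) (le_trans sx).
  apply: (le_trans (ler_sum _ (fun i _ => one i))).
  rewrite sumr_const card_ord -[leLHS]mulr_natl [2 ^+ n.+1]exprS.
  set E := expR _; have E0 : 1 <= E by rewrite -expR0 ler_expR !mulr_ge0 // ltW.
  have p2 : 0 < (2:R) ^+ n by rewrite exprn_gt0.
  set A := D / 2 ^+ n; have A0 : 0 <= A by rewrite divr_ge0 // ltW.
  have -> : D / (2 * 2 ^+ n) = A / 2 by rewrite invfM /A; field; rewrite gt_eqF.
  have -> : m%:R * (A * K * ((E - 1) / (2 * L))) = A / 2 * ((m%:R * K) / L * (E - 1)).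
    by field; rewrite gt_eqF.
  rewrite ler_wpM2l ?divr_ge0 //.
  have q1 : (m%:R * K) / L <= 1 by rewrite ler_pdivrMr // mul1r /L lerDl.
  have q0 : 0 <= (m%:R * K) / L by rewrite divr_ge0 ?mulr_ge0 // ltW.
  move: q1 q0; move: (m%:R * K / L) => z; nra.
exists (D * expR (2 * L * Num.max 0 X)); first by rewrite mulr_ge0 // expR_ge0.
move=> x n i xX; have [x0|x0] := leP 0 x; last first.
  rewrite (@Yneg n.+1 i x (ltW x0)) (@Yneg n i x (ltW x0)) subrr normr0.
  by rewrite divr_ge0 ?exprn_ge0 // mulr_ge0 // expR_ge0.
have x0X : 0 <= x <= X by rewrite x0.
have X0 : 0 <= X by rewrite (le_trans x0).
rewrite max_r //.
apply: (@le_trans _ _ (\sum_i `|picard_iter n.+1 i x - picard_iter n i x|)).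
  by rewrite (bigD1 i) //= lerDl sumr_ge0.
apply: (le_trans (main n x x0X)).
rewrite [leRHS]mulrAC ler_wpM2l ?divr_ge0 ?exprn_ge0 //.
by rewrite ler_expR ler_wpM2l // mulr_ge0 // ltW.
Qed.

(** The solution is global: in the norm weighted by e^{2Lx} each iteration is a
    contraction by 1/2, on every bounded interval. *)
Theorem picard : exists y : 'I_m -> R -> R, (forall i, contin (y i)) /\
  forall i x, y i x = y0 i + prim (fun s => F i s (fun j => y j s)) x.
Proof.
pose y i x := lim ((fun n => picard_iter n i x) @ \oo).
have est X : exists2 C, 0 <= C & forall x n i, x <= X ->
    `|y i x - picard_iter n i x| <= C / 2 ^+ n.
  have [C C0 hC] := locY X; exists (2 * C); first by rewrite mulr_ge0.
  move=> x n i xX; apply: (@geometric_lim (fun n => picard_iter n i x) C) => k; exact: hC.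
have cy i : contin (y i).
  move=> x; apply/cvgrPdist_lt => e e0.
  have [C C0 hC] := est (x + 1).
  have e3 : 0 < e / 3 by rewrite divr_gt0.
  have [n hn] := geometric_small C0 e3.
  have /cvgrPdist_lt /(_ _ e3) cn := @cY n i x.
  near=> t.
  have /ltW t1 : t < x + 1 by near: t; apply: lt_nbhsl; rewrite ltrDl.
  have a1 : `|picard_iter n i x - picard_iter n i t| < e / 3 by near: t; exact: cn.
  have a2 := le_lt_trans (hC t n i t1) hn.
  have x1 : x <= x + 1 by rewrite lerDl.
  have a3 := le_lt_trans (hC x n i x1) hn.
  move: a1 a2 a3; rewrite !ltr_norml => /andP[? ?] /andP[? ?] /andP[? ?].
  by apply/andP; split; lra.
exists y; split => // i x.
have iF : locint (fun s => F i s (fun j => y j s)) by apply: contin_locint; exact: Fc.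
have [x0|x0] := leP 0 x; last first.
  rewrite prim_neg ?ltW // addr0 /y.
  have -> : (fun n => picard_iter n i x) = (fun=> y0 i) by apply/funext => n; exact: (@Yneg n i x (ltW x0)).
  exact: lim_cst.
have [C C0 hC] := est x.
have bd n : `|y i x - (y0 i + prim (fun s => F i s (fun j => y j s)) x)| <=
    (C + K * (m%:R * C) * x) / 2 ^+ n.
  have h1 := hC x n.+1 i (lexx _).
  have p2 : 0 < (2:R) ^+ n by rewrite exprn_gt0.
  have h2 : `|picard_iter n.+1 i x - (y0 i + prim (fun s => F i s (fun j => y j s)) x)| <=
      K * (m%:R * C) * x / 2 ^+ n.
    rewrite /= opprD addrACA subrr add0r -primB //.
    set g := fun s : R => _ - _.
    have ig : locint g by apply: locintB.
    have := @prim_incr_norm _ g 0 x; rewrite lexx x0 !prim0 !subr0.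
    move=> /(_ isT ig) /le_trans; apply.
    have -> : K * (m%:R * C) * x / 2 ^+ n = prim (fun=> K * (m%:R * (C / 2 ^+ n))) x.
      by rewrite prim_cst //; field; rewrite gt_eqF.
    apply: prim_le; [exact: locint_norm|exact: locint_cst|].
    move=> s /andP[s0 sx]; apply: (le_trans (FL _ _ _ (ltW s0))).
    rewrite ler_wpM2l //.
    rewrite -[m in m%:R](card_ord m) mulr_natl -sumr_const; apply: ler_sum => j _.
    by rewrite distrC; exact: hC.
  rewrite -(subrKA (picard_iter n.+1 i x)) (le_trans (ler_normD _ _)) //.
  rewrite (le_trans (lerD h1 h2)) // mulrDl lerD2r ler_wpM2l //.
  by rewrite lef_pV2 ?posrE ?exprn_gt0 // exprS ler_peMl // ?ler1n // ltW.
apply/eqP; rewrite -subr_eq0 -normr_le0; apply/ler_addgt0Pl => e e0; rewrite addr0.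
have CC : 0 <= C + K * (m%:R * C) * x by rewrite addr_ge0 // !mulr_ge0.
by have [n /ltW hn] := geometric_small CC e0; apply: le_trans (bd n) hn.
Unshelve. all: by end_near. Qed.

End Picard.

(** * Linear equations of second order *)

Section LinearODE.
Variable R : realType.
Implicit Types (f g e m P p : R -> R) (x y : R).

Lemma gronwall e e' m m' x y : x <= y ->
  (forall t, x <= t <= y -> ct e t) -> (forall t, x <= t <= y -> ct m t) ->
  (forall t, x < t < y -> dd e t (e' t)) -> (forall t, x < t < y -> dd m t (m' t)) ->
  (forall t, x < t < y -> 0 <= e' t + m' t * e t) ->
  e x * expR (m x) <= e y * expR (m y).
Proof.
move=> xy ce cm de dm h.
apply: (@mono_le _ (fun t => e t * expR (m t))
  (fun t => e' t * expR (m t) + e t * (expR (m t) * m' t))) => //.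
- by move=> t xty; apply: dmul; [exact: de|apply: dexpR; exact: dm].
- by move=> t xty; apply: cmul; [exact: ce|apply: cexpR; exact: cm].
move=> t xty; have := h t xty; have := expR_gt0 (m t); nra.
Qed.

(** A relative rate of change at most M bounds the growth forwards and
    backwards; the second half gives uniqueness from Cauchy data at any point.
    *)
Lemma gronwall2 e e' M x y : 0 <= x <= y -> contin e ->
  (forall t, 0 < t -> dd e t (e' t)) ->
  (forall t, 0 < t -> `|e' t| <= M * e t) ->
  e y <= e x * expR (M * (y - x)) /\ e x <= e y * expR (M * (y - x)).
Proof.
move=> /andP[x0 xy] ce de h.
have cM c t : ct (fun t => c * t : R) t by cnt.
have dM (c t : R) : dd (fun t => c * t : R) t c by apply: deq; [der|ring].
have t0 t : x < t < y -> 0 < t by move=> /andP[xt _]; exact: le_lt_trans xt.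
split.
- have := @gronwall (fun t => - e t) (fun t => - e' t) (fun t => - M * t) (fun=> - M) x y xy.
  have h1 t : x < t < y -> 0 <= - e' t + - M * - e t.
    by move=> /t0 /h; rewrite ler_norml => /andP[]; lra.
  move=> k; have {k} : - e x * expR (- M * x) <= - e y * expR (- M * y).
    apply: k h1 => t xty //; first by apply: copp; exact: ce.
    by apply: dopp; apply: de; exact: t0.
  rewrite !mulNr lerN2 !expRN ler_pdivrMr ?expR_gt0 // => k.
  by rewrite mulrBr expRB mulrCA mulrC.
- have := @gronwall e e' (fun t => M * t) (fun=> M) x y xy.
  have h1 t : x < t < y -> 0 <= e' t + M * e t.
    by move=> /t0 /h; rewrite ler_norml => /andP[]; lra.
  move=> k; have {k} : e x * expR (M * x) <= e y * expR (M * y).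
    by apply: k h1 => t xty //; apply: de; exact: t0.
  by rewrite mulrBr expRB mulrA ler_pdivlMr ?expR_gt0.
Qed.

Variables (q : R -> R) (K : R).
Hypothesis cq : contin q.
Hypothesis qK : forall x, `|q x| <= K.

Let K0 : 0 <= K. Proof. exact: le_trans (qK 0). Qed.

(** The equation u'' = (q - (a + ib)) u - (g1 + i g2) for u = p + i s, in
    integrated form because g1 and g2 are only locally integrable. The unknown
    u' + prim g makes the right-hand side continuous. *)
Lemma linear_ivp (a b : R) (g1 g2 : R -> R) (al be ga de : R) :
  locint g1 -> locint g2 ->
  exists p p1 s s1, [/\ contin p, contin p1, contin s & contin s1] /\
   [/\ p 0 = al, p1 0 = be, s 0 = ga & s1 0 = de] /\
   [/\ is_primitive p p1, is_primitive p1 (fun t => (q t - a) * p t + b * s t - g1 t),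
       is_primitive s s1 & is_primitive s1 (fun t => (q t - a) * s t - b * p t - g2 t)].
Proof.
move=> i1 i2.
pose o (k : nat) (h : (k < 4)%N) : 'I_4 := Ordinal h.
pose o0 := @o 0 isT; pose o1 := @o 1 isT; pose o2 := @o 2 isT; pose o3 := @o 3 isT.
pose F (i : 'I_4) s (z : 'I_4 -> R) := match val i with
  | 0 => z o1 - prim g1 s
  | 1 => (q s - a) * z o0 + b * z o2
  | 2 => z o3 - prim g2 s
  | _ => (q s - a) * z o2 - b * z o0 end.
pose y0 (i : 'I_4) := match val i with 0 => al | 1 => be | 2 => ga | _ => de end.
set M := 1 + K + `|a| + `|b|.
have M0 : 0 <= M by rewrite /M !addr_ge0.
have cG1 := prim_contin i1; have cG2 := prim_contin i2.
have Fc (y : 'I_4 -> R -> R) : (forall i, contin (y i)) ->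
    forall i, contin (fun s => F i s (fun j => y j s)).
  move=> cy [[|[|[|k]]] hk] x; rewrite /F /=.
  - by apply: cadd; [exact: cy|apply: copp; exact: cG1].
  - apply: cadd; apply: cmul; [|exact: cy|cnt|exact: cy].
    by apply: cadd; [exact: cq|cnt].
  - by apply: cadd; [exact: cy|apply: copp; exact: cG2].
  - apply: cadd; [|apply: copp]; apply: cmul; [|exact: cy|cnt|exact: cy].
    by apply: cadd; [exact: cq|cnt].
have FL i s z z' : 0 <= s -> `|F i s z - F i s z'| <= M * \sum_j `|z j - z' j|.
  move=> _; set S := \sum_j _.
  have hS j : `|z j - z' j| <= S by rewrite /S (bigD1 j) //= lerDl sumr_ge0.
  have hS2 j k : j != k -> `|z j - z' j| + `|z k - z' k| <= S.
    move=> jk; rewrite /S (bigD1 j) //= lerD2l (bigD1 k) 1?eq_sym //= lerDl.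
    exact: sumr_ge0.
  have S0 : 0 <= S by rewrite sumr_ge0.
  have Mge1 : 1 <= M by rewrite /M -!addrA lerDl !addr_ge0.
  have qa : `|q s - a| <= M.
    rewrite (le_trans (ler_normB _ _)) // /M.
    have := qK s; have := normr_ge0 b; lra.
  have bM : `|b| <= M.
    by rewrite /M lerDr !addr_ge0.
  have lin (u v u' v' : R) :
     `|u * v + u' * v'| <= `|u| * `|v| + `|u'| * `|v'|.
    by rewrite (le_trans (ler_normD _ _)) // !normrM.
  have two (A B u v : R) : `|A| <= M -> `|B| <= M -> `|u| + `|v| <= S ->
     `|A * u + B * v| <= M * S.
    move=> hA hB huv; apply: (le_trans (lin _ _ _ _)).
    apply: (@le_trans _ _ (M * (`|u| + `|v|))); last by rewrite ler_wpM2l.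
    by rewrite mulrDr lerD // ler_wpM2r.
  case: i => [[|[|[|k]]] hk]; rewrite /F /=.
  - rewrite opprB addrA subrK (le_trans (hS o1)) // ler_peMl //.
  - rewrite (_ : _ - _ = (q s - a) * (z o0 - z' o0) + b * (z o2 - z' o2)); last by ring.
    by apply: two => //; exact: hS2.
  - rewrite opprB addrA subrK (le_trans (hS o3)) // ler_peMl //.
  - rewrite (_ : _ - _ = (q s - a) * (z o2 - z' o2) + (- b) * (z o0 - z' o0)); last by ring.
    by apply: two => //; [rewrite normrN|exact: hS2].
have [y [cy hy]] := picard y0 M0 Fc FL.
have hy0 i : y i 0 = y0 i by rewrite hy prim0 addr0.
exists (y o0), (fun t => y o1 t - prim g1 t), (y o2), (fun t => y o3 t - prim g2 t).
have cp1 : contin (fun t => y o1 t - prim g1 t).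
  by move=> x; apply: cadd; [exact: cy|apply: copp; exact: cG1].
have cs1 : contin (fun t => y o3 t - prim g2 t).
  by move=> x; apply: cadd; [exact: cy|apply: copp; exact: cG2].
split; first by split.
split; first by split; rewrite ?prim0 ?subr0 hy0.
split.
- by move=> x x0; rewrite [LHS]hy hy0.
- move=> x x0; rewrite prim0 subr0 hy0 [y o1 x]hy.
  have e : prim (fun t => (q t - a) * y o0 t + b * y o2 t - g1 t) x =
      prim (fun t => (q t - a) * y o0 t + b * y o2 t) x - prim g1 x.
    by apply: primB => //; apply: contin_locint; exact: (Fc y cy o1).
  by rewrite e addrA.
- by move=> x x0; rewrite [LHS]hy hy0.
- move=> x x0; rewrite prim0 subr0 hy0 [y o3 x]hy.
  have e : prim (fun t => (q t - a) * y o2 t - b * y o0 t - g2 t) x =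
      prim (fun t => (q t - a) * y o2 t - b * y o0 t) x - prim g2 x.
    by apply: primB => //; apply: contin_locint; exact: (Fc y cy o3).
  by rewrite e addrA.
Qed.

Lemma is_primitive_dd P p x : contin p -> is_primitive P p -> 0 < x -> dd P x (p x).
Proof.
move=> cp hP x0.
have d : dd (fun t => P 0 + prim p t) x (0 + p x).
  apply: dadd; first exact: dcst.
  by apply: prim_ftc => //; exact: contin_locint.
rewrite add0r in d; apply: dnear d; near=> t; rewrite -hP // ltW //.
near: t; exact: lt_nbhsr.
Unshelve. all: by end_near. Qed.

(** A solution of y'' = Q y on (0, oo), together with its derivative y1,
    continuous up to 0. *)
Definition sol (Q y y1 : R -> R) := [/\ contin y, contin y1,
  forall x, 0 < x -> dd y x (y1 x) & forall x, 0 < x -> dd y1 x (Q x * y x)].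

Lemma sol_exists (lam : R) : exists y y1 : R -> R, sol (fun t => q t - lam) y y1 /\
  y 0 = 0 /\ y1 0 = 1.
Proof.
have i0 : locint (fun=> 0 : R) by apply: contin_locint => t; cnt.
have [p [p1 [s [s1 [[cp cp1 cs cs1] [[p0 p10 _ _] [h1 h2 _ _]]]]]]] :=
  linear_ivp lam 0 0 1 0 0 i0 i0.
exists p, p1; split => //; split => // x x0; first exact: is_primitive_dd.
have c : contin (fun t => (q t - lam) * p t).
  by move=> t; apply: cmul; [apply: cadd; [exact: cq|cnt]|exact: cp].
have h : is_primitive p1 (fun t => (q t - lam) * p t).
  by move=> t t0; rewrite h2 //; congr (_ + _); apply: prim_eq => r _; ring.
exact: (is_primitive_dd c h).
Qed.

(** The energy |u|^2 + |u'|^2 of u = p + i s changes at a bounded relative rate.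
    *)
Lemma energy_bound (a b : R) p p1 s s1 :
  contin p -> contin p1 -> contin s -> contin s1 ->
  (forall x, 0 < x -> dd p x (p1 x)) -> (forall x, 0 < x -> dd s x (s1 x)) ->
  (forall x, 0 < x -> dd p1 x ((q x - a) * p x + b * s x)) ->
  (forall x, 0 < x -> dd s1 x ((q x - a) * s x - b * p x)) ->
  exists M, forall x y, 0 <= x <= y ->
    let e t := p t ^+ 2 + p1 t ^+ 2 + s t ^+ 2 + s1 t ^+ 2 in
    e y <= e x * expR (M * (y - x)) /\ e x <= e y * expR (M * (y - x)).
Proof.
move=> cp cp1 cs cs1 dp ds dp1 ds1.
set N := 1 + K + `|a| + `|b|.
exists (2 * N) => x y xy e.
have ce : contin e.
  by move=> t; rewrite /e; cnt.
pose e' t := 2 * (p t * p1 t + p1 t * ((q t - a) * p t + b * s t) +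
   s t * s1 t + s1 t * ((q t - a) * s t - b * p t)).
apply: (@gronwall2 e e' (2 * N)) => // t t0.
  rewrite /e; apply: deq.
    by der.
  by rewrite /e' /= !expr1; ring.
rewrite /e' normrM ger0_norm // -mulrA ler_wpM2l //.
have Q : `|q t - a| <= K + `|a| by rewrite (le_trans (ler_normB _ _)) // lerD2r.
have hA (A B u v : R) : `|A| <= B -> `|A * (u * v)| <= B * ((u ^+ 2 + v ^+ 2) / 2).
  move=> AB; rewrite normrM; apply: ler_pM => //.
  rewrite ler_norml; apply/andP; split.
    by have := sqr_ge0 (u + v); nra.
  by have := sqr_ge0 (u - v); nra.
have h1 := hA (1 + (q t - a)) (1 + K + `|a|) (p t) (p1 t).
have h2 := hA (1 + (q t - a)) (1 + K + `|a|) (s t) (s1 t).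
have h3 := hA b `|b| (s t) (p1 t) (lexx _).
have h4 := hA (- b) `|b| (p t) (s1 t); rewrite normrN in h4.
have q1 : `|1 + (q t - a)| <= 1 + K + `|a|.
  by rewrite (le_trans (ler_normD _ _)) // normr1 -addrA lerD2l.
have {}h1 := h1 q1; have {}h2 := h2 q1; have {}h4 := h4 (lexx _).
rewrite [X in `|X|](_ : _ = (1 + (q t - a)) * (p t * p1 t) +
  (1 + (q t - a)) * (s t * s1 t) + b * (s t * p1 t) + - b * (p t * s1 t)); last by ring.
have tri (u1 u2 u3 u4 : R) : `|u1 + u2 + u3 + u4| <= `|u1| + `|u2| + `|u3| + `|u4|.
  by rewrite !(le_trans (ler_normD _ _)) // lerD2r // (le_trans (ler_normD _ _)) // lerD2r ler_normD.
apply: (le_trans (tri _ _ _ _)).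
apply: (le_trans (lerD (lerD (lerD h1 h2) h3) h4)).
rewrite /N /e; have := normr_ge0 a; have := normr_ge0 b.
have := sqr_ge0 (p t); have := sqr_ge0 (p1 t); have := sqr_ge0 (s t); have := sqr_ge0 (s1 t).
move: (p t ^+ 2) (p1 t ^+ 2) (s t ^+ 2) (s1 t ^+ 2) `|a| `|b| K0 => A B C D a' b' ? ? ? ? ? ? ?.
have : 0 <= (1 + K + a') * (A + B + C + D) by rewrite mulr_ge0 ?addr_ge0.
have : 0 <= b' * (A + B + C + D) by rewrite mulr_ge0 ?addr_ge0.
nra.
Qed.

End LinearODE.

(** * The adjoint of the free operator *)

Section SelfAdjoint.
Variable R : realType.
Local Notation mu := (@lebesgue_measure R).
Local Notation H := (half_line R).
Implicit Types (f g h p r v w : R -> R) (x M : R).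
#[local] Hint Resolve measurable_segment measurable_half locint_cst : core.

Definition trunc M f x := if x <= M then f x else 0.

Lemma L2_trunc M f : measurable_fun (H : set (measurableTypeR R)) f ->
  locint (fun t => f t ^+ 2) -> L2 (trunc M f).
Proof.
move=> mf i2.
have e : {in H, f \_ `[0, M] =1 trunc M f}.
  move=> x /set_mem x0; rewrite /patch /trunc; case: ifPn => [/set_mem|].
    by rewrite /= in_itv /= => /andP[_ ->].
  rewrite notin_setE /= in_itv /= => h; case: ifPn => // xM; exfalso; apply: h.
  by apply/andP.
split.
  have mt : measurable_fun (H : set (measurableTypeR R)) (f \_ `[0, M]).
    apply/(measurable_restrict _ _ _).1 => //.
    by apply: measurable_funS mf => // x [].
  by apply: eq_measurable_fun mt => x xH; rewrite e.
have : mu.-integrable setT ((EFin \o (fun t => f t ^+ 2)) \_ `[0, M]).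
  by apply/(integrable_mkcond _ (measurable_segment 0 M)).1; exact: i2.
move=> /(integrableS measurableT (@measurable_half R) (@subsetT _ _)).
apply: (eq_integrable (@measurable_half R)) => x xH; rewrite /= -e // /patch /=; case: ifP => // _.
by rewrite expr0n.
Qed.

Lemma prim_support f M x : locint f -> (forall t, M < t -> f t = 0) -> 0 <= M <= x ->
  prim f x = prim f M.
Proof.
move=> i0 f0 Mx; apply/eqP; rewrite eq_le -subr_le0 -(subr_le0 (prim f x)).
have a := @prim_incr_le _ f (fun=> 0) M x Mx i0 (locint_cst 0).
have b := @prim_incr_le _ (fun=> 0) f M x Mx (locint_cst 0) i0.
have z : prim (fun=> 0 : R) x - prim (fun=> 0) M = 0.
  have /andP[M0 Mx'] := Mx.
  by rewrite !prim_cst ?mul0r ?subrr // (le_trans M0).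
rewrite z in a; rewrite z in b.
apply/andP; split; first by apply: a => t /andP[/f0 ->].
by rewrite -oppr_ge0 opprB; apply: b => t /andP[/f0 ->].
Qed.

Lemma int_support f M : integrable_on H f -> 0 <= M -> (forall t, M < t -> f t = 0) ->
  \int[mu]_(t in H) f t = prim f M.
Proof.
move=> i0 M0 f0; have c := prim_cvg i0.
have c2 : prim f x @[x --> +oo] --> prim f M.
  apply: cvg_near_cst; apply: (@near_pinfty_in _ M) => x Mx.
  by apply: prim_support => //; [exact: locint_half|rewrite M0].
exact: (cvg_unique _ c c2).
Qed.

Lemma ae_pt (A : R -> Prop) a b : {ae mu, forall x, A x} -> a < b ->
  exists2 x, a < x < b & A x.
Proof.
move=> [N [mN N0 hN]] ab; apply: contrapT => no.
have sub : `]a, b[%classic `<=` N.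
  move=> x /=; rewrite in_itv /= => xab; apply: hN => /= Ax; apply: no.
  by exists x.
have : (mu `]a, b[%classic <= mu N)%E by apply: le_measure => //; rewrite inE.
rewrite N0 lebesgue_measure_itv /= lte_fin ab -EFinB lee_fin; lra.
Qed.

Lemma prim_eq0_ae g M : locint g -> (forall t, 0 <= t <= M -> 0 <= g t) ->
  prim g M = 0 -> {ae mu, forall x, 0 <= x <= M -> g x = 0}.
Proof.
move=> ig g0 e.
have mg : measurable_fun (`[0, M]%classic : set (measurableTypeR R)) (EFin \o g).
  by apply/measurable_EFinP; apply: intg_meas; exact: ig.
have : (\int[mu]_(x in `[0%R, M]%classic) `|(EFin \o g) x| = 0)%E.
  transitivity ((prim g M)%:E); last by rewrite e.
  rewrite /prim /Rintegral fineK; last first.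
    by apply: integrable_fin_num => //; exact: ig.
  apply: eq_integral => t; rewrite inE /= in_itv /= => tM.
  by rewrite ger0_norm // g0.
move/(ae_eq_integral_abs _ (measurable_segment 0 M) mg).1.
by apply: ae_imp => x h xM; have := h; rewrite /= in_itv /= => /(_ xM) [].
Qed.

Lemma L2_ae p r : measurable_fun (H : set (measurableTypeR R)) r ->
  ae_half_line (fun x => p x = r x) -> L2 p -> L2 r.
Proof.
move=> mr pr [mp /integrableP[_ ip]]; split => //.
apply/integrableP; split.
  by apply/measurable_EFinP; exact: measurable_funX.
rewrite (le_lt_trans _ ip) // le_eqVlt; apply/orP; left; apply/eqP.
apply: ge0_ae_eq_integral => //.
- by apply: measurableT_comp => //; apply/measurable_EFinP; exact: measurable_funX.
- by apply: measurableT_comp => //; apply/measurable_EFinP; exact: measurable_funX.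
by apply: ae_imp pr => x h xH /=; rewrite h.
Qed.

(** The Sobolev space H^2(0, oo) of real functions, with the two derivatives. *)
Definition real_H2 p p1 p2 := [/\ L2 p, L2 p1, L2 p2, is_primitive p p1 & is_primitive p1 p2].

(** The boundary term p' r - p r' vanishes at 0, and tends to 0 at infinity by
    [H1_vanishes_at_infinity]. *)
Lemma symmetric p p1 p2 r r1 r2 : real_H2 p p1 p2 -> real_H2 r r1 r2 -> p 0 = 0 -> r 0 = 0 ->
  \int[mu]_(t in H) (p2 t * r t) = \int[mu]_(t in H) (p t * r2 t).
Proof.
move=> [Lp Lp1 Lp2 hp hp1] [Lr Lr1 Lr2 hr hr1] p0 r0.
have i2r := L2_mul_int Lp2 Lr; have ir2 := L2_mul_int Lp Lr2.
have i11 := L2_mul_int Lp1 Lr1.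
have A := is_primitive_mul hp1 hr (L2_locL2 Lp2) (L2_locL2 Lr1).
have B := is_primitive_mul hp hr1 (L2_locL2 Lp1) (L2_locL2 Lr2).
have e x : 0 <= x -> p1 x * r x - p x * r1 x =
    prim (fun t => p2 t * r t) x - prim (fun t => p t * r2 t) x.
  move=> x0; rewrite A // B // p0 r0 mulr0 mul0r !add0r.
  have -> : prim (fun t => p2 t * r t + r1 t * p1 t) x =
    prim (fun t => p2 t * r t) x + prim (fun t => p1 t * r1 t) x.
    rewrite -primD; [|exact: locint_half..].
    by apply: prim_eq => t _; rewrite [r1 t * _]mulrC.
  have -> : prim (fun t => p1 t * r1 t + r2 t * p t) x =
    prim (fun t => p t * r2 t) x + prim (fun t => p1 t * r1 t) x.
    rewrite -primD; [|exact: locint_half..].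
    by apply: prim_eq => t _; rewrite [r2 t * _]mulrC addrC.
  by ring.
have c1 : p1 x * r x - p x * r1 x @[x --> +oo] --> (0 * 0 - 0 * 0 : R).
  by apply: cvgB; apply: cvgM; apply: H1_vanishes_at_infinity; eassumption.
have c2 : p1 x * r x - p x * r1 x @[x --> +oo] -->
    \int[mu]_(t in H) (p2 t * r t) - \int[mu]_(t in H) (p t * r2 t).
  apply: cvgy_eq (cvgB (prim_cvg i2r) (prim_cvg ir2)) => x x0.
  by rewrite /= [RHS]e.
have E := cvg_unique (@Rhausdorff R) c1 c2.
by apply/eqP; rewrite -subr_eq0 -E mulr0 subrr.
Qed.

Lemma L2_support p M : 0 <= M -> contin p -> (forall t, M < t -> p t = 0) -> L2 p.
Proof.
move=> M0 cp p0.
apply: (@L2_eq _ (trunc M p)).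
  by move=> x _; rewrite /trunc; case: leP => // /p0.
apply: L2_trunc; first exact: measurable_contin.
by case: (contin_locL2 cp).
Qed.

(** Let h be v - z - k x, cut off at M, with k such that h is orthogonal to x.
    Thanks to this moment condition the solution p of p'' = -h with p'(M) = 0
    and p(0) = 0 also vanishes at M, and so lies in the domain. The hypothesis
    for p says that h is orthogonal to v - z, hence to itself. *)
Lemma adjoint_on_segment v w M : L2 v -> L2 w -> 0 < M ->
  (forall p p1 p2, real_H2 p p1 p2 -> p 0 = 0 ->
     \int[mu]_(t in H) (- p2 t * v t) = \int[mu]_(t in H) (p t * w t)) ->
  let z := prim (prim (fun t => - w t)) in
  exists k, {ae mu, forall x, 0 <= x <= M -> v x = z x + k * x}.
Proof.
move=> Lv Lw M0 hyp.
have lw := L2_locL2 (L2N Lw).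
pose z1 := prim (fun t => - w t); move=> z.
have cz1 : contin z1 by exact: (prim_contin lw.1).
have iz1 := contin_locint cz1.
have cz : contin z by exact: prim_contin.
have hz1 : is_primitive z1 (fun t => - w t) by move=> x _; rewrite /z1 prim0 add0r.
have hz : is_primitive z z1 by move=> x _; rewrite /z prim0 add0r.
have hid : is_primitive (fun t : R => t) (fun=> 1) by move=> x x0; rewrite prim_cst // add0r mul1r.
pose d x := v x - z x.
have Lv2 := L2_locL2 Lv.
have ld : locint d by apply: locintB; [case: Lv2|exact: contin_locint].
have cid : contin (fun t : R => t) by move=> t; cnt.
have c1 : contin (fun=> 1 : R) by move=> t; cnt.
have c2 : contin (fun t : R => t ^+ 2) by move=> t; cnt.
have itd : locint (fun t => d t * t) by exact: (locintM ld cid).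
set S2 := prim (fun t : R => t ^+ 2) M.
have S20 : S2 != 0.
  have h : forall f : R -> R, f = (fun t => t ^+ 3 / 3) -> f M = f 0 + S2.
    move=> f ->; apply: (@prim_of_derive R (fun t => t ^+ 3 / 3)) => //.
    + by move=> t; cnt.
    + exact: contin_locint.
    + by move=> t _; apply: deq; [der|rewrite /=; field].
    + exact: ltW.
  have := h _ erefl; rewrite expr0n /= mul0r add0r => <-.
  by rewrite gt_eqF // divr_gt0 // exprn_gt0.
set k := prim (fun t => d t * t) M / S2.
pose h0 x := v x - (z x + k * x).
have mh0 : measurable_fun (H : set (measurableTypeR R)) h0.
  apply: measurable_funB; first by case: Lv.
  by apply: measurable_contin => // t; apply: cadd; [exact: cz|cnt].
have ck : contin (fun t => z t + k * t) by move=> t; cnt.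
pose h := trunc M h0.
have Lh : L2 h.
  have Lc : L2 (trunc M (fun t => z t + k * t)).
    by apply: L2_trunc; [exact: measurable_contin|case: (contin_locL2 ck)].
  have Lvt : L2 (trunc M v) by apply: L2_trunc; [case: Lv|case: Lv2].
  apply: L2_eq (L2B Lvt Lc) => x _; rewrite /h /trunc; case: ifP => // _.
  by rewrite subr0.
have lh := L2_locL2 Lh.
have hM t : M < t -> h t = 0 by move=> Mt; rewrite /h /trunc leNgt Mt.
have hE t : t <= M -> h t = h0 t by move=> tM; rewrite /h /trunc tM.
pose p1 x := prim h M - prim h x.
have cp1 : contin p1 by move=> t; rewrite /p1; cnt; exact: (prim_contin lh.1).
have ip1 := contin_locint cp1.
have Mx x : M < x -> 0 <= M <= x by move=> /ltW ->; rewrite ltW.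
have p1M t : M <= t -> p1 t = 0.
  rewrite le_eqVlt => /predU1P[<-|Mt]; first by rewrite /p1 subrr.
  by rewrite /p1 (prim_support lh.1 hM (Mx _ Mt)) subrr.
have hp1 : is_primitive p1 (fun t => - h t).
  by move=> x x0; rewrite /p1 prim0 subr0 primN //; case: lh.
pose p := prim p1.
have cp : contin p by exact: prim_contin.
have hp : is_primitive p p1 by move=> x _; rewrite /p prim0 add0r.
have p00 : p 0 = 0 by rewrite /p prim0.
have lmh : locL2 (fun t => - h t) by exact: (L2_locL2 (L2N Lh)).
have M0' := ltW M0.
(* the moment condition makes p vanish beyond M *)
have iht : locint (fun t => h t * t) by exact: (locintM lh.1 cid).
have mom : prim (fun t => h t * t) M = 0.
  have -> : prim (fun t => h t * t) M = prim (fun t => d t * t - k * t ^+ 2) M.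
    by apply: prim_eq => t /andP[_ tM]; rewrite hE // /h0 /d; ring.
  rewrite primB //; last by apply: locintZ; exact: contin_locint.
  by rewrite primZ; [rewrite /k divfK // subrr|exact: contin_locint].
have pM : p M = 0.
  have := is_primitive_mul hid hp1 (contin_locL2 c1) lmh M0'.
  rewrite (p1M M) // mulr0 mul0r add0r.
  have -> : prim (fun t => 1 * p1 t + - h t * t) M = p M - prim (fun t => h t * t) M.
    by rewrite -primB //; apply: prim_eq => t _; ring.
  by rewrite mom subr0.
have pM' t : M < t -> p t = 0.
  by move=> /Mx Mt; rewrite /p (prim_support ip1 _ Mt) // => u /ltW; exact: p1M.
have Lp : L2 p by exact: (L2_support M0' cp).
have Lp1 : L2 p1 by apply: (L2_support M0' cp1) => t /ltW; exact: p1M.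
have dp : real_H2 p p1 (fun t => - h t) by split => //; exact: L2N.
have := hyp _ _ _ dp p00.
rewrite (@int_support _ M) //; last 2 first.
- by apply: L2_mul_int => //; do 2 apply: L2N.
- by move=> t /hM ->; rewrite oppr0 oppr0 mul0r.
rewrite (@int_support _ M) //; last 2 first.
- exact: L2_mul_int.
- by move=> t /pM' ->; rewrite mul0r.
have A := is_primitive_mul hp hz1 (contin_locL2 cp1) lw M0'.
have B := is_primitive_mul hp1 hz lmh (contin_locL2 cz1) M0'.
have z00 : z 0 = 0 by rewrite /z prim0.
rewrite pM p00 !mul0r add0r in A.
rewrite p1M // z00 mul0r mulr0 add0r in B.
have iz1p1 : locint (fun t => p1 t * z1 t) by exact: locintM.
have ihz : locint (fun t => h t * z t) by exact: (locintM lh.1 cz).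
have ipw : locint (fun t => p t * w t) by apply: locint_half; exact: L2_mul_int.
have ihv : locint (fun t => h t * v t) by apply: locint_half; exact: L2_mul_int.
have {}A : prim (fun t => p1 t * z1 t) M = prim (fun t => p t * w t) M.
  apply/eqP; rewrite -subr_eq0 -primB // A; apply/eqP; apply: prim_eq => t _; ring.
have {}B : prim (fun t => p1 t * z1 t) M = prim (fun t => h t * z t) M.
  apply/eqP; rewrite -subr_eq0 -primB // B; apply/eqP; apply: prim_eq => t _; ring.
have -> : prim (fun t => - - h t * v t) M = prim (fun t => h t * v t) M.
  by apply: prim_eq => t _; rewrite opprK.
rewrite -A B => C.
have sq : prim (fun t => h t ^+ 2) M = 0.
  have -> : prim (fun t => h t ^+ 2) M =
      prim (fun t => h t * v t - h t * z t - k * (h t * t)) M.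
    by apply: prim_eq => t /andP[_ tM]; rewrite expr2 {2}hE // /h0; ring.
  rewrite primB; [|exact: locintB|exact: locintZ].
  by rewrite primB // primZ // C mom mulr0 !subrr.
exists k; have := prim_eq0_ae lh.2 (fun t _ => sqr_ge0 _) sq.
apply: ae_imp => x hx xM; have /eqP := hx xM; rewrite sqrf_eq0 hE; last by case/andP: xM.
by rewrite /h0 subr_eq0 => /eqP.
Qed.

End SelfAdjoint.

(** * Real and imaginary parts *)

Section ComplexWrappers.
Variable R : realType.
Local Notation mu := (@lebesgue_measure R).
Local Notation H := (half_line R).
Local Notation Re := (@complex.Re R).
Local Notation Im := (@complex.Im R).
Implicit Types (f g h p r v w : R -> R) (x M : R) (u : R -> R[i]).
#[local] Hint Resolve measurable_segment measurable_half locint_cst : core.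

(** The slopes obtained on two segments agree, because the segments overlap. *)
Lemma adjoint_of_free_operator v w : L2 v -> L2 w ->
  (forall p p1 p2, real_H2 p p1 p2 -> p 0 = 0 ->
     \int[mu]_(t in H) (- p2 t * v t) = \int[mu]_(t in H) (p t * w t)) ->
  exists v0 v1, [/\ real_H2 v0 v1 (fun t => - w t), v0 0 = 0 &
    ae_half_line (fun x => v x = v0 x)].
Proof.
move=> Lv Lw hyp.
have lw := L2_locL2 (L2N Lw).
pose z1 := prim (fun t => - w t).
pose z := prim z1.
have cz1 : contin z1 by exact: (prim_contin lw.1).
have cz : contin z by apply: prim_contin; exact: contin_locint.
have ex (n : nat) : exists k, {ae mu, forall x, 0 <= x <= n.+1%:R -> v x = z x + k * x}.
  by apply: adjoint_on_segment.
have [k hk] := choice ex.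
have kE n : k n = k 0%N.
  have ab : (0 : R) < 1 by [].
  have [x /andP[x0 x1] [h1 h2]] := ae_pt (ae_and (hk n) (hk 0%N)) ab.
  have x1n : 0 <= x <= n.+1%:R.
    by rewrite (ltW x0) (le_trans (ltW x1)) // ler1n.
  have x10 : 0 <= x <= 1%:R by rewrite (ltW x0) ltW.
  have := h1 x1n; rewrite (h2 x10) => /addrI /(mulIf (lt0r_neq0 x0)) //.
have hae : ae_half_line (fun x => v x = z x + k 0%N * x).
  have : {ae mu, forall x n, 0 <= x <= n.+1%:R -> v x = z x + k 0%N * x}.
    by apply/ae_foralln => n; rewrite -(kE n); exact: hk.
  apply: ae_imp => x hx x0; apply: (hx (Num.bound x)).
  by rewrite x0 ltW // (lt_trans (archi_boundP x0)) // ltr_nat.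
exists (fun x => z x + k 0%N * x), (fun x => z1 x + k 0%N).
have cv : contin (fun x => z x + k 0%N * x) by move=> t; cnt.
have L0 : L2 (fun x => z x + k 0%N * x).
  by apply: (L2_ae _ hae) => //; exact: measurable_contin.
have P0 : is_primitive (fun x => z x + k 0%N * x) (fun x => z1 x + k 0%N).
  move=> x x0; rewrite primD //; last exact: contin_locint.
  by rewrite prim_cst // mulr0 addr0 /z prim0 add0r.
have P1 : is_primitive (fun x => z1 x + k 0%N) (fun t => - w t).
  by move=> x x0; rewrite /z1 prim0 add0r addrC.
have L2w := L2N Lw.
split => //; last by rewrite mulr0 addr0 /z prim0.
by split => //; exact: L2_interpolation P0 P1 L0 L2w.
Qed.

Lemma ReM (a b : R[i]) : Re (a * b) = Re a * Re b - Im a * Im b.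
Proof. by case: a b => [? ?] [? ?]. Qed.
Lemma ImM (a b : R[i]) : Im (a * b) = Re a * Im b + Im a * Re b.
Proof. by case: a b => [? ?] [? ?]. Qed.
Lemma ReD (a b : R[i]) : Re (a + b) = Re a + Re b.
Proof. by case: a b => [? ?] [? ?]. Qed.
Lemma ImD (a b : R[i]) : Im (a + b) = Im a + Im b.
Proof. by case: a b => [? ?] [? ?]. Qed.
Lemma ReN (a : R[i]) : Re (- a) = - Re a.
Proof. by case: a. Qed.
Lemma ImN (a : R[i]) : Im (- a) = - Im a.
Proof. by case: a. Qed.
Lemma ReJ (a : R[i]) : Re (conjc a) = Re a.
Proof. by case: a. Qed.
Lemma ImJ (a : R[i]) : Im (conjc a) = - Im a.
Proof. by case: a. Qed.
Definition reimE := (ReM, ImM, ReD, ImD, ReN, ImN, ReJ, ImJ).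

Lemma complexP (a b : R[i]) : Re a = Re b -> Im a = Im b -> a = b.
Proof. by case: a b => [? ?] [? ?] /= -> ->. Qed.

Definition rl u := fun t => Re (u t).
Definition im u := fun t => Im (u t).

Lemma in_L2P u : in_L2 u <-> L2 (rl u) /\ L2 (im u).
Proof.
split.
- move=> [mr [mi fi]].
  have mr' : measurable_fun (H : set (measurableTypeR R)) (rl u) by exact: mr.
  have mi' : measurable_fun (H : set (measurableTypeR R)) (im u) by exact: mi.
  have ic : integrable_on H (fun t => cnorm2 (u t)).
    apply/integrableP; split.
      by apply/measurable_EFinP; apply: measurable_funD; exact: measurable_funX.
    rewrite (le_lt_trans _ fi) // le_eqVlt; apply/orP; left; apply/eqP.
    by apply: eq_integral => t _ /=; rewrite ger0_norm // /cnorm2 addr_ge0 ?sqr_ge0.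
  split; split => //; apply: (intg_le _ _ _ ic) => //; try exact: measurable_funX.
  + by move=> x _; rewrite ger0_norm ?sqr_ge0 // /cnorm2 lerDl sqr_ge0.
  + by move=> x _; rewrite ger0_norm ?sqr_ge0 // /cnorm2 lerDr sqr_ge0.
- move=> [[mr ir] [mi ii]]; split; [exact: mr|split; [exact: mi|]].
  have /integrableP[_] := intgD (@measurable_half R) ir ii.
  apply: le_lt_trans; rewrite le_eqVlt; apply/orP; left; apply/eqP.
  by apply: eq_integral => t _ /=; rewrite ger0_norm // addr_ge0 ?sqr_ge0.
Qed.

Lemma primitive_ofP u u' : primitive_of u u' <->
  is_primitive (rl u) (rl u') /\ is_primitive (im u) (im u').
Proof.
split.
- move=> h; split => x x0; rewrite /rl /im h // ?ReD ?ImD //.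
- move=> [h1 h2] x x0; apply: complexP; rewrite ?ReD ?ImD.
  + exact: h1.
  + exact: h2.
Qed.

Lemma in_H2P u u' u'' : in_H2 u u' u'' <->
  real_H2 (rl u) (rl u') (rl u'') /\ real_H2 (im u) (im u') (im u'').
Proof.
split.
- move=> [/in_L2P[a1 a2] /in_L2P[b1 b2] /in_L2P[c1 c2] /primitive_ofP[d1 d2]
    /primitive_ofP[e1 e2]]; by split.
- move=> [[a1 b1 c1 d1 e1] [a2 b2 c2 d2 e2]].
  by split; [exact/in_L2P..|exact/primitive_ofP|exact/primitive_ofP].
Qed.

Lemma L2innerRe u (v : R -> R[i]) : in_L2 u -> in_L2 v -> Re (L2inner u v) =
  \int[mu]_(t in H) (rl u t * rl v t) + \int[mu]_(t in H) (im u t * im v t).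
Proof.
move=> /in_L2P[a1 a2] /in_L2P[b1 b2].
rewrite -RintegralD //; [|exact: L2_mul_int..].
apply: eq_Rintegral => t _; rewrite !reimE /rl /im; ring.
Qed.

Lemma L2innerIm u (v : R -> R[i]) : in_L2 u -> in_L2 v -> Im (L2inner u v) =
  \int[mu]_(t in H) (im u t * rl v t) - \int[mu]_(t in H) (rl u t * im v t).
Proof.
move=> /in_L2P[a1 a2] /in_L2P[b1 b2].
rewrite -RintegralB //; [|exact: L2_mul_int..].
apply: eq_Rintegral => t _; rewrite !reimE /rl /im; ring.
Qed.

Lemma ae_pos (A : R -> Prop) : (forall x, 0 < x -> A x) -> ae_half_line A.
Proof.
move=> hA; exists [set 0]; split => //; first exact: lebesgue_measure_set1.
move=> x /=; apply: contrapT => /not_implyP[]; move=> h x0.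
apply: h => xH; apply: hA; rewrite lt_neqAle eq_sym; apply/andP; split => //.
exact/eqP.
Qed.

End ComplexWrappers.

(** * Self-adjointness *)

Section Operator.
Variable R : realType.
Local Notation mu := (@lebesgue_measure R).
Local Notation H := (half_line R).
Implicit Types (f g h p r : R -> R) (x M : R) (u v w : R -> R[i]).
#[local] Hint Resolve measurable_segment measurable_half locint_cst : core.

Variables (V q : R -> R) (K : R).
Hypothesis cq : contin q.
Hypothesis qK : forall x, `|q x| <= K.
Hypothesis Vq : forall x, 0 < x -> V x = q x.

Lemma L2_q p : L2 p -> L2 (fun t => q t * p t).
Proof. by apply: (@L2_bmul _ _ _ K) => //; exact: measurable_contin. Qed.

(** The operator is real, so it acts on real and imaginary parts separately. *)
Lemma dirichletP u v : dirichlet_schrodinger V u v <-> exists p1 p2 s1 s2 : R -> R,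
  [/\ real_H2 (rl u) p1 p2, real_H2 (im u) s1 s2, rl u 0 = 0 & im u 0 = 0] /\
  [/\ L2 (rl v), L2 (im v), ae_half_line (fun x => rl v x = - p2 x + q x * rl u x) &
    ae_half_line (fun x => im v x = - s2 x + q x * im u x)].
Proof.
have aeV : ae_half_line (fun x => V x = q x) by exact: ae_pos.
split.
- move=> [u' [u'' [/in_H2P[h1 h2] u0 /in_L2P[l1 l2] e]]].
  exists (rl u'), (rl u''), (im u'), (im u''); split.
    by split => //; rewrite /rl /im u0.
  split => //.
  + apply: ae_imp (ae_and aeV e) => x [hV hv] x0; rewrite /rl hv // hV //.
    by rewrite !reimE /= mul0r subr0.
  + apply: ae_imp (ae_and aeV e) => x [hV hv] x0; rewrite /im hv // hV //.
    by rewrite !reimE /= mul0r addr0.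
- move=> [p1 [p2 [s1 [s2 [[d1 d2 r0 i0] [l1 l2 e1 e2]]]]]].
  exists (fun t => p1 t +i* s1 t), (fun t => p2 t +i* s2 t); split.
  + by apply/in_H2P.
  + exact: complexP.
  + exact/in_L2P.
  + apply: ae_imp (ae_and aeV (ae_and e1 e2)) => x [hV [h1 h2]] x0.
    apply: complexP; rewrite !reimE /= hV // ?mul0r ?subr0 ?addr0.
    * exact: h1.
    * exact: h2.
Qed.

Lemma L2_real_0 : L2 (fun=> 0 : R).
Proof.
have c0 : contin (fun=> 0 : R) by move=> t; cnt.
by apply: (@L2_support _ _ 0).
Qed.

Lemma real_H2_0 : real_H2 (fun=> 0 : R) (fun=> 0) (fun=> 0).
Proof.
have z := L2_real_0; split => // x x0; by rewrite prim_cst // mul0r addr0.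
Qed.

Lemma dirichlet_real p p1 p2 : real_H2 p p1 p2 -> p 0 = 0 ->
  dirichlet_schrodinger V (fun t => p t +i* 0) (fun t => (- p2 t + q t * p t) +i* 0).
Proof.
move=> d p0; apply/dirichletP; exists p1, p2, (fun=> 0), (fun=> 0).
have [Lp _ Lp2 _ _] := d.
split; first by split => //; exact: real_H2_0.
split.
- by apply: L2D; [exact: L2N|exact: L2_q].
- exact: L2_real_0.
- by apply: ae_pos.
- by apply: ae_pos => x _; rewrite /im /= mulr0 oppr0 addr0.
Qed.

Lemma dirichlet_in_L2 u v : dirichlet_schrodinger V u v -> in_L2 u /\ in_L2 v.
Proof.
move=> /dirichletP [p1 [p2 [s1 [s2 [[[a1 _ _ _ _] [a2 _ _ _ _] _ _] [l1 l2 _ _]]]]]].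
by split; exact/in_L2P.
Qed.

Lemma symmetric_ae p p1 p2 r r1 r2 a b c : real_H2 p p1 p2 -> real_H2 r r1 r2 ->
  p 0 = 0 -> r 0 = 0 -> L2 a -> L2 b -> L2 c ->
  ae_half_line (fun x => a x = - p2 x + q x * p x) ->
  ae_half_line (fun x => b x = - r2 x + q x * r x) ->
  ae_half_line (fun x => c x = r x) ->
  \int[mu]_(t in H) (a t * c t) = \int[mu]_(t in H) (p t * b t).
Proof.
move=> dp dr p0 r0 La Lb Lc ea eb ec.
have [Lp Lp1 Lp2 _ _] := dp; have [Lr Lr1 Lr2 _ _] := dr.
have La' : L2 (fun x => - p2 x + q x * p x) by apply: L2D; [exact: L2N|exact: L2_q].
have Lb' : L2 (fun x => - r2 x + q x * r x) by apply: L2D; [exact: L2N|exact: L2_q].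
have m2 f g : L2 f -> L2 g -> measurable_fun (H : set (measurableTypeR R)) (fun x => f x * g x).
  by move=> [mf _] [mg _]; exact: measurable_funM.
transitivity (\int[mu]_(t in H) (q t * p t * r t - p2 t * r t)).
  apply: Rint_ae => //; first exact: m2.
    apply: measurable_funB; apply: m2 => //; exact: L2_q.
  apply: ae_imp (ae_and ea ec) => x [h1 h2] xH; rewrite h1 // h2 //; ring.
transitivity (\int[mu]_(t in H) (q t * p t * r t - p t * r2 t)); last first.
  apply/esym; apply: Rint_ae => //; first exact: m2.
    apply: measurable_funB; apply: m2 => //; exact: L2_q.
  apply: ae_imp eb => x h1 xH; rewrite h1 //; ring.
have Lqp := L2_q Lp.
by rewrite !RintegralB; rewrite ?(symmetric dp dr) //; exact: L2_mul_int.
Qed.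

(** The function q being bounded, it can be moved to the other side of the
    adjoint relation, which becomes that of the free operator. As the operator
    is real, real test functions give the real and the imaginary part of v. *)
Theorem dirichlet_self_adjoint : self_adjoint (dirichlet_schrodinger V).
Proof.
move=> v w Lv Lw; have [Lv1 Lv2] := (in_L2P v).1 Lv; have [Lw1 Lw2] := (in_L2P w).1 Lw.
split; last first.
  move=> [v0 [ev Tv]] u Tu TuP.
  have [p1 [p2 [s1 [s2 [[dp ds p0 s0] [La1 La2 ea1 ea2]]]]]] := (dirichletP u Tu).1 TuP.
  have [r1 [r2 [t1 [t2 [[dr dt r0 t0] [_ _ eb1 eb2]]]]]] := (dirichletP v0 w).1 Tv.
  have [Lu LTu] := dirichlet_in_L2 TuP.
  have ev1 : ae_half_line (fun x => rl v x = rl v0 x).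
    by apply: ae_imp ev => x h x0; rewrite /rl h.
  have ev2 : ae_half_line (fun x => im v x = im v0 x).
    by apply: ae_imp ev => x h x0; rewrite /im h.
  apply: complexP.
  - rewrite !L2innerRe //.
    by rewrite (symmetric_ae dp dr p0 r0 La1 Lw1 Lv1 ea1 eb1 ev1)
      (symmetric_ae ds dt s0 t0 La2 Lw2 Lv2 ea2 eb2 ev2).
  - rewrite !L2innerIm //.
    by rewrite (symmetric_ae dp dt p0 t0 La1 Lw2 Lv2 ea1 eb2 ev2)
      (symmetric_ae ds dr s0 r0 La2 Lw1 Lv1 ea2 eb1 ev1).
move=> hyp.
have z0 g : \int[mu]_(t in H) (0 * g t) = 0.
  transitivity (\int[mu]_(t in H) (0 : R)); last by rewrite /Rintegral integral0.
  by apply: eq_Rintegral => t _; rewrite mul0r.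
have key vr wr : L2 vr -> L2 wr -> (forall p p1 p2, real_H2 p p1 p2 -> p 0 = 0 ->
    \int[mu]_(t in H) ((- p2 t + q t * p t) * vr t) = \int[mu]_(t in H) (p t * wr t)) ->
    exists v0 v1 : R -> R, [/\ real_H2 v0 v1 (fun t => - (wr t - q t * vr t)), v0 0 = 0 &
    ae_half_line (fun x => vr x = v0 x)].
  move=> Lvr Lwr h; have Lqv := L2_q Lvr.
  apply: adjoint_of_free_operator => //; first exact: L2B.
  move=> p p1 p2 d p0; have [Lp _ Lp2 _ _] := d.
  have e := h p p1 p2 d p0.
  have -> : \int[mu]_(t in H) (p t * (wr t - q t * vr t)) =
      \int[mu]_(t in H) (p t * wr t) - \int[mu]_(t in H) (p t * (q t * vr t)).
    rewrite -RintegralB //; [|exact: L2_mul_int..].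
    by apply: eq_Rintegral => t _; rewrite mulrBr.
  rewrite -e -RintegralB //; [|apply: L2_mul_int => //|exact: L2_mul_int].
    by apply: eq_Rintegral => t _; ring.
  by apply: L2D; [exact: L2N|exact: L2_q].
have [|v0 [v1 [dv v00 ev]]] := key (rl v) (rl w) Lv1 Lw1.
  move=> p p1 p2 d p0; have T := dirichlet_real d p0; have [L1 L2_] := dirichlet_in_L2 T.
  have := congr1 (@complex.Re R) (hyp _ _ T); rewrite !L2innerRe // /rl /im /= !z0 !addr0.
  by [].
have [|s0 [s1 [ds s00 es]]] := key (im v) (im w) Lv2 Lw2.
  move=> p p1 p2 d p0; have T := dirichlet_real d p0; have [L1 L2_] := dirichlet_in_L2 T.
  have := congr1 (@complex.Im R) (hyp _ _ T); rewrite !L2innerIm // /rl /im /= !z0 !sub0r.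
  by move/oppr_inj.
exists (fun t => v0 t +i* s0 t); split.
  apply: ae_imp (ae_and ev es) => x [h1 h2] x0; apply: complexP; [exact: h1|exact: h2].
apply/dirichletP; exists v1, (fun t => - (rl w t - q t * rl v t)), s1,
  (fun t => - (im w t - q t * im v t)); split; first by split.
split => //.
- by apply: ae_imp ev => x h x0; rewrite /rl /= -/(rl v x) -/(rl w x) h //; ring.
- by apply: ae_imp es => x h x0; rewrite /im /= -/(im v x) -/(im w x) h //; ring.
Qed.

End Operator.

(** * Solutions that vanish at infinity *)

Section NonnegativeSpectrum.
Variable R : realType.
Local Notation mu := (@lebesgue_measure R).
Local Notation H := (half_line R).
Implicit Types (f g h p r s : R -> R) (x y t M N a b c k X : R) (u v w : R -> R[i]).
#[local] Hint Resolve measurable_segment measurable_half locint_cst : core.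

(** Chooses representatives that are continuous on the whole line. *)
Lemma real_H2_regular p p1 p2 : real_H2 p p1 p2 -> exists P P1 : R -> R,
  [/\ contin P, contin P1, (forall x, 0 <= x -> P x = p x) &
      (forall x, 0 <= x -> P1 x = p1 x)] /\
  [/\ L2 P, L2 P1, is_primitive P P1, (forall x, 0 < x -> dd P x (P1 x)) &
      forall x, P1 x = p1 0 + prim p2 x].
Proof.
move=> [Lp Lp1 Lp2 hp hp1].
have l1 := L2_locL2 Lp1; have l2 := L2_locL2 Lp2.
pose P x := p 0 + prim p1 x; pose P1 x := p1 0 + prim p2 x.
have cP : contin P by move=> t; rewrite /P; cnt; exact: (prim_contin l1.1).
have cP1 : contin P1 by move=> t; rewrite /P1; cnt; exact: (prim_contin l2.1).
have eP x : 0 <= x -> P x = p x by move=> x0; rewrite [RHS]hp.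
have eP1 x : 0 <= x -> P1 x = p1 x by move=> x0; rewrite [RHS]hp1.
have hP : is_primitive P P1.
  move=> x x0; rewrite /P prim0 addr0; congr (_ + _).
  by apply: prim_eq => t /andP[t0 _]; rewrite eP1.
exists P, P1; split => //; split => //.
- by apply: L2_eq Lp => x x0; rewrite eP.
- by apply: L2_eq Lp1 => x x0; rewrite eP1.
- by move=> x x0; exact: is_primitive_dd.
Qed.

Lemma is_primitive_dd_at P p x : is_primitive P p -> locint p -> 0 < x -> ct p x -> dd P x (p x).
Proof.
move=> hP ip x0 cx.
have d : dd (fun t => P 0 + prim p t) x (0 + p x).
  by apply: dadd; [exact: dcst|exact: prim_ftc].
rewrite add0r in d; apply: dnear d; near=> t; rewrite -hP // ltW //.
near: t; exact: lt_nbhsr.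
Unshelve. all: by end_near. Qed.

(** If P vanishes at M, then cutting it off creates no jump. *)
Lemma trunc_prim P p M : 0 <= M -> is_primitive P p -> locint p -> P M = 0 ->
  locint (trunc M p) -> is_primitive (trunc M P) (trunc M p).
Proof.
move=> M0 hP ip PM it x x0; rewrite [trunc M P 0]/trunc M0.
have e y : y <= M -> prim (trunc M p) y = prim p y.
  move=> yM; apply: prim_eq => t /andP[_ ty].
  by rewrite /trunc (le_trans ty).
rewrite /trunc; case: leP => xM; first by rewrite hP // e.
rewrite (@prim_support _ _ M) //; first by rewrite e // -hP.
  by move=> t Mt; rewrite /trunc leNgt Mt.
by rewrite M0 ltW.
Qed.

Lemma mul_expN_bound x : x * expR (- x) <= 4 / (1 + x) \/ x < 0.
Proof.
have [x0|x0] := leP 0 x; [left|by right].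
have h : 1 + x / 2 <= expR (x / 2) by exact: expR_ge1Dx.
have e : expR x = expR (x / 2) ^+ 2.
  by rewrite expr2 -expRD; congr expR; lra.
rewrite expRN ler_pdivrMr ?expR_gt0 // mulrAC ler_pdivlMr; last lra.
have h2 : (1 + x / 2) ^+ 2 <= expR x by rewrite e ler_sqr ?nnegrE //; lra.
nra.
Qed.

(** Both g - (C/k) e^{-kx} and - g - (C/k) e^{-kx} are nondecreasing with limit
    0. *)
Lemma exp_decay g g1 C k N : 0 < k -> 0 <= N -> contin g ->
  (forall x, N < x -> dd g x (g1 x)) -> (forall x, N < x -> `|g1 x| <= C * expR (- k * x)) ->
  g x @[x --> +oo] --> 0 -> forall x, N <= x -> `|g x| <= C / k * expR (- k * x).
Proof.
move=> k0 N0 cg dg hg lim x Nx.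
have ex (sg : R) : `|sg| = 1 -> sg * g x <= C / k * expR (- k * x).
  move=> s1; apply/ler_addgt0Pl => e e0.
  have [N' N'0 hN'] := cvgy_dist lim e0.
  set y := Num.max x N' + 1.
  have xy : x < y by rewrite /y ltr_pwDr // le_max lexx.
  have N'y : N' <= y by rewrite /y ler_wpDr // le_max lexx orbT.
  have ce : contin (fun t => C / k * expR (- k * t)) by move=> t; cnt.
  have m : sg * g x - C / k * expR (- k * x) <= sg * g y - C / k * expR (- k * y).
    apply: (@mono_le _ (fun t => sg * g t + - (C / k * expR (- k * t)))
      (fun t => sg * g1 t + C * expR (- k * t))) => //; first exact: ltW.
    - move=> t /andP[xt _]; have Nt : N < t by exact: le_lt_trans xt.
      have dgt := dg t Nt; apply: deq; [der|by field; rewrite gt_eqF].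
    - by move=> t _; cnt.
    - move=> t /andP[xt _]; have Nt : N < t by exact: le_lt_trans xt.
      have := hg t Nt; rewrite -[`|g1 t|]mul1r -s1 -normrM => h.
      have := ler_normr; rewrite -[sg * g1 t]opprK => _.
      have := ler_norm (- (sg * g1 t)); rewrite normrN; lra.
  have a1 : sg * g y < e.
    apply: le_lt_trans (hN' y N'y); rewrite subr0 -[leRHS]mul1r -s1 -normrM.
    exact: ler_norm.
  have C0 : 0 <= C.
    have Ny : N < y by exact: le_lt_trans xy.
    have := le_trans (normr_ge0 _) (hg y Ny).
    by rewrite pmulr_lge0 // expR_gt0.
  have : 0 <= C / k * expR (- k * y) by rewrite mulr_ge0 ?expR_ge0 // divr_ge0 // ltW.
  lra.
rewrite ler_norml; apply/andP; split.
- by have := ex (-1); rewrite normrN normr1 mulN1r => /(_ erefl); lra.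
- by have := ex 1; rewrite normr1 mul1r => /(_ erefl).
Qed.

Variables (q : R -> R) (K C : R).
Hypothesis cq : contin q.
Hypothesis qK : forall x, `|q x| <= K.
Hypothesis qC : forall x, 0 <= x -> (1 + x ^+ 2) * `|q x| <= C * expR (- x).

Let C0 : 0 <= C.
Proof.
have := le_trans _ (qC (lexx 0)); rewrite oppr0 expR0 mulr1; apply.
by rewrite mulr_ge0 // addr_ge0 // sqr_ge0.
Qed.

(** Gronwall backwards from infinity: the weight e^{-c e^{-x}} stays between two
    positive constants, so the limit 0 propagates to every finite point. *)
Lemma energy_tail e e' c (X0 : R) : 0 <= X0 -> contin e -> (forall x, 0 <= e x) -> 0 <= c ->
  (forall x, X0 < x -> dd e x (e' x)) ->
  (forall x, X0 < x -> 0 <= e' x + c * expR (- x) * e x) ->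
  e x @[x --> +oo] --> 0 -> forall x, X0 <= x -> e x = 0.
Proof.
move=> X00 ce e0 c0 de he lim x X0x; apply/eqP; rewrite eq_le e0 andbT.
have Ep : 0 < expR (- c * expR (- x)) by exact: expR_gt0.
rewrite -(pmulr_lle0 _ Ep); apply/ler_addgt0Pl => d d0; rewrite addr0.
have [N N0 hN] := cvgy_dist lim d0.
set y := Num.max x N.
have xy : x <= y by rewrite le_max lexx.
have Ny : N <= y by rewrite le_max lexx orbT.
have := @gronwall _ e e' (fun t => - c * expR (- t)) (fun t => c * expR (- t)) x y xy.
move=> g; have {g} : e x * expR (- c * expR (- x)) <= e y * expR (- c * expR (- y)).
  apply: g => t xty.
  - exact: ce.
  - by cnt.
  - by apply: de; case/andP: xty => xt _; exact: le_lt_trans xt.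
  - by apply: deq; [der|ring].
  - by apply: he; case/andP: xty => xt _; exact: le_lt_trans xt.
move/le_trans; apply; apply: (@le_trans _ _ (e y * 1)).
  by rewrite ler_wpM2l // -expR0 ler_expR mulNr oppr_le0 mulr_ge0 // expR_ge0.
by rewrite mulr1; have := hN y Ny; rewrite subr0 => /ltW; apply: le_trans; exact: ler_norm.
Qed.

Let qE x : 0 <= x -> `|q x| <= C * expR (- x).
Proof.
by move=> x0; apply: le_trans (qC x0); rewrite ler_peMl // lerDl sqr_ge0.
Qed.

(** For a > 0 the energy p'^2 + a p^2 changes at a relative rate O(e^{-x}). For
    a = 0 the free solutions are 1 and x, so one follows p - x p' and p'
    instead, which are constant for q = 0; the factor 1 + x^2 in the decay of q
    is what this costs. *)
Lemma decaying_solution_zero a p p1 (X0 : R) : 0 <= a -> 0 <= X0 -> contin p -> contin p1 ->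
  (forall x, X0 < x -> dd p x (p1 x)) ->
  (forall x, X0 < x -> dd p1 x ((q x - a) * p x)) ->
  p x @[x --> +oo] --> 0 -> p1 x @[x --> +oo] --> 0 ->
  forall x, X0 <= x -> p x = 0 /\ p1 x = 0.
Proof.
rewrite le_eqVlt => /predU1P[<-|a0] X00 cp cp1 dp dp1 lp lp1 x X0x; last first.
  pose e t := p1 t ^+ 2 + a * p t ^+ 2.
  pose e' t := 2 * q t * (p t * p1 t).
  suff : e x = 0.
    have h1 := sqr_ge0 (p1 x); have h2 : 0 <= a * p x ^+ 2.
      by rewrite mulr_ge0 ?sqr_ge0 // ltW.
    rewrite /e => h; have h3 : p1 x ^+ 2 = 0 by lra.
    have /eqP h4 : a * p x ^+ 2 = 0 by lra.
    move/eqP : h3; rewrite sqrf_eq0 => /eqP ->; split => //.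
    by move: h4; rewrite (mulf_eq0 a) gt_eqF //= sqrf_eq0 => /eqP.
  apply: (@energy_tail e e' (C * (1 + a^-1)) X0) => //.
  - by move=> t; rewrite /e; cnt.
  - by move=> t; rewrite /e addr_ge0 ?sqr_ge0 // mulr_ge0 ?sqr_ge0 // ltW.
  - by rewrite mulr_ge0 // addr_ge0 // invr_ge0 ltW.
  - move=> t X0t; have d1 := dp t X0t; have d2 := dp1 t X0t; rewrite /e.
    apply: deq; [der|rewrite /e' /=; ring].
  - move=> t X0t; have t0 : 0 <= t by rewrite ltW // (le_lt_trans X00).
    have h := qE t0; have E0 := expR_ge0 (- t).
    have b1 : `|e' t| <= `|q t| * (p t ^+ 2 + p1 t ^+ 2).
      rewrite /e' -mulrA mulrCA normrM ler_wpM2l // ler_norml; apply/andP; split.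
        by have := sqr_ge0 (p t + p1 t); nra.
      by have := sqr_ge0 (p t - p1 t); nra.
    have b2 : p t ^+ 2 + p1 t ^+ 2 <= (1 + a^-1) * e t.
      rewrite /e; have -> : (1 + a^-1) * (p1 t ^+ 2 + a * p t ^+ 2) =
        p t ^+ 2 + p1 t ^+ 2 + (a^-1 * p1 t ^+ 2 + a * p t ^+ 2).
        by field; rewrite gt_eqF.
      by rewrite lerDl addr_ge0 // mulr_ge0 ?sqr_ge0 ?invr_ge0 // ltW.
    have b3 : `|e' t| <= C * expR (- t) * ((1 + a^-1) * e t).
      apply: (le_trans b1); apply: ler_pM => //.
      by rewrite addr_ge0 // sqr_ge0.
    have := ler_norm (- e' t); rewrite normrN; move: b3; set A := _ * _ * (_ * _).
    rewrite (_ : C * (1 + a^-1) * expR (- t) * e t = A); last by rewrite /A; ring.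
    lra.
  - have h : p1 t * p1 t + a * (p t * p t) @[t --> +oo] --> (0 * 0 + a * (0 * 0) : R).
      by apply: cvgD; [exact: cvgM|apply: cvgM; [exact: cvg_cst|exact: cvgM]].
    rewrite !mulr0 addr0 in h; apply: cvgy_eq h => t _; by rewrite /e !expr2.
pose al t := p t - t * p1 t.
pose e t := al t ^+ 2 + p1 t ^+ 2.
pose e' t := 2 * q t * p t * (p1 t - t * al t).
have xp1 : t * p1 t @[t --> +oo] --> 0.
  have [N N0 hN] := cvgy_dist lp (ltr01 : 0 < 1 :> R).
  set N2 := Num.max N X0.
  have NN2 : N <= N2 by rewrite le_max lexx.
  have XN2 : X0 <= N2 by rewrite le_max lexx orbT.
  have N20 : 0 <= N2 by exact: le_trans NN2.
  have b t : N2 <= t -> `|p1 t| <= C / 1 * expR (- 1 * t).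
    apply: (@exp_decay p1 (fun t => (q t - 0) * p t) C 1 N2) => //.
    - by move=> y hy; apply: dp1; exact: le_lt_trans hy.
    - move=> y hy; rewrite subr0 normrM mulN1r.
      have y0 : 0 <= y by rewrite ltW // (le_lt_trans N20).
      have := hN y (le_trans NN2 (ltW hy)); rewrite subr0 => py.
      by apply: le_trans (qE y0); rewrite ler_piMr // ltW.
  apply: dist_cvgy => d d0.
  exists (Num.max N2 (4 * C / d + 1)) => t; rewrite ge_max => /andP[N2t dt].
  have t0 : 0 <= t by exact: le_trans N2t.
  rewrite subr0 normrM ger0_norm //.
  have := b t N2t; rewrite divr1 mulN1r => b1.
  apply: (@le_lt_trans _ _ (C * (t * expR (- t)))).
    by rewrite mulrCA ler_wpM2l.
  case: (mul_expN_bound t) => h; last by move: t0; rewrite leNgt h.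
  apply: (@le_lt_trans _ _ (C * (4 / (1 + t)))); first by rewrite ler_wpM2l.
  have t1 : 0 < 1 + t by lra.
  rewrite mulrA ltr_pdivrMr //.
  have : 4 * C / d < 1 + t by lra.
  by rewrite ltr_pdivrMr //; lra.
suff : e x = 0.
  have h1 := sqr_ge0 (p1 x); have h2 := sqr_ge0 (al x).
  rewrite /e => h; have /eqP h3 : p1 x ^+ 2 = 0 by lra.
  have /eqP h4 : al x ^+ 2 = 0 by lra.
  move: h3 h4; rewrite !sqrf_eq0 => /eqP h3 /eqP.
  by rewrite /al h3 mulr0 subr0.
apply: (@energy_tail e e' C X0) => //.
- by move=> t; rewrite /e /al; cnt.
- by move=> t; rewrite /e addr_ge0 // sqr_ge0.
- move=> t X0t; have d1 := dp t X0t; have d2 := dp1 t X0t; rewrite /e /al.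
  by apply: deq; [der|rewrite /e' /al /=; ring].
- move=> t X0t; have t0 : 0 <= t by rewrite ltW // (le_lt_trans X00).
  have h := qC t0.
  have b1 : `|e' t| <= `|q t| * (p t ^+ 2 + (p1 t - t * al t) ^+ 2).
    rewrite /e' -!mulrA mulrCA normrM ler_wpM2l // ler_norml; apply/andP; split.
      by have := sqr_ge0 (p t + (p1 t - t * al t)); nra.
    by have := sqr_ge0 (p t - (p1 t - t * al t)); nra.
  have b2 : p t ^+ 2 + (p1 t - t * al t) ^+ 2 = (1 + t ^+ 2) * e t.
    by rewrite /e /al; ring.
  have e0 : 0 <= e t by rewrite /e addr_ge0 // sqr_ge0.
  have b3 : `|e' t| <= C * expR (- t) * e t.
    apply: (le_trans b1); rewrite b2 mulrA [`|q t| * _]mulrC.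
    by rewrite ler_wpM2r.
  have := ler_norm (- e' t); rewrite normrN; lra.
- have la : al t @[t --> +oo] --> (0 - 0 : R) by apply: cvgB.
  rewrite subrr in la.
  have h : al t * al t + p1 t * p1 t @[t --> +oo] --> (0 * 0 + 0 * 0 : R).
    by apply: cvgD; exact: cvgM.
  by rewrite !mulr0 addr0 in h; apply: cvgy_eq h => t _; rewrite /e !expr2.
Qed.

End NonnegativeSpectrum.

(** * The half line of nonnegative spectral values *)

Section EigenfunctionParts.
Variable R : realType.
Local Notation mu := (@lebesgue_measure R).
Local Notation H := (half_line R).
Implicit Types (f g h p r s y : R -> R) (x t M N a b c k : R) (u v w : R -> R[i]).
#[local] Hint Resolve measurable_segment measurable_half locint_cst : core.

Lemma rl_scale a b u x : rl (fun x => (a +i* b) * u x) x = a * rl u x - b * im u x.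
Proof. by rewrite /rl ReM. Qed.
Lemma im_scale a b u x : im (fun x => (a +i* b) * u x) x = a * im u x + b * rl u x.
Proof. by rewrite /im ImM. Qed.

Variables (V q : R -> R) (K C : R).
Hypothesis cq : contin q.
Hypothesis qK : forall x, `|q x| <= K.
Hypothesis qC : forall x, 0 <= x -> (1 + x ^+ 2) * `|q x| <= C * expR (- x).
Hypothesis Vq : forall x, 0 < x -> V x = q x.
Local Notation T := (dirichlet_schrodinger V).

(** The eigenvalue equation holds almost everywhere with a continuous right-hand
    side, so the continuous representatives are classical solutions. *)
Lemma eigenfunction_parts a b u : T u (fun x => (a +i* b) * u x) ->
  exists p p1 s s1 : R -> R,
  [/\ contin p, contin p1, contin s & contin s1] /\
  [/\ L2 p, L2 p1, L2 s & L2 s1] /\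
  [/\ p 0 = 0, s 0 = 0, is_primitive p p1 & is_primitive s s1] /\
  [/\ (forall x, 0 < x -> dd p x (p1 x)),
      (forall x, 0 < x -> dd s x (s1 x)),
      (forall x, 0 < x -> dd p1 x ((q x - a) * p x + b * s x)) &
      (forall x, 0 < x -> dd s1 x ((q x - a) * s x - b * p x))] /\
  (forall x, 0 <= x -> u x = p x +i* s x).
Proof.
move=> /(dirichletP Vq) [p1 [p2 [s1 [s2 [[dp ds p0 s0] [_ _ ep es]]]]]].
have [P [P1 [[cP cP1 eP eP1] [LP LP1 hP dP P1E]]]] := real_H2_regular dp.
have [S [S1 [[cS cS1 eS eS1] [LS LS1 hS dS S1E]]]] := real_H2_regular ds.
have [_ _ Lp2 _ _] := dp; have [_ _ Ls2 _ _] := ds.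
have lp2 := (L2_locL2 Lp2).1; have ls2 := (L2_locL2 Ls2).1.
have cA : contin (fun x => (q x - a) * P x + b * S x) by move=> t; cnt.
have cB : contin (fun x => (q x - a) * S x - b * P x) by move=> t; cnt.
have hP1 : is_primitive P1 (fun x => (q x - a) * P x + b * S x).
  move=> x x0; rewrite P1E eP1 //; congr (_ + _).
  apply: prim_ae => //; first exact: contin_locint.
  apply: ae_imp ep => t h t0; rewrite eP // eS //.
  by have := h t0; rewrite rl_scale; lra.
have hS1 : is_primitive S1 (fun x => (q x - a) * S x - b * P x).
  move=> x x0; rewrite S1E eS1 //; congr (_ + _).
  apply: prim_ae => //; first exact: contin_locint.
  apply: ae_imp es => t h t0; rewrite eP // eS //.
  by have := h t0; rewrite im_scale; lra.
exists P, P1, S, S1; split => //; split => //; split.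
  by split => //; rewrite ?eP ?eS.
split; first split => //.
- by move=> x x0; exact: (is_primitive_dd cA).
- by move=> x x0; exact: (is_primitive_dd cB).
by move=> x x0; apply: complexP; rewrite /= ?eP ?eS.
Qed.

Lemma sol_is_primitive Q y y1 : contin Q -> sol Q y y1 ->
  is_primitive y y1 /\ is_primitive y1 (fun t => Q t * y t).
Proof.
move=> cQ [cy cy1 dy dy1]; have cQy : contin (fun t => Q t * y t) by move=> t; cnt.
split => x x0.
- by apply: prim_of_derive => //; exact: contin_locint.
- by apply: (@prim_of_derive R y1 (fun t => Q t * y t)) => //; exact: contin_locint.
Qed.

Lemma contin_qa a : contin (fun t => q t - a).
Proof. by move=> t; cnt. Qed.

Lemma L2_qa a p : L2 p -> L2 (fun t => (q t - a) * p t).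
Proof.
apply: (@L2_bmul _ _ _ (K + `|a|)); first by apply: measurable_contin => //; exact: contin_qa.
by move=> x _; rewrite (le_trans (ler_normB _ _)) // lerD2r.
Qed.

Lemma sol_L2 a y y1 : sol (fun t => q t - a) y y1 -> L2 y ->
  [/\ L2 y1, y x @[x --> +oo] --> 0 & y1 x @[x --> +oo] --> 0].
Proof.
move=> sy Ly; have [h h1] := sol_is_primitive (@contin_qa a) sy.
have Lq := L2_qa a Ly.
have Ly1 := L2_interpolation h h1 Ly Lq.
by split => //; apply: H1_vanishes_at_infinity; eassumption.
Qed.

Lemma sol_dom a y y1 : sol (fun t => q t - a) y y1 -> L2 y ->
  real_H2 y y1 (fun t => (q t - a) * y t).
Proof.
move=> sy Ly; have [h h1] := sol_is_primitive (@contin_qa a) sy.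
have [Ly1 _ _] := sol_L2 sy Ly.
by split => //; exact: L2_qa.
Qed.

Lemma sol_eig a y y1 : sol (fun t => q t - a) y y1 -> L2 y -> y 0 = 0 -> y1 0 = 1 ->
  T (fun t => y t +i* 0) (fun x => (a +i* 0) * (y x +i* 0)).
Proof.
move=> sy Ly y0 y10; apply/(dirichletP Vq).
exists y1, (fun t => (q t - a) * y t), (fun=> 0), (fun=> 0).
split; first by split => //; [exact: sol_dom|exact: real_H2_0].
have r x : rl (fun x => (a +i* 0) * (y x +i* 0)) x = a * y x.
  by rewrite rl_scale /= mul0r subr0.
have i x : im (fun x => (a +i* 0) * (y x +i* 0)) x = 0.
  by rewrite im_scale /rl /im /= mul0r mulr0 addr0.
split.
- by apply: (L2_eq _ (L2Z a Ly)) => x _; rewrite r.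
- by apply: (L2_eq _ (L2_real_0 R)) => x _; rewrite i.
- by apply: ae_pos => x _; rewrite r /rl /=; ring.
- by apply: ae_pos => x _; rewrite i /im /= mulr0 oppr0 addr0.
Qed.

(** By the backward half of the energy bound. *)
Lemma sol_nonzero a y y1 x : sol (fun t => q t - a) y y1 -> y 0 = 0 -> y1 0 = 1 ->
  0 <= x -> y x <> 0 \/ y1 x <> 0.
Proof.
move=> [cy cy1 dy dy1] y0 y10 x0; apply: contrapT => /not_orP[/contrapT a1 /contrapT a2].
have c0 : contin (fun=> 0 : R) by move=> t; cnt.
have d0 t : dd (fun=> 0 : R) t 0 by exact: dcst.
have [|||M hM] := @energy_bound _ q K qK a 0 y y1 (fun=> 0) (fun=> 0) cy cy1 c0 c0 dy.
- by move=> t _.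
- by move=> t t0; rewrite mul0r addr0; exact: dy1.
- by move=> t _; rewrite mul0r mulr0 subr0.
have x00 : 0 <= (0 : R) <= x by apply/andP.
have [_] := hM 0 x x00.
rewrite y0 y10 a1 a2 expr0n expr1n /= !addr0 add0r mul0r; lra.
Qed.

Lemma sol_pos_near0 Q y y1 : sol Q y y1 -> y 0 = 0 -> y1 0 = 1 ->
  exists2 d, 0 < d & forall x, 0 < x <= d -> 0 < y x.
Proof.
move=> [cy cy1 dy _] y0 y10.
have /cvgrPdist_lt /(_ (2^-1)) c := cy1 0.
have h2 : 0 < 2^-1 :> R by [].
have [d /= d0 hd] := c h2.
exists (d / 2); first by rewrite divr_gt0.
move=> x /andP[x0 xd]; rewrite -y0.
apply: (@mono_lt _ y y1) => //.
- by move=> t /andP[t0 _]; exact: dy.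
- move=> t /andP[t0 tx]; have := hd t.
  rewrite /= sub0r normrN gtr0_norm // => /(_ _); rewrite y10 => h.
  have {h} : `|1 - y1 t| < 2^-1 by apply: h; lra.
  rewrite ltr_norml => /andP[_]; lra.
Qed.

Lemma nonneg_not_eigenvalue a : 0 <= a -> ~ eigenvalue_of T (a +i* 0).
Proof.
move=> a0 [u [Tu nz]].
have [p [p1 [s [s1 [[cp cp1 cs cs1] [[Lp Lp1 Ls Ls1] [[p0 s0 hp hs] [[dp ds dp1 ds1] e]]]]]]]]
  := eigenfunction_parts Tu.
have Lq z : L2 z -> L2 (fun t => (q t - a) * z t) by exact: L2_qa.
have zero z z1 : contin z -> contin z1 -> L2 z -> L2 z1 -> is_primitive z z1 ->
    (forall x, 0 < x -> dd z x (z1 x)) -> (forall x, 0 < x -> dd z1 x ((q x - a) * z x)) ->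
    forall x, 0 <= x -> z x = 0.
  move=> cz cz1 Lz Lz1 hz dz dz1 x x0.
  have sz : sol (fun t => q t - a) z z1 by split.
  have [_ l l1] := sol_L2 sz Lz.
  by have [] := decaying_solution_zero qC a0 (lexx 0) cz cz1 dz dz1 l l1 x0.
apply: nz; apply: ae_pos => x x0; rewrite e ?ltW //; apply: complexP => /=.
- apply: (zero p p1) => //; last exact: ltW.
  by move=> t t0; have := dp1 t t0; rewrite mul0r addr0.
- apply: (zero s s1) => //; last exact: ltW.
  by move=> t t0; have := ds1 t t0; rewrite mul0r subr0.
Qed.

Lemma nonneg_sol_not_L2 a y y1 : 0 <= a -> sol (fun t => q t - a) y y1 -> y1 0 = 1 -> ~ L2 y.
Proof.
move=> a0 sy y10 Ly; have [_ l l1] := sol_L2 sy Ly; have [cy cy1 dy dy1] := sy.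
have [_] := decaying_solution_zero qC a0 (lexx 0) cy cy1 dy dy1 l l1 (lexx 0).
by rewrite y10; apply/eqP; rewrite oner_eq0.
Qed.

(** The function g equal to the regular solution y on [0, 1] and to 0 beyond has
    no preimage P. By [decaying_solution_zero], P would vanish from 1 on; the Wronskian of P
    and y would then vanish at 0 and at 1, while its derivative is - y^2 in
    between. *)
Lemma nonneg_not_surjective a : 0 <= a ->
  ~ (forall g : R -> R[i], in_L2 g -> shifted_range T (a +i* 0) g).
Proof.
move=> a0 surj.
have [y [y1 [sy [y0 y10]]]] := sol_exists cq qK a.
have [cy cy1 dy dy1] := sy.
pose g := trunc 1 y.
have Lg : L2 g by apply: L2_trunc; [exact: measurable_contin|case: (contin_locL2 cy)].
have lg := (L2_locL2 Lg).1.
have Lg' : in_L2 (fun t => g t +i* 0) by apply/in_L2P; split => //; exact: L2_real_0.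
have [u Tu] := surj _ Lg'.
have [p1 [p2 [s1 [s2 [[dp ds p0 s0] [_ _ ep es]]]]]] := (dirichletP Vq _ _).1 Tu.
have [P [P1 [[cP cP1 eP eP1] [LP LP1 hP dP P1E]]]] := real_H2_regular dp.
have [_ _ Lp2 _ _] := dp; have lp2 := (L2_locL2 Lp2).1.
have cA : contin (fun x => (q x - a) * P x) by move=> t; cnt.
pose F x := (q x - a) * P x - g x.
have lF : locint F by apply: locintB => //; exact: contin_locint.
have hP1 : is_primitive P1 F.
  move=> x x0; rewrite P1E eP1 //; congr (_ + _).
  apply: prim_ae => //; apply: ae_imp ep => t h t0; rewrite /F eP //.
  by have := h t0; rewrite /rl /= !reimE /= mul0r; rewrite /rl; lra.
have dP1 x : 1 < x -> dd P1 x ((q x - a) * P x).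
  move=> x1; have x0 : 0 < x by lra.
  have gx : g x = 0 by rewrite /g /trunc leNgt x1.
  rewrite (_ : (q x - a) * P x = F x); last by rewrite /F gx subr0.
  apply: is_primitive_dd_at => //.
  rewrite /ct /prop_for /continuous_at {2}/F gx subr0.
  apply: cvg_trans (cA x); apply: near_eq_cvg; near=> t.
  have t1 : 1 < t by near: t; exact: lt_nbhsr.
  by rewrite /F /g /trunc leNgt t1 subr0.
have LF : L2 F by apply: L2B => //; exact: L2_qa.
have l := H1_vanishes_at_infinity hP LP LP1; have l1 := H1_vanishes_at_infinity hP1 LP1 LF.
have [P_1 P1_1] := decaying_solution_zero qC a0 ler01 cP cP1
  (fun x (h : 1 < x) => dP x (lt_trans ltr01 h)) dP1 l l1 (lexx 1).
have [hy hy1] := sol_is_primitive (@contin_qa a) sy.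
have cQy : contin (fun t => (q t - a) * y t) by move=> t; cnt.
have A := is_primitive_mul hP1 hy (L2_locL2 LF) (contin_locL2 cy1) ler01.
have B := is_primitive_mul hP hy1 (contin_locL2 cP1) (contin_locL2 cQy) ler01.
have P00 : P 0 = 0 by rewrite eP.
rewrite P1_1 y0 mul0r mulr0 add0r in A; rewrite P_1 P00 !mul0r add0r in B.
have iA : locint (fun t => F t * y t + y1 t * P1 t).
  by apply: locintD; [exact: locintM|apply: contin_locint => t; cnt].
have iB : locint (fun t => P1 t * y1 t + (q t - a) * y t * P t).
  by apply: contin_locint => t; cnt.
have z : prim (fun t => y t ^+ 2) 1 = 0.
  have : prim (fun t => P1 t * y1 t + (q t - a) * y t * P t) 1 -
    prim (fun t => F t * y t + y1 t * P1 t) 1 = 0 by rewrite -A -B subrr.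
  rewrite -primB // => <-; apply: prim_eq => t /andP[_ t1].
  by rewrite /F /g /trunc t1; ring.
have hz := prim_eq0_ae (contin_locL2 cy).2 (fun t _ => sqr_ge0 _) z.
have [d d0 hd] := sol_pos_near0 sy y0 y10.
have dd0 : 0 < Num.min d 1 by rewrite lt_min d0 ltr01.
have [x /andP[x0 xd] hx] := ae_pt hz dd0.
move: xd; rewrite lt_min => /andP[xd x1].
have x01 : 0 <= x <= 1 by rewrite (ltW x0) ltW.
have xd' : 0 < x <= d by rewrite x0 ltW.
by have := hx x01; move/eqP; rewrite sqrf_eq0 gt_eqF // hd.
Unshelve. all: by end_near. Qed.

(** Solve p'' = (q - a) p - h with p(0) = 0. As h is orthogonal to y, the
    Wronskian of p and y vanishes at M, so adding a multiple of y makes p and p'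
    both vanish at M, and p can be cut off there. *)
Lemma trunc_solution a h M y y1 : L2 h -> 0 <= M -> (forall t, M < t -> h t = 0) ->
  sol (fun t => q t - a) y y1 -> y 0 = 0 -> y1 0 = 1 ->
  prim (fun t => h t * y t) M = 0 ->
  exists p p1, real_H2 p p1 (fun t => (q t - a) * p t - h t) /\ p 0 = 0.
Proof.
move=> Lh M0 hM sy y0 y10 o.
have lh := L2_locL2 Lh.
have [p [p1 [s [s1 [[cp cp1 _ _] [[p0 p10 _ _] [hp hp1 _ _]]]]]]] :=
  linear_ivp cq qK a 0 0 0 0 0 lh.1 (locint_cst 0).
have [cy cy1 dy dy1] := sy.
have [hy hy1] := sol_is_primitive (@contin_qa a) sy.
have cQy : contin (fun t => (q t - a) * y t) by move=> t; cnt.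
have cQp : contin (fun t => (q t - a) * p t) by move=> t; cnt.
have lF : locint (fun t => (q t - a) * p t - h t).
  by apply: locintB; [exact: contin_locint|case: lh].
have {}hp1 : is_primitive p1 (fun t => (q t - a) * p t - h t).
  by move=> x x0; rewrite hp1 //; congr (_ + _); apply: prim_eq => t _; ring.
have LtM f : contin f -> L2 (trunc M f).
  by move=> cf; apply: L2_trunc; [exact: measurable_contin|case: (contin_locL2 cf)].
have th t : trunc M h t = h t by rewrite /trunc; case: leP => // /hM.
have lF2 : locL2 (fun t => (q t - a) * p t - h t).
  split => // X.
  have i1 : locint (fun t => 2 * ((q t - a) * p t) ^+ 2 + 2 * h t ^+ 2).
    by apply: locintD; apply: locintZ; [case: (contin_locL2 cQp)|case: lh].
  apply: (intg_le _ _ _ (i1 X)) => //.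
    by apply: measurable_funX; apply: intg_meas; exact: lF.
  move=> t _; rewrite ger0_norm ?sqr_ge0 //.
  by have := sqr_ge0 ((q t - a) * p t + h t); nra.
have A := is_primitive_mul hp1 hy lF2 (contin_locL2 cy1) M0.
have B := is_primitive_mul hp hy1 (contin_locL2 cp1) (contin_locL2 cQy) M0.
rewrite p10 mul0r add0r in A; rewrite p0 mul0r add0r in B.
have iA : locint (fun t => ((q t - a) * p t - h t) * y t + y1 t * p1 t).
  by apply: locintD; [exact: (locintM lF cy)|apply: contin_locint => t; cnt].
have iB : locint (fun t => p1 t * y1 t + (q t - a) * y t * p t).
  by apply: contin_locint => t; cnt.
have W : p M * y1 M - p1 M * y M = 0.
  rewrite A B -primB // -o; apply: prim_eq => t _; ring.
have [c [P_M P1_M]] : exists c, p M + c * y M = 0 /\ p1 M + c * y1 M = 0.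
  have [yM|yM] := eqVneq (y M) 0.
    have y1M : y1 M != 0 by case: (sol_nonzero sy y0 y10 M0) => // /eqP.
    have pM : p M = 0.
      by move/eqP : W; rewrite yM mulr0 subr0 mulf_eq0 (negbTE y1M) orbF => /eqP.
    by exists (- p1 M / y1 M); rewrite yM pM; split; field.
  exists (- p M / y M); split; first by field.
  have e : p1 M = p M * y1 M / y M.
    by apply: (mulIf yM); rewrite divfK //; apply/eqP; rewrite eq_sym -subr_eq0 W.
  by rewrite e; field.
pose P t := p t + c * y t; pose P1 t := p1 t + c * y1 t.
pose P2 t := (q t - a) * P t - h t.
have cP : contin P by move=> t; rewrite /P; cnt.
have cP1 : contin P1 by move=> t; rewrite /P1; cnt.
have lP2 : locint P2.
  by apply: locintB; [apply: contin_locint => t; cnt|case: lh].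
have hP : is_primitive P P1.
  move=> x x0; have e : prim P1 x = prim p1 x + c * prim y1 x.
    rewrite primD; [by rewrite primZ //; exact: contin_locint|exact: contin_locint|].
    by apply: locintZ; exact: contin_locint.
  by rewrite e /P [p x]hp // [y x]hy //; ring.
have hP1 : is_primitive P1 P2.
  have lQy := contin_locint cQy.
  move=> x x0.
  have e : prim P2 x = prim (fun t => (q t - a) * p t - h t) x +
      c * prim (fun t => (q t - a) * y t) x.
    rewrite -primZ // -primD //; last exact: locintZ.
    by apply: prim_eq => t _; rewrite /P2 /P; ring.
  by rewrite e /P1 [p1 x]hp1 // [y1 x]hy1 //; ring.
have e2 t : (q t - a) * trunc M P t - h t = trunc M P2 t.
  by rewrite -th /trunc /P2; case: leP => // _; rewrite mulr0 subr0.
have LP2 : L2 (trunc M P2).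
  apply: (L2_eq _ (L2B (L2_qa a (LtM P cP)) Lh)) => x _; exact: e2.
exists (trunc M P), (trunc M P1).
have e3 : (fun t => (q t - a) * trunc M P t - h t) = trunc M P2 by apply/funext.
rewrite e3; split; last by rewrite /trunc M0 /P p0 y0 mulr0 addr0.
have LP1 := LtM P1 cP1.
split => //; first exact: LtM.
- apply: trunc_prim => //; first exact: contin_locint.
  exact: (L2_locL2 LP1).1.
- apply: trunc_prim => //; exact: (L2_locL2 LP2).1.
Qed.

(** Cut g off at N, and make it orthogonal to y by subtracting the multiple of y
    on [0, M] with coefficient <g, y> / <y, y>. The norm of what is subtracted
    tends to 0 as M grows, because y is not square integrable. *)
Lemma density_real a g e : 0 <= a -> L2 g -> 0 < e ->
  exists h p p1, [/\ real_H2 p p1 (fun t => (q t - a) * p t - h t), p 0 = 0, L2 h &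
    \int[mu]_(t in H) ((g t - h t) ^+ 2) < e].
Proof.
move=> a0 Lg e0.
have [mg ig] := Lg; have lg := L2_locL2 Lg.
set G := \int[mu]_(t in H) (g t ^+ 2).
have e4 : 0 < e / 4 by rewrite divr_gt0.
have [N N0 hN] := cvgy_dist (prim_cvg ig) e4.
have {}hN := hN N (lexx N); rewrite -/G in hN.
have [y [y1 [sy [y0 y10]]]] := sol_exists cq qK a.
have [cy cy1 dy dy1] := sy.
have ly := contin_locL2 cy.
set A := prim (fun t => g t * y t) N.
set B := 4 * A ^+ 2 / e + 1.
have [x x0 hx] : exists2 x, 0 <= x & B < prim (fun t => y t ^+ 2) x.
  apply: contrapT => no; apply: (nonneg_sol_not_L2 a0 sy y10); split.
    exact: measurable_contin.
  apply: (@integrable_of_bound _ _ B) => //.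
  - by apply: measurable_contin => // t; cnt.
  - exact: ly.2.
  - by move=> t _; exact: sqr_ge0.
  - by move=> x x0; rewrite leNgt; apply/negP => h; apply: no; exists x.
set M := Num.max x N.
have xM : x <= M by rewrite le_max lexx.
have NM : N <= M by rewrite le_max lexx orbT.
have M0 : 0 <= M by exact: le_trans NM.
set S := prim (fun t => y t ^+ 2) M.
have SB : B < S.
  apply: (lt_le_trans hx); apply: prim_ndecr => //; first exact: ly.2.
  by move=> t _; exact: sqr_ge0.
have B1 : 0 < B.
  by rewrite /B ltr_wpDl // divr_ge0 // ?(ltW e0) // mulr_ge0 // sqr_ge0.
have S0 : 0 < S by exact: lt_trans SB.
set k := A / S.
have Ltg : L2 (trunc N g) by apply: L2_trunc => //; exact: lg.2.
have Lty : L2 (trunc M y) by apply: L2_trunc; [exact: measurable_contin|exact: ly.2].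
pose h t := trunc N g t - k * trunc M y t.
have Lh : L2 h by apply: L2B => //; exact: L2Z.
have hM t : M < t -> h t = 0.
  move=> Mt; rewrite /h /trunc !leNgt Mt (le_lt_trans NM Mt) /=; ring.
have igy : locint (fun t => g t * y t) by exact: (locintM lg.1 cy).
have itgy : locint (fun t => trunc N g t * y t).
  by apply: (locintM _ cy); exact: (L2_locL2 Ltg).1.
have o : prim (fun t => h t * y t) M = 0.
  have -> : prim (fun t => h t * y t) M = prim (fun t => trunc N g t * y t - k * y t ^+ 2) M.
    by apply: prim_eq => t /andP[_ tM]; rewrite /h {2}/trunc tM; ring.
  rewrite primB //; last by apply: locintZ; exact: ly.2.
  rewrite primZ; last exact: ly.2.
  rewrite (@prim_support _ _ N M) //; last 2 first.
  - by move=> t Nt; rewrite /trunc leNgt Nt mul0r.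
  - by rewrite N0.
  rewrite (_ : prim _ N = A); last first.
    by apply: prim_eq => t /andP[_ tN]; rewrite /trunc tN.
  by rewrite -/S /k divfK ?subrr // gt_eqF.
have [p [p1 [dp p0]]] := trunc_solution Lh M0 hM sy y0 y10 o.
exists h, p, p1; split => //.
have Ld : L2 (fun t => g t - trunc N g t) by exact: L2B.
have i1 : \int[mu]_(t in H) ((g t - trunc N g t) ^+ 2) = G - prim (fun t => g t ^+ 2) N.
  have -> : prim (fun t => g t ^+ 2) N = \int[mu]_(t in H) (trunc N g t ^+ 2).
    rewrite (@int_support _ _ N) //; last 2 first.
    - by case: Ltg.
    - by move=> t Nt; rewrite /trunc leNgt Nt expr0n.
    by apply: prim_eq => t /andP[_ tN]; rewrite /trunc tN.
  rewrite /G -RintegralB //; last by case: Ltg.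
  by apply: eq_Rintegral => t _; rewrite /trunc; case: leP => _; ring.
have i2 : \int[mu]_(t in H) (trunc M y t ^+ 2) = S.
  rewrite (@int_support _ _ M) //; last 2 first.
  - by case: Lty.
  - by move=> t Nt; rewrite /trunc leNgt Nt expr0n.
  by apply: prim_eq => t /andP[_ tN]; rewrite /trunc tN.
have j1 : integrable_on H (fun t => 2 * (g t - trunc N g t) ^+ 2).
  by apply: intgZ => //; case: Ld.
have j2 : integrable_on H (fun t => 2 * k ^+ 2 * trunc M y t ^+ 2).
  by apply: intgZ => //; case: Lty.
apply: (@le_lt_trans _ _ (\int[mu]_(t in H)
    (2 * (g t - trunc N g t) ^+ 2 + 2 * k ^+ 2 * trunc M y t ^+ 2))).
  apply: le_Rintegral => //.
  - by case: (L2B Lg Lh).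
  - exact: intgD.
  - move=> t _; rewrite /h; have := sqr_ge0 ((g t - trunc N g t) - k * trunc M y t).
    by move: (g t) (trunc N g t) (trunc M y t) => *; nra.
rewrite RintegralD // !RintegralZl //; [|by case: Lty|by case: Ld].
rewrite i1 i2.
have -> : 2 * k ^+ 2 * S = 2 * A ^+ 2 / S by rewrite /k; field; rewrite gt_eqF.
have b1 : 2 * A ^+ 2 / S < e / 2.
  rewrite ltr_pdivrMr //.
  have : 4 * A ^+ 2 / e < S by apply: lt_trans SB; rewrite /B ltrDl.
  rewrite ltr_pdivrMr //; lra.
move: hN; rewrite ltr_norml => /andP[]; lra.
Qed.

Lemma nonneg_dense a (g : R -> R[i]) (e : R) : 0 <= a -> in_L2 g -> 0 < e ->
  exists h : R -> R[i], [/\ shifted_range T (a +i* 0) h, in_L2 h & L2norm (fun x => g x - h x) < e].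
Proof.
move=> a0 /in_L2P[L1 L2_] e0.
have e2 : 0 < e ^+ 2 / 2 by rewrite divr_gt0 // exprn_gt0.
have [h [p [p1 [dp p0 Lh hp]]]] := density_real a0 L1 e2.
have [k [s [s1 [ds s0 Lk hk]]]] := density_real a0 L2_ e2.
have Lhk : in_L2 (fun t => h t +i* k t) by apply/in_L2P.
exists (fun t => h t +i* k t); split => //.
- exists (fun t => p t +i* s t); apply/(dirichletP Vq).
  exists p1, (fun t => (q t - a) * p t - h t), s1, (fun t => (q t - a) * s t - k t).
  split; first by split.
  have [Lp _ _ _ _] := dp; have [Ls _ _ _ _] := ds.
  have r x : rl (fun x => (h x +i* k x) + (a +i* 0) * (p x +i* s x)) x = h x + a * p x.
    by rewrite /rl !reimE /= mul0r subr0.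
  have i x : im (fun x => (h x +i* k x) + (a +i* 0) * (p x +i* s x)) x = k x + a * s x.
    by rewrite /im !reimE /= mul0r addr0.
  split.
  + by apply: (L2_eq _ (L2D Lh (L2Z a Lp))) => x _; rewrite r.
  + by apply: (L2_eq _ (L2D Lk (L2Z a Ls))) => x _; rewrite i.
  + by apply: ae_pos => x _; rewrite r /rl /=; ring.
  + by apply: ae_pos => x _; rewrite i /im /=; ring.
- rewrite /L2norm.
  have -> : \int[mu]_(x in H) cnorm2 (g x - (h x +i* k x)) =
     \int[mu]_(t in H) ((rl g t - h t) ^+ 2) + \int[mu]_(t in H) ((im g t - k t) ^+ 2).
    rewrite -RintegralD //; last 2 first.
    + by case: (L2B L1 Lh).
    + by case: (L2B L2_ Lk).
    by apply: eq_Rintegral => t _; rewrite /cnorm2 !reimE.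
  rewrite -[ltRHS](ger0_norm (ltW e0)) -sqrtr_sqr ltr_sqrt ?exprn_gt0 //; lra.
Qed.

End EigenfunctionParts.

(** * Surjectivity off the half line *)

Section Resolvent.
Variable R : realType.
Local Notation mu := (@lebesgue_measure R).
Local Notation H := (half_line R).
Implicit Types (f g h p r s y : R -> R) (x t M N a b c k : R) (u v w : R -> R[i]).
#[local] Hint Resolve measurable_segment measurable_half locint_cst : core.

(** The number - a + k b is the real part of (1 + ik)(-lambda) for lambda = a +
    ib. *)
Lemma coercivity_direction a b : b != 0 \/ a < 0 -> exists k, 0 < - a + k * b.
Proof.
move=> h; have [b0|b0] := eqVneq b 0.
  by exists 0; rewrite mul0r addr0 oppr_gt0; case: h => //; rewrite b0 eqxx.
by exists ((`|a| + 1) / b); rewrite divfK //; have := ler_norm a; lra.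
Qed.

(** Bolzano-Weierstrass for pairs, with one cluster point that inherits all the
    closed conditions which hold eventually. *)
Lemma cluster_pair (c1 c2 : nat -> R) M : (forall n, `|c1 n| <= M) ->
  (forall n, `|c2 n| <= M) -> exists z1 z2 : R, forall (A : R -> R -> R) (B : R) n0,
    (forall d1 d2 e, 0 < e -> exists2 d, 0 < d & forall x1 x2,
       `|d1 - x1| < d -> `|d2 - x2| < d -> `|A d1 d2 - A x1 x2| < e) ->
    (forall n, (n0 <= n)%N -> A (c1 n) (c2 n) <= B) -> A z1 z2 <= B.
Proof.
move=> h1 h2.
have cpt : compact (`[- M, M] `*` `[- M, M] : set (R * R)).
  by apply: compact_setX; exact: segment_compact.
have [[z1 z2] [_ cl]] : (`[- M, M] `*` `[- M, M]) `&`
    cluster ((fun n => (c1 n, c2 n)) @ \oo) !=set0.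
  apply: cpt; exists 0%N => // n _ /=; split; rewrite /= in_itv /= -ler_norml //.
exists z1, z2 => A B n0 cA hA; rewrite leNgt; apply/negP => lt.
have e0 : 0 < A z1 z2 - B by rewrite subr_gt0.
have [d d0 hd] := cA z1 z2 _ e0.
have n1 : ((fun n => (c1 n, c2 n)) @ \oo) [set x : R * R | A x.1 x.2 <= B].
  by exists n0 => // n /= n0n; exact: hA.
have n2 : nbhs (z1, z2) [set x : R * R | `|z1 - x.1| < d /\ `|z2 - x.2| < d].
  exists ([set x | `|z1 - x| < d], [set x | `|z2 - x| < d]) => /=.
    by split; exists d.
  by move=> [x1 x2] /=.
have [[x1 x2] /= [hx [b1 b2]]] := cl _ _ n1 n2.
have := hd x1 x2 b1 b2; rewrite ltr_norml => /andP[_]; lra.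
Qed.

Variables (V q : R -> R) (K C : R).
Hypothesis cq : contin q.
Hypothesis qK : forall x, `|q x| <= K.
Hypothesis qC : forall x, 0 <= x -> (1 + x ^+ 2) * `|q x| <= C * expR (- x).
Hypothesis Vq : forall x, 0 < x -> V x = q x.
Local Notation T := (dirichlet_schrodinger V).

Lemma potential_small e : 0 < e -> exists2 N, 0 <= N & forall x, N <= x -> `|q x| <= e.
Proof.
move=> e0; exists (`|C| / e); first by rewrite divr_ge0 // ltW.
move=> x Nx; have x0 : 0 <= x by apply: le_trans Nx; rewrite divr_ge0 // ltW.
have h1 : `|q x| <= `|C| * expR (- x).
  apply: (@le_trans _ _ ((1 + x ^+ 2) * `|q x|)).
    by rewrite ler_peMl // lerDl sqr_ge0.
  by apply: (le_trans (qC x0)); rewrite ler_wpM2r ?expR_ge0 // ler_norm.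
apply: (le_trans h1); rewrite expRN ler_pdivrMr ?expR_gt0 //.
have h2 : 1 + x <= expR x by exact: expR_ge1Dx.
move: Nx; rewrite ler_pdivrMr // => Nx.
apply: (le_trans Nx); rewrite mulrC ler_wpM2l // ?ltW //; lra.
Qed.

Section Fixed.
Variables (a b k : R).
Hypothesis kab : 0 < - a + k * b.
Let dl := - a + k * b.

(** A solution u = p + i s of u'' = (q - lambda) u - (g1 + i g2), for lambda = a
    + ib. *)
Definition forced_sol (g1 g2 p p1 s s1 : R -> R) :=
  [/\ contin p, contin p1, contin s & contin s1] /\
  [/\ is_primitive p p1, is_primitive p1 (fun t => (q t - a) * p t + b * s t - g1 t),
      is_primitive s s1 & is_primitive s1 (fun t => (q t - a) * s t - b * p t - g2 t)].

(** The real part of (1 + ik) conj(u) u', for u = p + i s. *)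
Definition flux (p p1 s s1 : R -> R) t :=
  (p t * p1 t + s t * s1 t) - k * (p t * s1 t - s t * p1 t).

Definition density (p p1 s s1 : R -> R) t :=
  p1 t ^+ 2 + s1 t ^+ 2 + dl / 2 * (p t ^+ 2 + s t ^+ 2).

Lemma forced_sol_comb g1 g2 p p1 s s1 y y1 z z1 c1 c2 :
  locint g1 -> locint g2 ->
  forced_sol g1 g2 p p1 s s1 -> forced_sol (fun=> 0) (fun=> 0) y y1 z z1 ->
  forced_sol g1 g2 (fun t => p t + c1 * y t - c2 * z t) (fun t => p1 t + c1 * y1 t - c2 * z1 t)
    (fun t => s t + c1 * z t + c2 * y t) (fun t => s1 t + c1 * z1 t + c2 * y1 t).
Proof.
move=> i1 i2 [[cp cp1 cs cs1] [hp hp1 hs hs1]] [[cy cy1 cz cz1] [hy hy1 hz hz1]].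
have comb P p' Y y' Z z' d1 d2 : is_primitive P p' -> is_primitive Y y' -> is_primitive Z z' ->
    locint p' -> locint y' -> locint z' ->
    is_primitive (fun t => P t + d1 * Y t + d2 * Z t) (fun t => p' t + d1 * y' t + d2 * z' t).
  move=> hP hY hZ ip iy iz x x0.
  rewrite primD; [|by apply: locintD => //; exact: locintZ|exact: locintZ].
  rewrite primD //; last exact: locintZ.
  by rewrite !primZ // [P x]hP // [Y x]hY // [Z x]hZ //; ring.
have iF1 : locint (fun t => (q t - a) * p t + b * s t - g1 t).
  by apply: locintB => //; apply: contin_locint => t; cnt.
have iF2 : locint (fun t => (q t - a) * s t - b * p t - g2 t).
  by apply: locintB => //; apply: contin_locint => t; cnt.
have iY1 : locint (fun t => (q t - a) * y t + b * z t - 0).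
  by apply: contin_locint => t; cnt.
have iY2 : locint (fun t => (q t - a) * z t - b * y t - 0).
  by apply: contin_locint => t; cnt.
split; first by split => t; cnt.
have ext P p' P2 p2 : is_primitive P p' -> (forall t, P t = P2 t) -> (forall t, p' t = p2 t) ->
    is_primitive P2 p2.
  by move=> h /funext <- /funext <-.
split.
- apply: ext (comb _ _ _ _ _ _ c1 (- c2) hp hy hz _ _ _) _ _ => [|||t|t];
   [exact: contin_locint..|ring|ring].
- apply: ext (comb _ _ _ _ _ _ c1 (- c2) hp1 hy1 hz1 _ _ _) _ _ => // t; ring.
- apply: ext (comb _ _ _ _ _ _ c1 c2 hs hz hy _ _ _) _ _ => [|||t|t];
   [exact: contin_locint..|ring|ring].
- apply: ext (comb _ _ _ _ _ _ c1 c2 hs1 hz1 hy1 _ _ _) _ _ => // t; ring.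
Qed.

Section Flux.
Variables (N : R) (g1 g2 p p1 s s1 : R -> R).
Hypothesis N0 : 0 <= N.
Hypothesis hN : forall x, N <= x -> `|q x| <= dl / 4.
Hypotheses (Lg1 : L2 g1) (Lg2 : L2 g2).
Hypothesis hu : forced_sol g1 g2 p p1 s s1.

Let D := 2 * (1 + k ^+ 2) / dl.
Let G := \int[mu]_(t in H) (g1 t ^+ 2 + g2 t ^+ 2).
Let Q := flux p p1 s s1.
Let E := prim (density p p1 s s1).

Lemma density_contin : contin (density p p1 s s1).
Proof. by have [[? ? ? ?] _] := hu => t; rewrite /density; cnt. Qed.

(** The derivative of the flux is |u'|^2 + (q + dl) |u|^2 up to terms linear in
    g. Beyond N one has |q| <= dl / 4, and the linear terms are absorbed by the
    inequality of Young. *)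
Lemma flux_growth x (y : R) : N <= x <= y -> Q x + (E y - E x) <= Q y + D * G.
Proof.
move=> /andP[Nx xy].
have [[cp cp1 cs cs1] [hp hp1 hs hs1]] := hu.
have x0 : 0 <= x by exact: le_trans Nx.
have y0 : 0 <= y by exact: le_trans xy.
have lg1 := L2_locL2 Lg1; have lg2 := L2_locL2 Lg2.
pose A t := (q t - a) * p t + b * s t; pose B t := (q t - a) * s t - b * p t.
have cA : contin A by move=> t; rewrite /A; cnt.
have cB : contin B by move=> t; rewrite /B; cnt.
have locsub f g : contin f -> locL2 g -> locL2 (fun t => f t - g t).
  move=> cf [lg lg']; split; first by apply: locintB => //; exact: contin_locint.
  move=> X; have i1 : locint (fun t => 2 * f t ^+ 2 + 2 * g t ^+ 2).
    by apply: locintD; apply: locintZ => //; case: (contin_locL2 cf).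
  apply: (intg_le _ _ _ (i1 X)) => //.
    apply: measurable_funX; apply: measurable_funB; first exact: measurable_contin.
    by apply: intg_meas; exact: lg.
  move=> t _; rewrite ger0_norm ?sqr_ge0 //.
  by have := sqr_ge0 (f t + g t); nra.
have l1 : locL2 (fun t => A t - g1 t) by exact: locsub.
have l2 : locL2 (fun t => B t - g2 t) by exact: locsub.
have M1 := is_primitive_mul hp hp1 (contin_locL2 cp1) l1.
have M2 := is_primitive_mul hs hs1 (contin_locL2 cs1) l2.
have M3 := is_primitive_mul hp hs1 (contin_locL2 cp1) l2.
have M4 := is_primitive_mul hs hp1 (contin_locL2 cs1) l1.
have j1 : locint (fun t => p1 t * p1 t + (A t - g1 t) * p t).
  by apply: locintD; [apply: contin_locint => t; cnt|exact: (locintM l1.1 cp)].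
have j2 : locint (fun t => s1 t * s1 t + (B t - g2 t) * s t).
  by apply: locintD; [apply: contin_locint => t; cnt|exact: (locintM l2.1 cs)].
have j3 : locint (fun t => p1 t * s1 t + (B t - g2 t) * p t).
  by apply: locintD; [apply: contin_locint => t; cnt|exact: (locintM l2.1 cp)].
have j4 : locint (fun t => s1 t * p1 t + (A t - g1 t) * s t).
  by apply: locintD; [apply: contin_locint => t; cnt|exact: (locintM l1.1 cs)].
pose W t := ((p1 t * p1 t + (A t - g1 t) * p t) + (s1 t * s1 t + (B t - g2 t) * s t)) -
  k * ((p1 t * s1 t + (B t - g2 t) * p t) - (s1 t * p1 t + (A t - g1 t) * s t)).
have jW : locint W by apply: locintB; [exact: locintD|apply: locintZ; exact: locintB].
have hQ : is_primitive Q W.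
  move=> z z0; rewrite /W primB; [|exact: locintD|apply: locintZ; exact: locintB].
  rewrite primD // primZ; last exact: locintB.
  by rewrite primB // /Q /flux M1 // M2 // M3 // M4 //; ring.
have jg : locint (fun t => g1 t ^+ 2 + g2 t ^+ 2) by apply: locintD; [case: lg1|case: lg2].
have jE : locint (density p p1 s s1) by apply: contin_locint; exact: density_contin.
have xy' : 0 <= x <= y by rewrite x0.
have := @prim_incr_le _ (fun t => density p p1 s s1 t - D * (g1 t ^+ 2 + g2 t ^+ 2)) W x y xy'.
move=> h; have {h} : prim (fun t => density p p1 s s1 t - D * (g1 t ^+ 2 + g2 t ^+ 2)) y -
   prim (fun t => density p p1 s s1 t - D * (g1 t ^+ 2 + g2 t ^+ 2)) x <= prim W y - prim W x.
  apply: h => //; first by apply: locintB => //; exact: locintZ.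
  move=> t /andP[/ltW xt _].
  have := hN (le_trans Nx xt); rewrite ler_norml => /andP[q1 q2].
  have -> : W t = p1 t ^+ 2 + s1 t ^+ 2 + (q t + dl) * (p t ^+ 2 + s t ^+ 2) -
    (p t * g1 t + s t * g2 t) + k * (p t * g2 t - s t * g1 t).
    by rewrite /W /A /B /dl; ring.
  have yg (z w : R) : z * w <= dl / 8 * z ^+ 2 + 2 / dl * w ^+ 2.
    have := sqr_ge0 (dl / 4 * z - w); rewrite -(pmulr_rge0 _ (_ : 0 < 2 / dl)); last first.
      by rewrite divr_gt0.
    have -> : 2 / dl * (dl / 4 * z - w) ^+ 2 =
      dl / 8 * z ^+ 2 + 2 / dl * w ^+ 2 - z * w by field; rewrite gt_eqF.
    lra.
  have a1 := yg (p t) (g1 t); have a2 := yg (s t) (g2 t).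
  have a3 := yg (p t) (- (k * g2 t)); have a4 := yg (s t) (k * g1 t).
  have b1 : (dl - dl / 4) * (p t ^+ 2 + s t ^+ 2) <= (q t + dl) * (p t ^+ 2 + s t ^+ 2).
    by rewrite ler_wpM2r ?addr_ge0 ?sqr_ge0 //; lra.
  have e1 : D * (g1 t ^+ 2 + g2 t ^+ 2) = 2 / dl * g1 t ^+ 2 + 2 / dl * g2 t ^+ 2 +
    2 / dl * (- (k * g2 t)) ^+ 2 + 2 / dl * (k * g1 t) ^+ 2.
    by rewrite /D; ring.
  rewrite e1 /density.
  move: a1 a2 a3 a4 b1.
  move: (2 / dl * g1 t ^+ 2) (2 / dl * g2 t ^+ 2) (2 / dl * (- (k * g2 t)) ^+ 2)
    (2 / dl * (k * g1 t) ^+ 2) ((q t + dl) * _) => *; lra.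
have e1 z : prim (fun t => density p p1 s s1 t - D * (g1 t ^+ 2 + g2 t ^+ 2)) z =
    E z - D * prim (fun t => g1 t ^+ 2 + g2 t ^+ 2) z.
  by rewrite primB ?primZ //; exact: locintZ.
rewrite !e1.
have gx0 : 0 <= prim (fun t => g1 t ^+ 2 + g2 t ^+ 2) x.
  by apply: prim_ge0 => t _; rewrite addr_ge0 ?sqr_ge0.
have gy0 : prim (fun t => g1 t ^+ 2 + g2 t ^+ 2) y <= G.
  apply: prim_le_half; last by move=> t _; rewrite addr_ge0 ?sqr_ge0.
  by apply: intgD => //; [case: Lg1|case: Lg2].
have D0 : 0 <= D.
  by apply: divr_ge0; [rewrite mulr_ge0 // addr_ge0 // sqr_ge0|exact: ltW].
have := ler_wpM2l D0 (lerB gy0 gx0); rewrite subr0.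
by rewrite [Q x]hQ // [Q y]hQ //; lra.
Qed.

(** By [flux_growth] the flux controls the integral of the density, up to a
    constant. *)
Lemma flux_bounded_L2 (B : R) : (forall X, exists2 x, X <= x & Q x <= B) ->
  [/\ L2 p, L2 p1, L2 s & L2 s1].
Proof.
move=> hB.
have [[cp cp1 cs cs1] _] := hu.
have cE := density_contin; have jE := contin_locint cE.
have e0 t : 0 <= density p p1 s s1 t.
  rewrite /density addr_ge0 //; first by rewrite addr_ge0 ?sqr_ge0.
  by rewrite mulr_ge0 //; [rewrite divr_ge0 // ltW|rewrite addr_ge0 ?sqr_ge0].
have Eb x : 0 <= x -> E x <= B + D * G - Q N + E N.
  move=> x0; have [X] := hB (Num.max x N); rewrite ge_max => /andP[xX NX] QX.
  have h : N <= N <= X by rewrite lexx.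
  have := flux_growth h.
  have : E x <= E X by apply: prim_ndecr.
  lra.
have crit f c : contin f -> 0 < c -> (forall t, c * f t ^+ 2 <= density p p1 s s1 t) -> L2 f.
  move=> cf c0 hf; split; first exact: measurable_contin.
  have lf := contin_locL2 cf.
  apply: (@integrable_of_bound _ _ ((B + D * G - Q N + E N) / c)) => //.
  - by apply: measurable_funX; exact: measurable_contin.
  - exact: lf.2.
  - by move=> t _; exact: sqr_ge0.
  move=> x x0; rewrite ler_pdivlMr // mulrC -primZ; last exact: lf.2.
  apply: le_trans (Eb x x0); apply: prim_le => //.
  by apply: locintZ; exact: lf.2.
have d2 : 0 < dl / 2 by rewrite divr_gt0.
have sq0 := sqr_ge0.
have pos (c z w : R) : 0 < c -> 0 <= c * (z ^+ 2 + w ^+ 2).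
  by move=> c0; rewrite mulr_ge0 //; [exact: ltW|rewrite addr_ge0 ?sqr_ge0].
split.
- apply: (crit _ _ cp d2) => t; rewrite /density mulrDr.
  have := sq0 _ (p1 t); have := sq0 _ (s1 t); have := mulr_ge0 (ltW d2) (sq0 _ (s t)); lra.
- apply: (crit _ _ cp1 ltr01) => t; rewrite /density mul1r.
  have := sq0 _ (s1 t); have := pos _ (p t) (s t) d2; lra.
- apply: (crit _ _ cs d2) => t; rewrite /density mulrDr.
  have := sq0 _ (p1 t); have := sq0 _ (s1 t); have := mulr_ge0 (ltW d2) (sq0 _ (p t)); lra.
- apply: (crit _ _ cs1 ltr01) => t; rewrite /density mul1r.
  have := sq0 _ (p1 t); have := pos _ (p t) (s t) d2; lra.
Qed.

End Flux.

(** For large X, a particular solution u_p plus a complex multiple c_X of the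
    regular solution phi vanishes at 0 and at X. Its flux is 0 at X, so by
    [flux_growth] it is bounded on [N, X] independently of X. The flux of phi is
    positive at some X0, since phi would otherwise be an eigenfunction; as the
    flux at X0 of u_p + c phi is quadratic in c with that leading coefficient,
    the c_X are bounded. For a cluster point c of them the flux of u_p + c phi
    is bounded, and u_p + c phi lies in H^2. *)
Lemma resolvent_surjective (g : R -> R[i]) : ~ eigenvalue_of T (a +i* b) ->
  in_L2 g -> shifted_range T (a +i* b) g.
Proof.
move=> ne /in_L2P[Lg1 Lg2].
set g1 := rl g in Lg1; set g2 := im g in Lg2.
have lg1 := L2_locL2 Lg1; have lg2 := L2_locL2 Lg2.
have L0 := L2_real_0 R.
have dl4 : 0 < dl / 4 by rewrite divr_gt0.
have [N N0 hN] := potential_small dl4.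
have [y [y1 [z [z1 [cY [[y0 y10 z0 z10] hY]]]]]] :=
  linear_ivp cq qK a b 0 1 0 0 (locint_cst 0) (locint_cst 0).
have sY : forced_sol (fun=> 0) (fun=> 0) y y1 z z1 by split.
have [p [p1 [s [s1 [cU [[p0 p10 s0 s10] hU]]]]]] :=
  linear_ivp cq qK a b 0 0 0 0 lg1.1 lg2.1.
have sU : forced_sol g1 g2 p p1 s s1 by split.
have [[cy cy1 cz cz1] [hy hy1 hz hz1]] := sY.
have csL2 h1 h2 P P1 S S1 : L2 h1 -> L2 h2 -> forced_sol h1 h2 P P1 S S1 ->
    [/\ L2 P, L2 P1, L2 S & L2 S1] ->
    real_H2 P P1 (fun t => (q t - a) * P t + b * S t - h1 t) /\
    real_H2 S S1 (fun t => (q t - a) * S t - b * P t - h2 t).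
  move=> Lh1 Lh2 [_ [hP hP1 hS hS1]] [LP LP1 LS LS1]; split; split => //.
  - by apply: L2B => //; apply: L2D; [exact: (L2_qa cq qK)|exact: L2Z].
  - by apply: L2B => //; apply: L2B; [exact: (L2_qa cq qK)|exact: L2Z].
(* the regular solution is not square integrable, so its flux becomes positive *)
have posQ : exists2 X0, N <= X0 & forall x, X0 <= x -> 0 < flux y y1 z z1 x.
  apply: contrapT => no; apply: ne.
  have LY : [/\ L2 y, L2 y1, L2 z & L2 z1].
    apply: (@flux_bounded_L2 N _ _ _ _ _ _ N0 hN L0 L0 sY 0) => X.
    apply: contrapT => no2; apply: no; exists (Num.max N X); first by rewrite le_max lexx.
    move=> x; rewrite ge_max => /andP[_ Xx]; rewrite ltNge; apply/negP => h.
    by apply: no2; exists x.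
  have [dY dZ] := csL2 _ _ _ _ _ _ L0 L0 sY LY.
  have [Ly Ly1 Lz Lz1] := LY.
  exists (fun t => y t +i* z t); split.
    apply/(dirichletP Vq); exists y1, (fun t => (q t - a) * y t + b * z t - 0), z1,
      (fun t => (q t - a) * z t - b * y t - 0); split; first by split.
    split.
    + by apply: (L2_eq _ (L2B (L2Z a Ly) (L2Z b Lz))) => x _; rewrite rl_scale.
    + by apply: (L2_eq _ (L2D (L2Z a Lz) (L2Z b Ly))) => x _; rewrite im_scale.
    + by apply: ae_pos => x _; rewrite rl_scale /rl /im /=; ring.
    + by apply: ae_pos => x _; rewrite im_scale /rl /im /=; ring.
  move=> ae0.
  have /cvgrPdist_lt /(_ _ ltr01) [d /= d0 hd] := cy1 0.
  have d2 : 0 < d / 2 by rewrite divr_gt0.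
  have [x /andP[x0 xd] hx] := ae_pt ae0 d2.
  have : y x = 0 by have /(congr1 (@complex.Re R)) := hx (ltW x0).
  have xx : y 0 < y x.
    apply: (@mono_lt _ y y1) => //.
    + move=> t /andP[t0 _]; exact: (is_primitive_dd cy1).
    + move=> t /andP[t0 tx]; have := hd t; rewrite /= sub0r normrN gtr0_norm // y10 => h.
      have {h} : `|1 - y1 t| < 1 by apply: h; lra.
      by rewrite ltr_norml => /andP[_]; lra.
  by move=> yx; move: xx; rewrite y0 yx ltxx.
have [X0 NX0 hX0] := posQ.
pose D := 2 * (1 + k ^+ 2) / dl.
pose G := \int[mu]_(t in H) (g1 t ^+ 2 + g2 t ^+ 2).
pose den x := y x ^+ 2 + z x ^+ 2.
have denp x : X0 <= x -> 0 < den x.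
  move=> xX; rewrite lt_neqAle addr_ge0 ?sqr_ge0 // andbT eq_sym.
  apply/eqP => h; have := hX0 x xX.
  have a1 := sqr_ge0 (y x); have a2 := sqr_ge0 (z x).
  have /eqP : y x ^+ 2 = 0 by rewrite /den in h; lra.
  have /eqP : z x ^+ 2 = 0 by rewrite /den in h; lra.
  rewrite !sqrf_eq0 => /eqP zx /eqP yx.
  by rewrite /flux yx zx !mul0r subrr addr0 mulr0 subr0 ltxx.
(* c1 + i c2 = - u_p / phi *)
pose c1 x := - (p x * y x + s x * z x) / den x.
pose c2 x := - (s x * y x - p x * z x) / den x.
pose U d1 d2 t := p t + d1 * y t - d2 * z t.
pose U1 d1 d2 t := p1 t + d1 * y1 t - d2 * z1 t.
pose W d1 d2 t := s t + d1 * z t + d2 * y t.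
pose W1 d1 d2 t := s1 t + d1 * z1 t + d2 * y1 t.
have sol_ d1 d2 : forced_sol g1 g2 (U d1 d2) (U1 d1 d2) (W d1 d2) (W1 d1 d2).
  by apply: forced_sol_comb => //; [exact: lg1.1|exact: lg2.1].
have zeroU x : X0 <= x -> U (c1 x) (c2 x) x = 0 /\ W (c1 x) (c2 x) x = 0.
  move=> xX; have d0 : den x != 0 by rewrite gt_eqF // denp.
  have d0' : y x ^+ 2 + z x ^+ 2 != 0 by exact: d0.
  by rewrite /U /W /c1 /c2 /den; split; field.
have E0 d1 d2 x x' : x <= x' -> 0 <= prim (density (U d1 d2) (U1 d1 d2) (W d1 d2) (W1 d1 d2)) x' -
   prim (density (U d1 d2) (U1 d1 d2) (W d1 d2) (W1 d1 d2)) x.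
  move=> xy; rewrite subr_ge0; apply: prim_ndecr => //.
    by apply: contin_locint; exact: (density_contin (sol_ d1 d2)).
  move=> t _; rewrite /density addr_ge0 //; first by rewrite addr_ge0 ?sqr_ge0.
  by rewrite mulr_ge0 //; [rewrite divr_ge0 // ltW|rewrite addr_ge0 ?sqr_ge0].
pose FX d1 d2 x := flux (U d1 d2) (U1 d1 d2) (W d1 d2) (W1 d1 d2) x.
have bound x X : X0 <= x <= X -> FX (c1 X) (c2 X) x <= D * G.
  move=> /andP[Xx xX]; have NxX : N <= x <= X by rewrite (le_trans NX0).
  have [u0 w0] := zeroU X (le_trans Xx xX).
  have e0 := E0 (c1 X) (c2 X) x X xX.
  have FX0 : FX (c1 X) (c2 X) X = 0.
    by rewrite /FX /flux u0 w0 !mul0r subrr addr0 mulr0 subr0.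
  have := flux_growth N0 hN Lg1 Lg2 (sol_ (c1 X) (c2 X)) NxX.
  rewrite -/(FX (c1 X) (c2 X) X) -/(FX (c1 X) (c2 X) x) FX0 -/D -/G; lra.
(* the flux of u_p + c phi is quadratic in c = d1 + i d2 *)
have quad x : exists l1 l2 l3, forall d1 d2,
    FX d1 d2 x = flux y y1 z z1 x * (d1 ^+ 2 + d2 ^+ 2) + d1 * l1 + d2 * l2 + l3.
  exists (y x * p1 x + p x * y1 x + z x * s1 x + s x * z1 x -
     k * (y x * s1 x + p x * z1 x - z x * p1 x - s x * y1 x)),
    (- z x * p1 x - p x * z1 x + y x * s1 x + s x * y1 x -
     k * (- z x * s1 x + p x * y1 x - y x * p1 x + s x * z1 x)),
    (flux p p1 s s1 x).
  by move=> d1 d2; rewrite /FX /flux /U /U1 /W /W1; ring.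
have [M hM] : exists M, forall X, X0 <= X -> `|c1 X| <= M /\ `|c2 X| <= M.
  have [l1 [l2 [l3 e]]] := quad X0.
  set F := flux y y1 z z1 X0 in e; have F0 : 0 < F by exact: hX0.
  set B := 2 * (D * G - l3 + (l1 ^+ 2 + l2 ^+ 2) / (2 * F)) / F.
  exists (`|B| + 1) => X XX.
  have X0X : X0 <= X0 <= X by rewrite lexx.
  have := bound X0 X X0X; rewrite e => h.
  have h2 : (c1 X) ^+ 2 + (c2 X) ^+ 2 <= B.
    rewrite /B ler_pdivlMr //.
    have i1 := sqr_ge0 (F * c1 X + l1); have i2 := sqr_ge0 (F * c2 X + l2).
    have e1 : (F * c1 X + l1) ^+ 2 / (2 * F) + (F * c2 X + l2) ^+ 2 / (2 * F) =
      F / 2 * (c1 X ^+ 2 + c2 X ^+ 2) + c1 X * l1 + c2 X * l2 + (l1 ^+ 2 + l2 ^+ 2) / (2 * F).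
      by field; rewrite gt_eqF.
    have F2 : 0 < 2 * F by rewrite mulr_gt0.
    have i3 : 0 <= (F * c1 X + l1) ^+ 2 / (2 * F) by rewrite divr_ge0 // ltW.
    have i4 : 0 <= (F * c2 X + l2) ^+ 2 / (2 * F) by rewrite divr_ge0 // ltW.
    move: h e1 i3 i4; move: ((F * c1 X + l1) ^+ 2 / (2 * F)) ((F * c2 X + l2) ^+ 2 / (2 * F))
      ((l1 ^+ 2 + l2 ^+ 2) / (2 * F)) => *; lra.
  have sm (d : R) : d ^+ 2 <= B -> `|d| <= `|B| + 1.
    rewrite -(real_normK (num_real d)) => hd.
    have hB := ler_norm B; have hB0 := normr_ge0 B.
    rewrite leNgt; apply/negP => hlt; nra.
  by split; apply: sm; apply: le_trans h2; rewrite ?lerDl ?lerDr sqr_ge0.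
pose X n : R := X0 + n%:R.
have XX0 n : X0 <= X n by rewrite /X lerDl.
have [z1' [z2' cl]] := cluster_pair (fun n => (hM (X n) (XX0 n)).1) (fun n => (hM (X n) (XX0 n)).2).
have FXb x : X0 <= x -> FX z1' z2' x <= D * G.
  move=> Xx; apply: (cl (fun d1 d2 => FX d1 d2 x) (D * G) (Num.bound (x - X0))).
    have [l1 [l2 [l3 e]]] := quad x.
    set F := flux y y1 z z1 x in e.
    move=> d1 d2 eps eps0.
    set S := `|F| * (2 * `|d1| + 2 * `|d2| + 2) + `|l1| + `|l2| + 1.
    have S1 : 1 <= S.
      by rewrite /S lerDr !addr_ge0 // mulr_ge0 // !addr_ge0 // mulr_ge0.
    have S0 : 0 < S by exact: lt_le_trans S1.
    exists (Num.min 1 (eps / S)); first by rewrite lt_min ltr01 divr_gt0.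
    move=> x1 x2; rewrite !lt_min => /andP[a1 a2] /andP[b1 b2].
    rewrite !e.
    set u := d1 - x1 in a1 a2; set v := d2 - x2 in b1 b2.
    have -> : F * (d1 ^+ 2 + d2 ^+ 2) + d1 * l1 + d2 * l2 + l3 -
      (F * (x1 ^+ 2 + x2 ^+ 2) + x1 * l1 + x2 * l2 + l3) =
      u * (F * (2 * d1 - u) + l1) + v * (F * (2 * d2 - v) + l2).
      by rewrite /u /v; ring.
    have tb (d w l : R) : `|w| < 1 -> `|w * (F * (2 * d - w) + l)| <= `|w| * (`|F| * (2 * `|d| + 1) + `|l|).
      move=> w1; rewrite normrM ler_wpM2l // (le_trans (ler_normD _ _)) // lerD2r normrM ler_wpM2l //.
      rewrite (le_trans (ler_normB _ _)) // normrM ger0_norm // lerD2l ltW //.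
    apply: (le_lt_trans (ler_normD _ _)).
    apply: (le_lt_trans (lerD (tb _ _ _ a1) (tb _ _ _ b1))).
    set m := eps / S in a2 b2; have mS : m * S = eps by rewrite /m divfK // gt_eqF.
    have m0 : 0 < m by rewrite divr_gt0.
    have c1' : 0 <= `|F| * (2 * `|d1| + 1) + `|l1|.
      by rewrite addr_ge0 // mulr_ge0 // addr_ge0 // mulr_ge0.
    have c2' : 0 <= `|F| * (2 * `|d2| + 1) + `|l2|.
      by rewrite addr_ge0 // mulr_ge0 // addr_ge0 // mulr_ge0.
    apply: (@le_lt_trans _ _ (m * (`|F| * (2 * `|d1| + 1) + `|l1|) +
       m * (`|F| * (2 * `|d2| + 1) + `|l2|))).
      by apply: lerD; rewrite ler_wpM2r // ltW.
    rewrite -mS -mulrDr ltr_pM2l // /S; lra.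
  move=> n xn; apply: bound; rewrite Xx /=.
  have xX : 0 <= x - X0 by rewrite subr_ge0.
  have := archi_boundP xX => h.
  have : (Num.bound (x - X0))%:R <= n%:R :> R by rewrite ler_nat.
  rewrite /X; lra.
have LU := @flux_bounded_L2 N _ _ _ _ _ _ N0 hN Lg1 Lg2 (sol_ z1' z2') (D * G).
have {}LU : [/\ L2 (U z1' z2'), L2 (U1 z1' z2'), L2 (W z1' z2') & L2 (W1 z1' z2')].
  by apply: LU => x; exists (Num.max x X0); [rewrite le_max lexx|apply: FXb; rewrite le_max lexx orbT].
have [dU dW] := csL2 _ _ _ _ _ _ Lg1 Lg2 (sol_ z1' z2') LU.
have [LU0 _ LW0 _] := LU.
exists (fun t => U z1' z2' t +i* W z1' z2' t); apply/(dirichletP Vq).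
exists (U1 z1' z2'), (fun t => (q t - a) * U z1' z2' t + b * W z1' z2' t - g1 t),
  (W1 z1' z2'), (fun t => (q t - a) * W z1' z2' t - b * U z1' z2' t - g2 t).
have r x : rl (fun x => g x + (a +i* b) * (U z1' z2' x +i* W z1' z2' x)) x =
    g1 x + (a * U z1' z2' x - b * W z1' z2' x).
  by rewrite /rl ReD ReM.
have i x : im (fun x => g x + (a +i* b) * (U z1' z2' x +i* W z1' z2' x)) x =
    g2 x + (a * W z1' z2' x + b * U z1' z2' x).
  by rewrite /im ImD ImM.
split; first split => //.
- by rewrite /rl /= /U p0 y0 z0 !mulr0 addr0 subr0.
- by rewrite /im /= /W s0 y0 z0 !mulr0 !addr0.
split.
- by apply: (L2_eq _ (L2D Lg1 (L2B (L2Z a LU0) (L2Z b LW0)))) => x _; rewrite r.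
- by apply: (L2_eq _ (L2D Lg2 (L2D (L2Z a LW0) (L2Z b LU0)))) => x _; rewrite i.
- by apply: ae_pos => x _; rewrite r /rl /=; ring.
- by apply: ae_pos => x _; rewrite i /im /=; ring.
Qed.

End Fixed.
End Resolvent.

(** * Eigenvalues and regular solutions *)

Section Spectrum.
Variable R : realType.
Local Notation mu := (@lebesgue_measure R).
Local Notation H := (half_line R).
Implicit Types (f g h p r s y : R -> R) (x t M N a b c k : R) (u v w : R -> R[i]).
#[local] Hint Resolve measurable_segment measurable_half locint_cst : core.

Variables (V q : R -> R) (K C : R).
Hypothesis cq : contin q.
Hypothesis qK : forall x, `|q x| <= K.
Hypothesis qC : forall x, 0 <= x -> (1 + x ^+ 2) * `|q x| <= C * expR (- x).
Hypothesis Vq : forall x, 0 < x -> V x = q x.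
Local Notation T := (dirichlet_schrodinger V).

Lemma complex_ge0 a b : (0 <= (a +i* b : R[i])) = (b == 0) && (0 <= a).
Proof. by rewrite lecE. Qed.

Lemma complex_lt0 a b c : ((a +i* b : R[i]) < (c +i* 0)) = (b == 0) && (a < c).
Proof. by rewrite ltcE /= eq_sym. Qed.

(** Off the half line the operator minus lambda is onto as soon as it is
    injective; on the half line it is injective with a proper dense range. *)
Theorem dirichlet_continuous_spectrum : continuous_spectrum T = [set lambda : R[i] | 0 <= lambda].
Proof.
apply/seteqP; split => [[a b]|[a b]] /=.
- move=> [ne _ ns]; rewrite complex_ge0; apply: contrapT => /negP.
  rewrite negb_and -ltNge => /orP h; apply: ns => g Lg.
  have [k hk] := @coercivity_direction _ a b h.
  exact: (resolvent_surjective cq qK qC Vq hk).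
- rewrite complex_ge0 => /andP[/eqP -> a0]; split.
  + exact: (nonneg_not_eigenvalue cq qK qC Vq).
  + by move=> g Lg e e0; exact: (nonneg_dense cq qK qC Vq).
  + exact: (nonneg_not_surjective cq qK qC Vq).
Qed.

(** By symmetry, b times the integral of |u|^2 is 0. *)
Lemma eigenvalue_real a b : eigenvalue_of T (a +i* b) -> b = 0.
Proof.
move=> [u [Tu nz]]; apply/eqP; apply: contrapT => /negP b0; apply: nz.
have [p [p1 [s [s1 [[cp cp1 cs cs1] [[Lp Lp1 Ls Ls1] [[p0 s0 hp hs] [[dp ds dp1 ds1] e]]]]]]]]
  := eigenfunction_parts cq Vq Tu.
have cA : contin (fun x => (q x - a) * p x + b * s x) by move=> t; cnt.
have cB : contin (fun x => (q x - a) * s x - b * p x) by move=> t; cnt.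
have LA : L2 (fun x => (q x - a) * p x + b * s x).
  by apply: L2D; [exact: (L2_qa cq qK)|exact: L2Z].
have LB : L2 (fun x => (q x - a) * s x - b * p x).
  by apply: L2B; [exact: (L2_qa cq qK)|exact: L2Z].
have hp1 : is_primitive p1 (fun x => (q x - a) * p x + b * s x).
  move=> x x0; apply: (@prim_of_derive R p1 (fun x => (q x - a) * p x + b * s x)) => //.
  exact: contin_locint.
have hs1 : is_primitive s1 (fun x => (q x - a) * s x - b * p x).
  move=> x x0; apply: (@prim_of_derive R s1 (fun x => (q x - a) * s x - b * p x)) => //.
  exact: contin_locint.
have dmp : real_H2 p p1 (fun x => (q x - a) * p x + b * s x) by split.
have dms : real_H2 s s1 (fun x => (q x - a) * s x - b * p x) by split.
have S := symmetric dmp dms p0 s0.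
have ips : integrable_on H (fun t => p t ^+ 2 + s t ^+ 2).
  by apply: intgD => //; [case: Lp|case: Ls].
have z : \int[mu]_(t in H) (p t ^+ 2 + s t ^+ 2) = 0.
  apply: (mulfI b0); rewrite mulr0 -RintegralZl //.
  transitivity (\int[mu]_(t in H) (((q t - a) * p t + b * s t) * s t) -
     \int[mu]_(t in H) (p t * ((q t - a) * s t - b * p t))).
    rewrite -RintegralB //; [|exact: L2_mul_int..].
    by apply: eq_Rintegral => t _; ring.
  by rewrite S subrr.
have lps := locint_half ips.
have e0 t : 0 <= t -> 0 <= p t ^+ 2 + s t ^+ 2 by move=> _; rewrite addr_ge0 ?sqr_ge0.
apply: ae_pos => x x0.
suff : p x ^+ 2 + s x ^+ 2 = 0.
  have := sqr_ge0 (p x); have := sqr_ge0 (s x) => h1 h2 h3.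
  have /eqP : p x ^+ 2 = 0 by lra.
  have /eqP : s x ^+ 2 = 0 by lra.
  by rewrite !sqrf_eq0 => /eqP sx /eqP px; rewrite e ?ltW // px sx.
have ex := e0 x (ltW x0).
apply/eqP; rewrite eq_le ex andbT leNgt; apply/negP => pos.
have cE : contin (fun t => p t ^+ 2 + s t ^+ 2) by move=> t; cnt.
have x1 : x < x + 1 by lra.
have z1 : prim (fun t => p t ^+ 2 + s t ^+ 2) (x + 1) = 0.
  apply/eqP; rewrite eq_le; apply/andP; split.
    by rewrite -z; apply: prim_le_half.
  by apply: prim_ge0 => t /andP[t0 _]; exact: e0.
have hz := prim_eq0_ae lps (fun t th => e0 t (proj1 (andP th))) z1.
have /cvgrPdist_lt /(_ _ pos) [d /= d0 hd] := cE x.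
have md : x < x + Num.min d 1 by rewrite ltrDl lt_min d0 ltr01.
have [y /andP[xy yd] hy] := ae_pt hz md.
move: yd; rewrite -ltrBlDl lt_min => /andP[yd y1].
have := hd y; rewrite /= distrC gtr0_norm ?subr_gt0 // => /(_ yd).
rewrite hy; last by apply/andP; split; lra.
by rewrite subr0 gtr0_norm // ltxx.
Qed.

(** The difference has zero Cauchy data at 0. *)
Lemma sol_unique a p p1 y y1 x : sol (fun t => q t - a) p p1 -> p 0 = 0 ->
  sol (fun t => q t - a) y y1 -> y 0 = 0 -> y1 0 = 1 -> 0 <= x ->
  p x = p1 0 * y x.
Proof.
move=> [cp cp1 dp dp1] p0 [cy cy1 dy dy1] y0 y10 x0.
pose D t := p t + - p1 0 * y t; pose D1 t := p1 t + - p1 0 * y1 t.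
have cD : contin D by move=> t; rewrite /D; cnt.
have cD1 : contin D1 by move=> t; rewrite /D1; cnt.
have c0 : contin (fun=> 0 : R) by move=> t; cnt.
have d0 t : dd (fun=> 0 : R) t 0 by exact: dcst.
have [|||M hM] := @energy_bound _ q K qK a 0 D D1 (fun=> 0) (fun=> 0) cD cD1 c0 c0 _ (fun t _ => d0 t).
- move=> t t0; have h1 := dp t t0; have h2 := dy t t0.
  by rewrite /D; apply: deq; [der|rewrite /D1; ring].
- move=> t t0; have h1 := dp1 t t0; have h2 := dy1 t t0.
  by rewrite /D1; apply: deq; [der|rewrite /D; ring].
- by move=> t _; rewrite mul0r mulr0 subr0.
have x00 : 0 <= (0 : R) <= x by apply/andP.
have [+ _] := hM 0 x x00.
rewrite /D /D1 p0 y0 y10 mulr0 mulr1 addr0 subrr expr0n /= !addr0 mul0r => h.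
have h1 := sqr_ge0 (p x + - p1 0 * y x); have h2 := sqr_ge0 (p1 x + - p1 0 * y1 x).
have /eqP : (p x + - p1 0 * y x) ^+ 2 = 0 by lra.
by rewrite sqrf_eq0 mulNr subr_eq0 => /eqP.
Qed.

Lemma eigenfunction_multiple a u y y1 : eigenfunction T (a +i* 0) u ->
  sol (fun t => q t - a) y y1 -> y 0 = 0 -> y1 0 = 1 ->
  L2 y /\ exists c : R[i], c != 0 /\ forall x, 0 <= x -> u x = c * (y x)%:C.
Proof.
move=> [Tu nz] sy y0 y10.
have [p [p1 [s [s1 [[cp cp1 cs cs1] [[Lp Lp1 Ls Ls1] [[p0 s0 hp hs] [[dp ds dp1 ds1] e]]]]]]]]
  := eigenfunction_parts cq Vq Tu.
have sp : sol (fun t => q t - a) p p1.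
  by split => // t t0; have := dp1 t t0; rewrite mul0r addr0.
have ss : sol (fun t => q t - a) s s1.
  by split => // t t0; have := ds1 t t0; rewrite mul0r subr0.
have ep x : 0 <= x -> p x = p1 0 * y x by move=> x0; apply: sol_unique sp p0 sy y0 y10 x0.
have es x : 0 <= x -> s x = s1 0 * y x by move=> x0; apply: sol_unique ss s0 sy y0 y10 x0.
have eu x : 0 <= x -> u x = (p1 0 +i* s1 0) * (y x)%:C.
  move=> x0; rewrite e // ep // es //; apply: complexP; rewrite ?ReM ?ImM /=; ring.
have c0 : (p1 0 +i* s1 0) != 0.
  apply/eqP => h; apply: nz; apply: ae_pos => x x0.
  by rewrite eu ?ltW // h mul0r.
split; last by exists (p1 0 +i* s1 0).
have [h|h] := eqVneq (p1 0) 0; last first.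
  apply: (L2_eq _ (L2Z (p1 0)^-1 Lp)) => x x0.
  by rewrite ep // mulrA mulVf // mul1r.
have h2 : s1 0 != 0.
  by apply/eqP => h2; move: c0; rewrite h h2 eqxx.
apply: (L2_eq _ (L2Z (s1 0)^-1 Ls)) => x x0.
by rewrite es // mulrA mulVf // mul1r.
Qed.

Lemma not_ae0 y y1 (c : R[i]) a : sol (fun t => q t - a) y y1 -> y 0 = 0 -> y1 0 = 1 ->
  c != 0 -> ~ ae_half_line (fun x => c * (y x)%:C = 0).
Proof.
move=> sy y0 y10 c0 h.
have [d d0 hd] := sol_pos_near0 sy y0 y10.
have [x /andP[x0 xd] hx] := ae_pt h d0.
have /eqP := hx (ltW x0); rewrite mulf_eq0 (negbTE c0) /= => /eqP/(congr1 (@complex.Re R)) /= yx.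
have xd' : 0 < x <= d by rewrite x0 ltW.
by have := hd x xd'; rewrite yx ltxx.
Qed.

Lemma eigenvalueP a y y1 : sol (fun t => q t - a) y y1 -> y 0 = 0 -> y1 0 = 1 ->
  eigenvalue_of T (a +i* 0) <-> L2 y.
Proof.
move=> sy y0 y10; split.
  by move=> [u eu]; have [] := eigenfunction_multiple eu sy y0 y10.
move=> Ly; exists (fun t => y t +i* 0); split; first exact: (sol_eig cq qK Vq sy).
move=> h; apply: (@not_ae0 y y1 1 a sy y0 y10 (oner_neq0 _)).
by apply: ae_imp h => x hx x0; rewrite mul1r; exact: hx.
Qed.

Lemma multiple_eigenfunction a y y1 (c : R[i]) u : sol (fun t => q t - a) y y1 ->
  y 0 = 0 -> y1 0 = 1 -> L2 y -> c != 0 ->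
  (forall x, 0 <= x -> u x = c * (y x)%:C) -> eigenfunction T (a +i* 0) u.
Proof.
move=> sy y0 y10 Ly c0 hu; split; last first.
  move=> h; apply: (not_ae0 sy y0 y10 c0).
  by apply: ae_imp h => x hx x0; rewrite -hu //; exact: hx.
have [d1 d2 d3 d4 d5] := sol_dom cq qK sy Ly.
have scal (k : R) r : (forall x, 0 <= x -> r x = k * y x) ->
    real_H2 r (fun t => k * y1 t) (fun t => k * ((q t - a) * y t)).
  move=> hr; split.
  - by apply: (L2_eq _ (L2Z k d1)) => x x0; rewrite hr.
  - exact: L2Z.
  - exact: L2Z.
  - move=> x x0; rewrite !hr // primZ; last exact: (L2_locL2 d2).1.
    by rewrite [y x]d4 //; ring.
  - move=> x x0; rewrite primZ; last exact: (L2_locL2 d3).1.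
    by rewrite [y1 x]d5 //; ring.
have er x : 0 <= x -> rl u x = complex.Re c * y x.
  by move=> x0; rewrite /rl hu // ReM /= mulr0 subr0.
have ei x : 0 <= x -> im u x = complex.Im c * y x.
  by move=> x0; rewrite /im hu // ImM /= mulr0 add0r.
have D1 := scal _ _ er; have D2 := scal _ _ ei.
have [Lr _ _ _ _] := D1; have [Li _ _ _ _] := D2.
apply/(dirichletP Vq).
exists (fun t => complex.Re c * y1 t), (fun t => complex.Re c * ((q t - a) * y t)),
  (fun t => complex.Im c * y1 t), (fun t => complex.Im c * ((q t - a) * y t)).
split; first by split => //; rewrite ?er ?ei // y0 mulr0.
split.
- by apply: (L2_eq _ (L2B (L2Z a Lr) (L2Z 0 Li))) => x _; rewrite rl_scale.
- by apply: (L2_eq _ (L2D (L2Z a Li) (L2Z 0 Lr))) => x _; rewrite im_scale.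
- by apply: ae_pos => x x0; rewrite rl_scale er ?ltW //; ring.
- by apply: ae_pos => x x0; rewrite im_scale ei ?ltW //; ring.
Qed.

End Spectrum.

(** * Comparison and changes of sign *)

Section Comparison.
Variable R : realType.
Implicit Types (f D m : R -> R) (x t a b z M : R).

Lemma ct_pos f x : ct f x -> 0 < f x ->
  exists2 d, 0 < d & forall t, `|t - x| < d -> 0 < f t.
Proof.
move=> /cvgrPdist_lt cf fx; have [d /= d0 hd] := cf _ fx.
exists d => // t td; have := hd t; rewrite /= distrC => /(_ td).
by rewrite ltr_norml => /andP[_]; lra.
Qed.

Lemma last_sign f a b : a <= b -> (forall t, a <= t <= b -> ct f t) ->
  0 <= f a -> f b < 0 ->
  exists2 z, a <= z < b & f z = 0 /\ forall t, z < t <= b -> f t < 0.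
Proof.
move=> ab cf fa fb.
pose S := [set t | a <= t <= b /\ 0 <= f t].
have Sa : S a by split; rewrite // lexx ab.
have Sb : ubound S b by move=> t [/andP[]].
have hS : has_sup S by split; [exists a|exists b].
pose z := sup S.
have az : a <= z by apply: sup_upper_bound.
have zb : z <= b by apply: ge_sup => //; exists a.
have zab : a <= z <= b by apply/andP.
have fz : 0 <= f z.
  rewrite leNgt; apply/negP => fz.
  have [||d d0 hd] := @ct_pos (fun t => - f t) z.
  - by apply: copp; exact: cf.
  - by rewrite oppr_gt0.
  have [t [tab ft] zt] := sup_adherent d0 hS.
  have tz : t <= z by apply: sup_upper_bound.
  have : 0 < - f t by apply: hd; rewrite distrC ger0_norm ?subr_ge0 //; move: zt; rewrite -/z; lra.
  by rewrite oppr_gt0 ltNge ft.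
have {}zb : z < b by rewrite lt_neqAle zb andbT; apply/eqP => e; move: fb; rewrite -e ltNge fz.
have neg t : z < t <= b -> f t < 0.
  move=> /andP[zt tb]; rewrite ltNge; apply/negP => ft.
  suff : t <= z by rewrite leNgt zt.
  by apply: sup_upper_bound => //; split; rewrite // tb (le_trans az (ltW zt)).
exists z; first by rewrite az zb.
split=> //; apply/eqP; rewrite eq_le fz andbT leNgt; apply/negP => fz0.
have [d d0 hd] := ct_pos (cf z zab) fz0.
pose t := Num.min b (z + d / 2).
have zt : z < t by rewrite lt_min zb; lra.
have tb : t <= b by rewrite ge_min lexx.
have td : t <= z + d / 2 by rewrite ge_min lexx orbT.
have := neg t; rewrite zt tb => /(_ isT).
have : 0 < f t by apply: hd; rewrite gtr0_norm ?subr_gt0 //; lra.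
by move=> /lt_trans h1 /h1; rewrite ltxx.
Qed.

Lemma first_sign f a b : a <= b -> (forall t, a <= t <= b -> ct f t) ->
  f a < 0 -> 0 <= f b ->
  exists2 z, a < z <= b & f z = 0 /\ forall t, a <= t < z -> f t < 0.
Proof.
move=> ab cf fa fb.
have [||||z /andP[z1 z2] [fz hz]] := @last_sign (fun t => f (- t)) (- b) (- a).
- by rewrite lerN2.
- move=> t /andP[t1 t2]; apply: (@ccomp _ (fun t => - t) f); first by cnt.
  by apply: cf; apply/andP; split; lra.
- by rewrite opprK.
- by rewrite opprK.
exists (- z); first by apply/andP; split; lra.
split => // t /andP[t1 t2]; rewrite -(opprK t); apply: hz; apply/andP; split; lra.
Qed.

(** Past the last zero of D before a negative value, e^{-Mt} D would be
    nondecreasing. *)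
Lemma comparison D D' M a b : a <= b -> (forall t, a <= t <= b -> ct D t) ->
  (forall t, a < t < b -> dd D t (D' t)) -> 0 <= D a ->
  (forall t, a < t < b -> D t < 0 -> M * D t <= D' t) -> 0 <= D b.
Proof.
move=> ab cD dD Da h; rewrite leNgt; apply/negP => Db.
have [z /andP[az zb] [Dz hz]] := last_sign ab cD Da Db.
have := @gronwall R D D' (fun t => - M * t) (fun=> - M) z b (ltW zb).
have inab t : z <= t <= b -> a <= t <= b by move=> /andP[? ?]; apply/andP; split; lra.
have inab' t : z < t < b -> a < t < b by move=> /andP[? ?]; apply/andP; split; lra.
move=> k; have : D z * expR (- M * z) <= D b * expR (- M * b).
  apply: k.
  - by move=> t /inab; exact: cD.
  - by move=> t _; cnt.
  - by move=> t /inab'; exact: dD.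
  - by move=> t _; apply: deq; [der|ring].
  - move=> t zt; have Dt : D t < 0.
      by apply: hz; case/andP: zt => zt tb; rewrite zt ltW.
    by have := h t (inab' t zt) Dt; lra.
by rewrite Dz mul0r pmulr_lge0 ?expR_gt0 // leNgt Db.
Qed.

End Comparison.

(** * The sine modulo pi *)

Section Angle.
Variable R : realType.
Implicit Types (t a b : R) (k : nat).

Lemma sin_lip a b : `|sin a - sin b| <= `|a - b|.
Proof.
wlog ab : a b / b < a.
  move=> h; have [->|ne] := eqVneq a b; first by rewrite !subrr.
  have [ab|ba] := ltP b a; first exact: h.
  by rewrite distrC [X in _ <= X]distrC; apply: h; rewrite lt_neqAle ne.
have [||c _ ->] := @mvt R (@sin R) (@cos R) b a ab.
- by move=> x _; rewrite /dd; exact: is_derive_sin.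
- by move=> x _; exact: continuous_sin.
by rewrite normrM ler_piMl // cos_max.
Qed.

Lemma sin_le_norm a : `|sin a| <= `|a|.
Proof. by have := sin_lip a 0; rewrite sin0 !subr0. Qed.

Lemma sin2_le_norm a : sin a ^+ 2 <= `|a|.
Proof.
rewrite -real_normK ?num_real // expr2 -[X in _ <= X]mul1r.
by apply: ler_pM => //; [exact: sin_max|exact: sin_le_norm].
Qed.

Lemma sinDpin t k : sin (t + k%:R * pi) = (-1) ^+ k * sin t :> R.
Proof.
elim: k => [|k IH]; first by rewrite mul0r addr0 expr0 mul1r.
have -> : t + k.+1%:R * pi = (t + k%:R * pi) + pi by rewrite -natr1; ring.
by rewrite sinDpi IH exprS mulN1r mulNr.
Qed.

Lemma cosDpin t k : cos (t + k%:R * pi) = (-1) ^+ k * cos t :> R.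
Proof.
elim: k => [|k IH]; first by rewrite mul0r addr0 expr0 mul1r.
have -> : t + k.+1%:R * pi = (t + k%:R * pi) + pi by rewrite -natr1; ring.
by rewrite cosDpi IH exprS mulN1r mulNr.
Qed.

(** The multiples of pi are the only zeros of the sine. *)
Lemma sin0_next t k : k%:R * pi < t -> sin t = 0 -> k.+1%:R * pi <= t :> R.
Proof.
move=> kt st; rewrite leNgt; apply/negP => tk.
have := sinDpin (t - k%:R * pi) k; rewrite subrK st => /esym/eqP.
rewrite mulf_eq0 expf_eq0 oppr_eq0 oner_eq0 andbF /= => /eqP s0.
have := @sin_gt0_pi R (t - k%:R * pi); rewrite s0 ltxx => h.
suff : false by []. apply: h; apply/andP; split; first lra.
by move: tk; rewrite -natr1 mulrDl mul1r; lra.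
Qed.

End Angle.

(** * The angle of the regular solution *)

Section Pruefer.
Variable R : realType.
Implicit Types (f y th rho : R -> R) (x t a b M lam : R) (k j : nat).
Variables (q : R -> R) (K : R).
Hypothesis cq : contin q.
Hypothesis qK : forall x, `|q x| <= K.

Let K0 : 0 <= K. Proof. exact: le_trans (qK 0). Qed.

(** Equal to cos^2 t + (lam - q x) sin^2 t; this form makes the Lipschitz
    constant in t visible. *)
Definition wind lam x t := 1 + (lam - q x - 1) * sin t ^+ 2.

(** Polar coordinates: y = rho sin th and y' = rho cos th, so the zeros of the
    regular solution are the points where th is a multiple of pi. *)
Definition pruefer lam th rho :=
  [/\ contin th, th 0 = 0, rho 0 = 1, forall x, 0 < rho x &
      forall x, 0 < x -> dd th x (wind lam x (th x))] /\
  sol (fun t => q t - lam) (fun t => rho t * sin (th t)) (fun t => rho t * cos (th t)).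

Definition rate lam := `|lam| + K + 1.

Lemma rate_ge1 lam : 1 <= rate lam.
Proof. by rewrite /rate lerDr addr_ge0. Qed.

Lemma wind_coef lam x : `|lam - q x - 1| <= rate lam.
Proof.
rewrite /rate; apply: (le_trans (ler_normB _ _)); rewrite normr1 lerD2r.
by apply: (le_trans (ler_normB _ _)); rewrite lerD2l.
Qed.

Lemma wind_lip lam x a b : `|wind lam x a - wind lam x b| <= 2 * rate lam * `|a - b|.
Proof.
have -> : wind lam x a - wind lam x b =
    (lam - q x - 1) * ((sin a + sin b) * (sin a - sin b)) by rewrite /wind; ring.
have h : `|(sin a + sin b) * (sin a - sin b)| <= 2 * `|a - b|.
  rewrite normrM; apply: ler_pM => //; last exact: sin_lip.
  apply: (le_trans (ler_normD _ _)).
  by rewrite -[2]/(1 + 1); apply: lerD; exact: sin_max.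
rewrite normrM; apply: le_trans (ler_pM _ _ (wind_coef lam x) h) _ => //.
by rewrite mulrCA mulrA.
Qed.

Lemma pruefer_exists lam : exists th rho, pruefer lam th rho.
Proof.
pose F (i : 'I_1) (s : R) (a : 'I_1 -> R) := wind lam s (a ord0).
have K1 : 0 <= 2 * rate lam by rewrite mulr_ge0 // (le_trans _ (rate_ge1 lam)).
have Fc : forall y : 'I_1 -> R -> R, (forall i : 'I_1, contin (y i)) ->
    forall i : 'I_1, contin (fun s => F i s (y^~ s)).
  by move=> y cy i s; rewrite /F /wind; cnt; exact: cy.
have FL : forall (i : 'I_1) (s : R) (a b : 'I_1 -> R), 0 <= s ->
    `|F i s a - F i s b| <= 2 * rate lam * \sum_(z < 1) `|a z - b z|.
  by move=> ? s a b _; rewrite big_ord1; exact: wind_lip.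
have [y [cy yE]] := picard (fun=> 0) K1 Fc FL.
pose th := y ord0; have cth : contin th by exact: cy.
pose p s := (1 + q s - lam) * (sin (th s) * cos (th s)).
have cp : contin p by move=> s; rewrite /p; cnt.
have cP := prim_contin (contin_locint cp).
have cw : contin (fun s => wind lam s (th s)) by move=> s; rewrite /wind; cnt.
have dth x : 0 < x -> dd th x (wind lam x (th x)).
  apply: (@is_primitive_dd _ th (fun s => wind lam s (th s))) => // s s0.
  by rewrite /th !yE prim0 addr0.
exists th, (fun x => expR (prim p x)); split; first split => //.
- by rewrite /th yE prim0 addr0.
- by rewrite prim0 expR0.
- by move=> x; exact: expR_gt0.
have dP x : 0 < x -> dd (prim p) x (p x).
  by move=> x0; apply: prim_ftc => //; exact: contin_locint.
have cc x : 0 < x -> (cos (th x)) ^+ 2 = 1 - sin (th x) ^+ 2 by rewrite cos2sin2.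
split.
- by move=> t; cnt.
- by move=> t; cnt.
- move=> x x0; have d1 := dP x x0; have d2 := dth x x0.
  apply: deq; first by der.
  have := cos2sin2 (th x); rewrite /p /wind; move: (sin _) (cos _) (expR _) => s c E h.
  transitivity (E * c * ((1 + q x - lam) * s ^+ 2 + (1 + (lam - q x - 1) * s ^+ 2))); first by ring.
  by ring.
- move=> x x0; have d1 := dP x x0; have d2 := dth x x0.
  apply: deq; first by der.
  have := cos2sin2 (th x); rewrite /p /wind; move: (sin _) (cos _) (expR _) => s c E h.
  transitivity (E * s * ((1 + q x - lam) * c ^+ 2 - (1 + (lam - q x - 1) * s ^+ 2))); first by ring.
  by rewrite h; ring.
Qed.

Section Family.
Variables th rho : R -> R -> R.
Hypothesis hp : forall lam, pruefer lam (th lam) (rho lam).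

Let cth lam : contin (th lam). Proof. by have [[]] := hp lam. Qed.
Let th0 lam : th lam 0 = 0. Proof. by have [[]] := hp lam. Qed.
Let rho_gt0 lam x : 0 < rho lam x. Proof. by have [[_ _ _ h _] _] := hp lam; exact: h. Qed.
Let dth lam x : 0 < x -> dd (th lam) x (wind lam x (th lam x)).
Proof. by have [[_ _ _ _ h] _] := hp lam; exact: h. Qed.

(** Equivalent to the regular solution having at least k positive zeros; in this
    form the condition is open and monotone in lam. *)
Definition reaches k lam := exists2 x, 0 <= x & k%:R * pi < th lam x.

Lemma sin2_shift t k : sin t ^+ 2 = sin (t - k%:R * pi) ^+ 2.
Proof. by rewrite -{1}(subrK (k%:R * pi) t) sinDpin exprMn -exprM mulnC exprM sqrrN expr1n expr1n mul1r. Qed.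

(** Near a multiple of pi the angle turns at a speed close to 1. *)
Lemma wind_ge lam x t k : 1 - rate lam * `|t - k%:R * pi| <= wind lam x t.
Proof.
rewrite /wind (sin2_shift t k).
have := sin2_le_norm (t - k%:R * pi); have := wind_coef lam x; have := rate_ge1 lam.
have := sqr_ge0 (sin (t - k%:R * pi)).
move: (sin _ ^+ 2) `|t - _| (rate lam) (lam - _ - 1) => s d r c s0 r1.
rewrite ler_norml => /andP[c1 c2] sd.
have h1 : 0 <= (c + r) * s by rewrite mulr_ge0 //; lra.
have h2 : 0 <= r * (d - s) by rewrite mulr_ge0 ?subr_ge0 //; lra.
lra.
Qed.

(** At a multiple of pi the angle increases with speed 1. *)
Lemma multiple_no_return lam k x t : 0 <= x -> k%:R * pi <= th lam x -> x < t ->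
  k%:R * pi < th lam t.
Proof.
move=> x0 kx xt.
pose D s := th lam s - k%:R * pi.
have cD s : ct D s by rewrite /D; cnt; exact: cth.
have dD s : 0 < s -> dd D s (wind lam s (th lam s)).
  by move=> s0; have d1 := dth lam s0; rewrite /D; apply: deq; [der|ring].
have D0 s : x <= s -> 0 <= D s.
  move=> xs; apply: (@comparison _ D (fun s => wind lam s (th lam s)) (rate lam) x) => //.
  - by move=> u /andP[xu _]; apply: dD; exact: le_lt_trans xu.
  - by rewrite subr_ge0.
  - move=> u _ Du; have := wind_ge lam u (th lam u) k; rewrite -/(D u) ltr0_norm //; lra.
rewrite -subr_gt0 -/(D t).
have := @mono_lt _ (fun s => D s * expR (rate lam * s))
  (fun s => (wind lam s (th lam s) + rate lam * D s) * expR (rate lam * s)) x t xt.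
move=> h; have {}h : D x * expR (rate lam * x) < D t * expR (rate lam * t).
  apply: h.
  - move=> s /andP[xs _]; have d1 := dD s (le_lt_trans x0 xs).
    by apply: deq; [der|ring].
  - by move=> s _; cnt; exact: cD.
  - move=> s /andP[xs _]; rewrite mulr_gt0 ?expR_gt0 //.
    have := wind_ge lam s (th lam s) k; rewrite -/(D s) (ger0_norm (D0 s (ltW xs))); lra.
rewrite -(pmulr_lgt0 _ (expR_gt0 (rate lam * t))); apply: le_lt_trans h.
by rewrite mulr_ge0 ?expR_ge0 // D0.
Qed.

Lemma angle_gt0 lam x : 0 < x -> 0 < th lam x.
Proof.
move=> x0; have := @multiple_no_return lam 0 0 x; rewrite th0 mul0r; exact.
Qed.

Lemma angle_mono lam mu x : lam <= mu -> 0 <= x -> th lam x <= th mu x.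
Proof.
move=> lm x0; rewrite -subr_ge0.
apply: (@comparison _ (fun s => th mu s - th lam s)
  (fun s => wind mu s (th mu s) - wind lam s (th lam s)) (2 * rate lam) 0) => //.
- by move=> s _; cnt; exact: cth.
- move=> s /andP[s0 _]; have d1 := dth lam s0; have d2 := dth mu s0; exact: dadd d2 (dopp d1).
- by rewrite !th0 subrr.
move=> s _ neg.
have := wind_lip lam s (th mu s) (th lam s); rewrite (ltr0_norm neg) ler_norml => /andP[h _].
have : wind lam s (th mu s) <= wind mu s (th mu s).
  by rewrite /wind lerD2l ler_wpM2r ?sqr_ge0 //; lra.
by lra.
Qed.

(** Continuity in the spectral value, locally uniformly. *)
Lemma angle_growth lam mu x : lam <= mu -> 0 <= x ->
  th mu x - th lam x <= (mu - lam) * expR (2 * rate lam * x).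
Proof.
move=> lm x0; set M := 2 * rate lam.
have M1 : 2 <= M by have := rate_ge1 lam; rewrite /M; lra.
suff : 0 <= (mu - lam) * expR (M * x) - (mu - lam) - (th mu x - th lam x) by lra.
apply: (@comparison _ (fun x => (mu - lam) * expR (M * x) - (mu - lam) - (th mu x - th lam x))
  (fun x => (mu - lam) * (M * expR (M * x)) - (wind mu x (th mu x) - wind lam x (th lam x))) M 0).
- exact: x0.
- by move=> s _; cnt; exact: cth.
- move=> s /andP[s0 _]; have d1 := dth lam s0; have d2 := dth mu s0.
  by apply: deq; [der|ring].
- by rewrite !th0 mulr0 expR0; lra.
move=> s /andP[s0 _] _.
have := wind_lip lam s (th mu s) (th lam s); rewrite ler_norml => /andP[_].
have D0 : 0 <= th mu s - th lam s by rewrite subr_ge0 angle_mono // ltW.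
rewrite (ger0_norm D0) -/M => h.
have : wind mu s (th mu s) - wind lam s (th mu s) <= mu - lam.
  have -> : wind mu s (th mu s) - wind lam s (th mu s) = (mu - lam) * sin (th mu s) ^+ 2.
    by rewrite /wind; ring.
  by rewrite ler_piMr ?subr_ge0 // sin2cos2 lerBlDr lerDl sqr_ge0.
have : mu - lam <= M * (mu - lam) by rewrite ler_peMl ?subr_ge0 //; lra.
move: h; move: (wind mu s _) (wind lam s (th mu s)) (wind lam s _) (expR _) => w1 w2 w3 E; lra.
Qed.

(** Where q >= lam, the angle does not increase at pi/2 modulo pi; it is
    confined to the quadrants in which y y' >= 0. *)
Lemma quadrant_trap lam k N x t : 0 <= N -> (forall s, N <= s -> lam <= q s) ->
  N <= x <= t -> th lam x <= k%:R * pi + pi / 2 -> th lam t <= k%:R * pi + pi / 2.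
Proof.
move=> N0 hN /andP[Nx xt] hx; rewrite -subr_ge0.
apply: (@comparison _ (fun s => k%:R * pi + pi / 2 - th lam s) (fun s => - wind lam s (th lam s)) 1 x).
- exact: xt.
- by move=> s _; cnt; exact: cth.
- move=> s /andP[xs _]; have d1 := dth lam (le_lt_trans (le_trans N0 Nx) xs).
  by apply: deq; [der|ring].
- by rewrite subr_ge0.
move=> s /andP[xs _] Ds; have qs := hN s (le_trans Nx (ltW xs)).
have h1 : wind lam s (th lam s) <= cos (th lam s) ^+ 2.
  by rewrite /wind cos2sin2; have := sqr_ge0 (sin (th lam s)); nra.
have h2 : cos (th lam s) ^+ 2 = sin (k%:R * pi + pi / 2 - th lam s) ^+ 2.
  have -> : k%:R * pi + pi / 2 - th lam s = - (th lam s - pi / 2 - k%:R * pi) by ring.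
  rewrite sinN sqrrN -sin2_shift -[in LHS](subrK (pi / 2) (th lam s)) cosDpihalf sqrrN.
  by [].
have := sin2_le_norm (k%:R * pi + pi / 2 - th lam s); rewrite (ltr0_norm Ds) -h2; lra.
Qed.

End Family.
End Pruefer.

(** * Oscillation and the number of eigenvalues *)

Section Sturm.
Variable R : realType.
Local Notation mu := (@lebesgue_measure R).
Local Notation H := (half_line R).
Implicit Types (x t a b lam nu : R) (k j n : nat).
#[local] Hint Resolve measurable_segment measurable_half locint_cst : core.
Variables (q : R -> R) (K C : R).
Hypothesis cq : contin q.
Hypothesis qK : forall x, `|q x| <= K.
Hypothesis qC : forall x, 0 <= x -> (1 + x ^+ 2) * `|q x| <= C * expR (- x).
Variables th rho : R -> R -> R.
Hypothesis hp : forall lam, pruefer q lam (th lam) (rho lam).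

Definition regular lam x := rho lam x * sin (th lam x).
Definition regular' lam x := rho lam x * cos (th lam x).

Let K0 : 0 <= K. Proof. exact: le_trans (qK 0). Qed.
Let cth lam : contin (th lam). Proof. by have [[]] := hp lam. Qed.
Let th0 lam : th lam 0 = 0. Proof. by have [[]] := hp lam. Qed.
Let rho_gt0 lam x : 0 < rho lam x. Proof. by have [[_ _ _ h _] _] := hp lam; exact: h. Qed.

Lemma regular_sol lam : sol (fun t => q t - lam) (regular lam) (regular' lam).
Proof. by have [_] := hp lam. Qed.

Lemma regular0 lam : regular lam 0 = 0.
Proof. by rewrite /regular th0 sin0 mulr0. Qed.

Lemma regular'0 lam : regular' lam 0 = 1.
Proof. by rewrite /regular' th0 cos0 mulr1; have [[]] := hp lam. Qed.

Local Notation reaches := (reaches th).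

Lemma reaches_mono k lam nu : lam <= nu -> reaches k lam -> reaches k nu.
Proof.
move=> ln [x x0 hx]; exists x => //; apply: (lt_le_trans hx).
exact: (angle_mono qK hp).
Qed.

Lemma reaches_le j k lam : (j <= k)%N -> reaches k lam -> reaches j lam.
Proof.
move=> jk [x x0 hx]; exists x => //; apply: le_lt_trans hx.
by rewrite ler_wpM2r ?pi_ge0 // ler_nat.
Qed.

Lemma reaches0 lam : reaches 0 lam.
Proof. by exists 1 => //; rewrite mul0r; apply: (angle_gt0 qK hp). Qed.

Lemma reaches_open k lam : reaches k lam ->
  exists2 d, 0 < d & forall nu, lam - d < nu -> reaches k nu.
Proof.
move=> [x x0 hx]; set E := expR (2 * rate K (`|lam| + 1) * x).
have E0 : 0 < E by exact: expR_gt0.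
pose e := (th lam x - k%:R * pi) / E.
have e0 : 0 < e by rewrite divr_gt0 // subr_gt0.
exists (Num.min 1 e); first by rewrite lt_min ltr01.
move=> nu; rewrite ltrBlDr -ltrBlDl lt_min => /andP[n1 ne].
have [ln|nl] := leP lam nu; first exact: (reaches_mono ln (ex_intro2 _ _ x x0 hx)).
exists x => //.
have := angle_growth qK hp (ltW nl) x0.
have h : (lam - nu) * expR (2 * rate K nu * x) <= (lam - nu) * E.
  rewrite ler_wpM2l ?subr_ge0 ?(ltW nl) // /E ler_expR ler_wpM2r // ler_wpM2l //.
  rewrite /rate !lerD2r (ger0_norm (addr_ge0 (normr_ge0 _) ler01)).
  have -> : nu = lam - (lam - nu) by ring.
  by apply: (le_trans (ler_normB _ _)); rewrite lerD2l gtr0_norm ?subr_gt0 // ltW.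
have : (lam - nu) * E < th lam x - k%:R * pi by rewrite -ltr_pdivlMr.
by lra.
Qed.

Lemma angle_right lam x a : 0 <= x -> th lam x < a ->
  exists2 d, 0 < d & forall nu, lam <= nu < lam + d -> th nu x < a.
Proof.
move=> x0 h; set E := expR (2 * rate K lam * x).
have E0 : 0 < E by exact: expR_gt0.
exists ((a - th lam x) / E); first by rewrite divr_gt0 // subr_gt0.
move=> nu /andP[ln nd]; have := angle_growth qK hp ln x0; rewrite -/E.
have : (nu - lam) * E < a - th lam x by rewrite -ltr_pdivlMr //; lra.
by lra.
Qed.

Lemma not_reaches_low lam k : lam <= - K -> ~ reaches k.+1 lam.
Proof.
move=> lK [x x0 hx].
have hq s : 0 <= s -> lam <= q s.
  by move=> _; have := qK s; rewrite ler_norml => /andP[h _]; exact: le_trans h.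
have := @quadrant_trap _ _ _ _ hp lam 0 0 0 x (lexx _) hq.
rewrite lexx x0 th0 mul0r add0r => /(_ isT); rewrite divr_ge0 ?pi_ge0 // => /(_ isT).
move=> h; have := pi_gt0 R; have : pi <= k.+1%:R * pi :> R.
  by rewrite ler_peMl ?pi_ge0 // ler1n.
by move: hx h; lra.
Qed.

(** Beyond N one has (y y')' >= (- lam / 2) y^2, while y y' stays nonpositive.
    *)
Lemma descending_L2 lam N : lam < 0 -> 0 <= N -> (forall x, N <= x -> lam / 2 <= q x) ->
  (forall x, N <= x -> regular lam x * regular' lam x <= 0) -> L2 (regular lam).
Proof.
move=> l0 N0 hq neg.
have [cy cy1 dy dy1] := regular_sol lam.
set y := regular lam in cy dy dy1 neg *; set y1 := regular' lam in cy1 dy dy1 neg.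
have cy2 : contin (fun t => y t ^+ 2) by move=> t; cnt.
have ly2 := contin_locint cy2.
have inc x : N <= x -> - lam / 2 * (prim (fun t => y t ^+ 2) x - prim (fun t => y t ^+ 2) N)
    <= - (y N * y1 N).
  move=> Nx.
  have := @mono_le _ (fun t => y t * y1 t - - lam / 2 * prim (fun t => y t ^+ 2) t)
    (fun t => y1 t ^+ 2 + (q t - lam / 2) * y t ^+ 2) N x Nx.
  move=> h; have {}h : y N * y1 N - - lam / 2 * prim (fun t => y t ^+ 2) N <=
      y x * y1 x - - lam / 2 * prim (fun t => y t ^+ 2) x.
    apply: h.
    - move=> t /andP[Nt _]; have t0 := le_lt_trans N0 Nt.
      have d1 := dy t t0; have d2 := dy1 t t0; have d3 := prim_ftc ly2 t0 (cy2 t).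
      by apply: deq; [der|field].
    - by move=> t _; cnt; exact: prim_contin.
    - move=> t /andP[Nt _]; rewrite addr_ge0 ?sqr_ge0 // mulr_ge0 ?sqr_ge0 // subr_ge0.
      exact: hq (ltW Nt).
  have := neg x Nx; move: h; move: (prim _ _) (prim _ _) => a b; lra.
split; first exact: measurable_contin.
apply: (@integrable_of_bound _ _ (prim (fun t => y t ^+ 2) N - (y N * y1 N) / (- lam / 2))) => //.
- exact: measurable_contin.
- by move=> t _; exact: sqr_ge0.
move=> x x0; have m0 : 0 < - lam / 2 by lra.
have [Nx|xN] := leP N x.
  by rewrite -lerBlDl -mulNr ler_pdivlMr // mulrC; exact: inc.
apply: (@le_trans _ _ (prim (fun t => y t ^+ 2) N)).
  by apply: prim_ndecr => //; [exact: ltW|move=> t _; exact: sqr_ge0].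
rewrite lerDl -mulNr divr_ge0 ?(ltW m0) // oppr_ge0; exact: neg.
Qed.

(** Take the infimum of the values that reach k + 1; it does not reach k + 1
    itself, because that condition is open. If beyond N its angle were once
    below k pi + pi/2, the same would hold for slightly larger values, which
    would then be trapped by [quadrant_trap] and could not reach k + 1. So
    beyond N the angle stays between k pi + pi/2 and (k + 1) pi, where y y' <=
    0. *)
Lemma threshold_eigenvalue k nu : nu < 0 -> reaches k.+1 nu ->
  exists lam, [/\ lam < nu, L2 (regular lam), reaches k lam & ~ reaches k.+1 lam].
Proof.
move=> n0 hn.
pose S := [set lam | lam <= nu /\ reaches k.+1 lam].
have Sn : S nu by split.
have Sl : lbound S (- K).
  by move=> lam [_ hl]; rewrite leNgt; apply/negP => h; exact: (not_reaches_low (ltW h) hl).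
have hS : has_inf S by split; [exists nu|exists (- K)].
pose lam := inf S.
have lamS t : S t -> lam <= t by move=> St; apply: ge_inf => //; exists (- K).
have nlam : ~ reaches k.+1 lam.
  move=> /reaches_open [d d0 hd].
  have : S (lam - d / 2).
    split; last by apply: hd; lra.
    by have := lamS _ Sn; lra.
  by move=> /lamS; lra.
have ln : lam < nu.
  by rewrite lt_neqAle lamS // andbT; apply/eqP => e; apply: nlam; rewrite e.
have above t : lam < t -> reaches k.+1 t.
  move=> lt; have tl : 0 < t - lam by rewrite subr_gt0.
  have [s [_ hs] st] := inf_adherent tl hS.
  by apply: reaches_mono hs; move: st; rewrite -/lam; lra.
have l0 : lam < 0 by exact: lt_trans n0.
have n2 : 0 < - nu / 2 by lra.
have [N N0 hN] := potential_small qC n2.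
have hq t : N <= t -> nu / 2 <= q t.
  by move=> Nt; have := hN t Nt; rewrite ler_norml => /andP[]; lra.
have lo x : N <= x -> k%:R * pi + pi / 2 <= th lam x.
  move=> Nx; rewrite leNgt; apply/negP => hx.
  have x0 := le_trans N0 Nx.
  have [d d0 hd] := angle_right x0 hx.
  (* t reaches k + 1, yet its angle at x is still below k pi + pi/2 *)
  pose t := Num.min nu (lam + d / 2).
  have lt : lam < t by rewrite lt_min ln; lra.
  have td : t <= lam + d / 2 by rewrite ge_min lexx orbT.
  have tn : t <= nu by rewrite ge_min lexx.
  move: lt td tn; move: t => t lt td tn.
  have ht : th t x <= k%:R * pi + pi / 2 by apply/ltW/hd; rewrite (ltW lt); lra.
  have [z z0 hz] := above t lt.
  have pp := pi_gt0 R.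
  have kp : k%:R * pi + pi / 2 <= k.+1%:R * pi :> R by rewrite -[k.+1%:R]natr1; lra.
  have [xz|zx] := leP x z.
    have := @quadrant_trap _ _ _ _ hp t k N x z N0 _ _ ht; rewrite Nx xz => h.
    have : th t z <= k%:R * pi + pi / 2.
      by apply: h => // s Ns; have := hq s Ns; lra.
    lra.
  have := multiple_no_return qK hp z0 (ltW hz) zx; lra.
have hi x : 0 <= x -> th lam x <= k.+1%:R * pi.
  by move=> x0; rewrite leNgt; apply/negP => h; apply: nlam; exists x.
exists lam; split => //.
- apply: (descending_L2 l0 N0).
    by move=> x Nx; have := hq x Nx; lra.
  move=> x Nx; have h1 := lo x Nx; have h2 := hi x (le_trans N0 Nx).
  have -> : regular lam x * regular' lam x =
      rho lam x ^+ 2 * (sin (th lam x) * cos (th lam x)) by rewrite /regular /regular'; ring.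
  rewrite pmulr_rle0 ?exprn_gt0 //.
  set t := th lam x - k%:R * pi - pi / 2.
  have e : th lam x = (t + pi / 2) + k%:R * pi by rewrite /t; ring.
  rewrite e sinDpin cosDpin sinDpihalf cosDpihalf.
  have -> : (-1) ^+ k * cos t * ((-1) ^+ k * - sin t) = - (cos t * sin t) * ((-1) ^+ k) ^+ 2 by ring.
  rewrite -exprM mulnC exprM sqrrN expr1n expr1n mulr1 oppr_le0.
  have t0 : 0 <= t by rewrite /t; lra.
  have t1 : t <= pi / 2 by move: h2; rewrite /t -[k.+1%:R]natr1; lra.
  have pp := pi_gt0 R.
  rewrite mulr_ge0 //.
    by apply: cos_ge0_pihalf; rewrite t1 andbT; lra.
  by apply: sin_ge0_pi; rewrite t0; lra.
- exists N => //; apply: lt_le_trans (lo N (lexx _)); rewrite ltrDl divr_gt0 ?pi_gt0 //.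
Qed.

Let wr lam nu x := regular lam x * regular' nu x - regular' lam x * regular nu x.

(** Otherwise both angles stay in (k pi, (k + 1) pi) from some X on, where u and
    v denote the regular solutions for lam and nu. There u v > 0, so the
    Wronskian u v' - u' v, whose derivative is (lam - nu) u v, is negative and
    decreasing, and v / u decreases. So v is square integrable with u, and the
    Wronskian tends to 0, a contradiction. *)
Lemma reaches_step lam nu k : lam < nu -> L2 (regular lam) -> reaches k lam -> reaches k.+1 nu.
Proof.
move=> ln Lu [X X0 hX]; apply: contrapT => nr.
have hi x : 0 <= x -> th nu x < k.+1%:R * pi.
  move=> x0; rewrite ltNge; apply/negP => h; apply: nr; exists (x + 1); first lra.
  apply: (multiple_no_return qK hp x0 h); lra.
have lo x : X <= x -> k%:R * pi < th lam x.
  rewrite le_eqVlt => /predU1P[<- //|Xx].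
  exact: (multiple_no_return qK hp X0 (ltW hX) Xx).
have mono x : 0 <= x -> th lam x <= th nu x by exact: (angle_mono qK hp (ltW ln)).
have sg a x : X <= x -> lam <= a <= nu -> 0 < (-1) ^+ k * regular a x.
  move=> Xx /andP[la an]; have x0 := le_trans X0 Xx.
  have h1 := lo x Xx; have h2 := hi x x0.
  have h3 := angle_mono qK hp la x0; have h4 := angle_mono qK hp an x0.
  rewrite /regular -(subrK (k%:R * pi) (th a x)) sinDpin.
  have -> : (-1) ^+ k * (rho a x * ((-1) ^+ k * sin (th a x - k%:R * pi))) =
     rho a x * sin (th a x - k%:R * pi) * ((-1) ^+ k) ^+ 2 by ring.
  rewrite -exprM mulnC exprM sqrrN expr1n expr1n mulr1 mulr_gt0 // sin_gt0_pi //.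
  by apply/andP; split; move: h2; rewrite -natr1; lra.
have uvp x : X <= x -> 0 < regular lam x * regular nu x.
  move=> Xx; have := mulr_gt0 (sg lam x Xx _) (sg nu x Xx _).
  rewrite !lexx !(ltW ln) => /(_ isT isT).
  rewrite mulrACA -expr2 -exprM mulnC exprM sqrrN !expr1n mul1r => h; exact: h.
have [cu cu1 du du1] := regular_sol lam; have [cv cv1 dv dv1] := regular_sol nu.
have cW : contin (wr lam nu) by move=> t; rewrite /wr; cnt.
have dW x : 0 < x -> dd (wr lam nu) x ((lam - nu) * (regular lam x * regular nu x)).
  move=> x0; have d1 := du x x0; have d2 := du1 x x0; have d3 := dv x x0; have d4 := dv1 x x0.
  by rewrite /wr; apply: deq; [der|ring].
have WX : wr lam nu X <= 0.
  have -> : wr lam nu X = - (rho lam X * rho nu X * sin (th nu X - th lam X)).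
    by rewrite sinB /wr /regular /regular'; ring.
  rewrite oppr_le0 mulr_ge0 //; first by rewrite mulr_ge0 // ltW.
  have := lo X (lexx _); have := hi X X0; have := mono X X0; rewrite -natr1 => h1 h2 h3.
  have k0 : 0 <= k%:R * pi :> R by rewrite mulr_ge0 // pi_ge0.
  by apply: sin_ge0_pi; apply/andP; split; lra.
have Wneg x t : X <= x -> x < t -> wr lam nu t < wr lam nu x.
  move=> Xx xt; rewrite -ltrN2.
  apply: (@mono_lt _ (fun t => - wr lam nu t) (fun t => - ((lam - nu) * (regular lam t * regular nu t)))) => //.
  - move=> s /andP[xs _]; apply: dopp; apply: dW; lra.
  - by move=> s _; cnt.
  - move=> s /andP[xs _]; have := uvp s (le_trans Xx (ltW xs)); nra.
have unz x : X <= x -> regular lam x != 0.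
  by move=> Xx; apply/eqP => e; have := uvp x Xx; rewrite e mul0r ltxx.
(* the ratio v / u, with derivative W / u^2 *)
pose r x := regular nu x * (regular lam x)^-1.
have rdecr x : X <= x -> r x <= r X.
  move=> Xx; rewrite -lerN2.
  apply: (@mono_le _ (fun t => - r t) (fun t => - (wr lam nu t / regular lam t ^+ 2))) => //.
  - move=> s /andP[Xs _]; have s0 := le_lt_trans X0 Xs; have nz := unz s (ltW Xs).
    apply: dopp; apply: deq; first exact: dmul (dv s s0) (dinv nz (du s s0)).
    by rewrite /wr; field.
  - move=> s /andP[Xs _]; rewrite /r; cnt; apply: cinv => //; exact: unz.
  - move=> s /andP[Xs _]; rewrite oppr_ge0 mulr_le0_ge0 ?invr_ge0 ?sqr_ge0 //.
    exact: le_trans (ltW (Wneg X s (lexx _) Xs)) WX.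
have rpos x : X <= x -> 0 < r x.
  move=> Xx; have -> : r x = regular lam x * regular nu x * (regular lam x)^-1 ^+ 2.
    by rewrite /r; field; exact: unz.
  rewrite mulr_gt0 ?uvp // lt_def sqr_ge0 sqrf_eq0 invr_eq0 unz //.
have vle x : X <= x -> regular nu x ^+ 2 <= r X ^+ 2 * regular lam x ^+ 2.
  move=> Xx; have -> : regular nu x = r x * regular lam x.
    by rewrite /r divfK // unz.
  rewrite exprMn ler_wpM2r ?sqr_ge0 //.
  have r0 := ltW (rpos x Xx); have r1 := ltW (rpos X (lexx _)).
  by rewrite ler_sqr ?nnegrE //; exact: rdecr.
have cv2 : contin (fun t => regular nu t ^+ 2) by move=> t; cnt.
have cu2 : contin (fun t => r X ^+ 2 * regular lam t ^+ 2) by move=> t; cnt.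
have Lv : L2 (regular nu).
  split; first exact: measurable_contin.
  apply: (@integrable_of_bound _ _ (prim (fun t => regular nu t ^+ 2) X +
     \int[mu]_(t in H) (r X ^+ 2 * regular lam t ^+ 2))).
  - exact: measurable_contin.
  - exact: contin_locint.
  - by move=> t _; exact: sqr_ge0.
  move=> x x0.
  have i1 : integrable_on H (fun t => r X ^+ 2 * regular lam t ^+ 2).
    by apply: intgZ => //; case: Lu.
  have p1 t : 0 <= t -> 0 <= r X ^+ 2 * regular lam t ^+ 2.
    by move=> _; rewrite mulr_ge0 ?sqr_ge0.
  have [Xx|xX] := leP X x; last first.
    apply: (@le_trans _ _ (prim (fun t => regular nu t ^+ 2) X)).
      by apply: prim_ndecr; [exact: ltW|exact: contin_locint|move=> t _; exact: sqr_ge0].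
    by rewrite lerDl; apply: Rintegral_ge0 => t t0; exact: p1.
  have h0 : 0 <= X <= x by rewrite X0.
  have := @prim_incr_le _ (fun t => regular nu t ^+ 2) (fun t => r X ^+ 2 * regular lam t ^+ 2)
    X x h0 (contin_locint cv2) (contin_locint cu2).
  move=> h; have {}h := h (fun t tt => vle t (ltW (proj1 (andP tt)))).
  have := prim_le_half x i1 p1.
  have : 0 <= prim (fun t => r X ^+ 2 * regular lam t ^+ 2) X.
    by apply: prim_ge0 => t /andP[t0 _]; exact: p1.
  move: h; move: (prim _ _) (prim _ _) (prim _ _) (prim _ _) (Rintegral _ _ _) => *; lra.
have [_ u0 u10] := sol_L2 cq qK (regular_sol lam) Lu.
have [_ v0 v10] := sol_L2 cq qK (regular_sol nu) Lv.
have W0 : wr lam nu x @[x --> +oo] --> (0 : R).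
  have -> : 0 = 0 * 0 - 0 * 0 :> R by rewrite !mulr0 subrr.
  by apply: cvgB; apply: cvgM.
have c0 : 0 < - wr lam nu (X + 1).
  by rewrite oppr_gt0; apply: lt_le_trans WX; apply: Wneg => //; lra.
have [N N0 hN] := cvgy_dist W0 c0.
pose x := Num.max N (X + 2).
have := hN x; rewrite le_max lexx => /(_ isT); rewrite subr0.
have : wr lam nu x < wr lam nu (X + 1).
  by apply: Wneg; [lra|rewrite lt_max; apply/orP; right; lra].
by rewrite ltr_norml => h /andP[]; lra.
Qed.

(** By [reaches_step], distinct eigenvalues reach distinct numbers of multiples
    of pi. *)
Lemma count_eigenvalues nu n :
  (forall k, (k < n)%N -> exists lam, [/\ lam < nu, L2 (regular lam), reaches k lam & ~ reaches k.+1 lam]) ->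
  (forall lam, lam < nu -> L2 (regular lam) -> ~ reaches n lam) ->
  ([set lam | L2 (regular lam) /\ lam < nu] #= `I_n)%card.
Proof.
move=> ex up.
have /choice [e he] : forall k, exists lam, (k < n)%N ->
    [/\ lam < nu, L2 (regular lam), reaches k lam & ~ reaches k.+1 lam].
  move=> k; have [kn|kn] := ltnP k n; last by exists 0.
  by have [lam hl] := ex k kn; exists lam.
have -> : [set lam | L2 (regular lam) /\ lam < nu] = e @` `I_n.
  apply/seteqP; split => [lam [Ll ln]|_ [k kn <-]] /=; last by have [] := he k kn.
  have [k kn [rk nrk]] : exists2 k, (k < n)%N & reaches k lam /\ ~ reaches k.+1 lam.
    have := up lam ln Ll; elim: n {ex up he} => [|n IH] nr; first by case: nr; exact: reaches0.
    have [r|r] := pselect (reaches n lam); first by exists n.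
    by have [k kn hk] := IH r; exists k => //; exact: ltnW.
  exists k => //; have [_ Le re nre] := he k kn.
  have [lt|lt|//] := ltgtP (e k) lam.
  - by case: nrk; exact: reaches_step lt Le re.
  - by case: nre; exact: reaches_step lt Ll rk.
apply: inj_card_eq => i j /set_mem /= iN /set_mem /= jN eij.
have [_ _ ri ni] := he i iN; have [_ _ rj nj] := he j jN.
apply/eqP; rewrite eqn_leq; apply/andP; split; rewrite leqNgt; apply/negP => lt.
- by apply: nj; rewrite -eij; exact: reaches_le lt ri.
- by apply: ni; rewrite eij; exact: reaches_le lt rj.
Qed.

(** Between two zeros of y the angle passes from a multiple of pi to a larger
    one. *)
Lemma zeros_reach lam n (a : nat -> R) : a 0%N = 0 ->
  (forall i, (i < n)%N -> a i < a i.+1) -> (forall i, (i <= n)%N -> regular lam (a i) = 0) ->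
  reaches n lam.
Proof.
move=> a0 inc z.
have pos i : (i <= n)%N -> 0 <= a i.
  elim: i => [_|i IH ii]; first by rewrite a0.
  by apply: (le_trans (IH (ltnW ii))); exact/ltW/inc.
have h i : (i <= n)%N -> i%:R * pi <= th lam (a i).
  elim: i => [_|i IH ii]; first by rewrite mul0r a0 th0.
  apply: sin0_next.
    by apply: (multiple_no_return qK hp (pos i (ltnW ii)) (IH (ltnW ii))); exact: inc.
  have /eqP := z _ ii; rewrite mulf_eq0 gt_eqF //= => /eqP h; exact: h.
exists (a n + 1); first by rewrite addr_ge0 // pos.
apply: (multiple_no_return qK hp (pos n (leqnn n)) (h n (leqnn n))); lra.
Qed.

Lemma reach_zeros lam n : reaches n lam -> exists a : nat -> R,
  [/\ a 0%N = 0, (forall i, (i < n)%N -> a i < a i.+1) &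
      forall i, (i <= n)%N -> regular lam (a i) = 0 /\ 0 <= a i].
Proof.
move=> [X X0 hX].
have ex i : exists x, (i <= n)%N -> 0 <= x /\ th lam x = i%:R * pi.
  have [ii|ii] := leqP i n; last by exists 0.
  have [||x /andP[x0 _] hx] := @ivt _ (th lam) 0 X (i%:R * pi) X0.
  - by move=> t _; exact: cth.
  - rewrite th0 mulr_ge0 ?pi_ge0 //=; apply: (le_trans _ (ltW hX)).
    by rewrite ler_wpM2r ?pi_ge0 // ler_nat.
  - by exists x.
have /choice [a ha] := ex.
exists a; split.
- have [a0 t0] := ha 0 (leq0n n); apply/eqP; rewrite eq_le a0 andbT leNgt; apply/negP => p.
  by have := angle_gt0 qK hp lam p; rewrite t0 mul0r ltxx.
- move=> i ii; have [p1 t1] := ha i (ltnW ii); have [p2 t2] := ha i.+1 ii.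
  rewrite ltNge; apply/negP; rewrite le_eqVlt => /predU1P[e|lt].
    have := t1; rewrite -e t2 -natr1; have := pi_gt0 R; lra.
  have := @multiple_no_return _ _ _ qK _ _ hp lam i.+1 _ _ p2 _ lt; rewrite t2 lexx => /(_ isT).
  by rewrite t1 -natr1; have := pi_gt0 R; lra.
- move=> i ii; have [p1 t1] := ha i ii; split => //.
  by rewrite /regular t1 -[i%:R * pi]add0r sinDpin sin0 !mulr0.
Qed.

End Sturm.

(** * Hyperbolic functions *)

Section Hyperbolic.
Variable R : realType.
Implicit Types (x t : R).

Lemma dsinh x : dd (@sinh R) x (cosh x).
Proof.
rewrite (_ : @sinh R = fun x => (expR x + - expR (- x)) * 2^-1); last by apply/funext.
by apply: deq; [der|rewrite /cosh; field].
Qed.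

Lemma dcosh x : dd (@cosh R) x (sinh x).
Proof.
rewrite (_ : @cosh R = fun x => (expR x + expR (- x)) * 2^-1); last by apply/funext.
by apply: deq; [der|rewrite /sinh; field].
Qed.

Lemma csinh : contin (@sinh R). Proof. by move=> x; exact: dcont (dsinh x). Qed.
Lemma ccosh : contin (@cosh R). Proof. by move=> x; exact: dcont (dcosh x). Qed.

Lemma sinh0 : sinh (0 : R) = 0. Proof. by rewrite /sinh oppr0 subrr mul0r. Qed.
Lemma cosh0 : cosh (0 : R) = 1. Proof. by rewrite /cosh oppr0 expR0; field. Qed.

Lemma cosh2 x : cosh x ^+ 2 = 1 + sinh x ^+ 2.
Proof.
have := expRxMexpNx_1 x; rewrite /cosh /sinh; move: (expR x) (expR (- x)) => a b h.
by transitivity (a * b + ((a - b) / 2) ^+ 2); [field|rewrite h].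
Qed.

Lemma cosh_gt0 x : 0 < cosh x.
Proof. by rewrite divr_gt0 // addr_gt0 ?expR_gt0. Qed.

Lemma cosh_ge1 x : 1 <= cosh x.
Proof.
by rewrite -(@ler_sqr R) ?nnegrE ?(ltW (cosh_gt0 x)) // expr1n cosh2 lerDl sqr_ge0.
Qed.

Lemma sinh_ge x : 0 <= x -> x <= sinh x.
Proof.
move=> x0; rewrite -subr_ge0.
have -> : 0 = sinh 0 - 0 :> R by rewrite sinh0 subr0.
apply: (@mono_le _ (fun t => sinh t - t) (fun t => cosh t - 1)) => //.
- by move=> t _; have d1 := dsinh t; der.
- by move=> t _; have c1 := csinh; cnt.
- by move=> t _; rewrite subr_ge0 cosh_ge1.
Qed.

Lemma sinh_gt0 x : 0 < x -> 0 < sinh x.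
Proof. by move=> x0; apply: lt_le_trans (sinh_ge (ltW x0)). Qed.

Lemma sinh_le_exp x : 0 <= x -> sinh x <= expR x.
Proof. by move=> x0; rewrite /sinh; have := expR_gt0 x; have := expR_gt0 (- x); lra. Qed.

Lemma exp_le_sinh x : 1 <= x -> expR x / 4 <= sinh x.
Proof.
move=> x1; have h1 : 1 + x <= expR x by exact: expR_ge1Dx.
have := expRxMexpNx_1 x; have := expR_gt0 (- x); rewrite /sinh => h2 h3.
nra.
Qed.

(** The function x coth x - 1, continued by its limit at 0. *)
Definition tau x := if 0 < x then x * cosh x / sinh x - 1 else 0.

Lemma tau_pos x : 0 < x -> tau x = x * cosh x / sinh x - 1.
Proof. by rewrite /tau => ->. Qed.

Lemma dtau x : 0 < x -> dd tau x ((sinh x * cosh x - x) / sinh x ^+ 2).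
Proof.
move=> x0; have s0 := gt_eqF (sinh_gt0 x0).
apply: (@dnear _ (fun t => t * cosh t * (sinh t)^-1 - 1)).
  by near=> t; rewrite tau_pos //; near: t; exact: lt_nbhsr.
have d1 := dcosh x; have d2 := dinv (negbT s0) (dsinh x).
apply: deq; first by der.
have h := cosh2 x; rewrite (_ : (sinh x * cosh x - x) = sinh x * cosh x + x * sinh x ^+ 2 - x * cosh x ^+ 2); last by rewrite h; ring.
by field; rewrite s0.
Unshelve. all: by end_near. Qed.

Lemma tau'_gt0 x : 0 < x -> 0 < (sinh x * cosh x - x) / sinh x ^+ 2.
Proof.
move=> x0; rewrite divr_gt0 ?exprn_gt0 ?sinh_gt0 // subr_gt0.
have c1 : 1 < cosh x.
  by rewrite -(@ltr_sqr R) ?nnegrE ?(ltW (cosh_gt0 x)) // expr1n cosh2 ltrDl exprn_gt0 // sinh_gt0.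
apply: (le_lt_trans (sinh_ge (ltW x0))); rewrite ltr_pMr ?sinh_gt0 //.
Qed.

Lemma tau_ge0 x : 0 <= tau x.
Proof.
have [x0|x0] := ltP 0 x; last by rewrite /tau ltNge x0.
rewrite tau_pos // subr_ge0 ler_pdivlMr ?sinh_gt0 // mul1r -subr_ge0.
have -> : 0 = 0 * cosh 0 - sinh 0 :> R by rewrite sinh0 subr0 mul0r.
apply: (@mono_le _ (fun t => t * cosh t - sinh t) (fun t => t * sinh t)); first exact: ltW.
- move=> t _; have d1 := dsinh t; have d2 := dcosh t.
  by apply: deq; [der|ring].
- by move=> t _; have c1 := csinh; have c2 := ccosh; cnt.
- by move=> t /andP[t0 _]; rewrite mulr_ge0 ?ltW ?sinh_gt0.
Qed.

Lemma tau_le x : 0 < x -> tau x <= x.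
Proof.
move=> x0; rewrite tau_pos // lerBlDr ler_pdivrMr ?sinh_gt0 //.
have h : expR (- x) <= 1 by rewrite expR_le1; lra.
have := sinh_ge (ltW x0); have -> : cosh x = sinh x + expR (- x) by rewrite /sinh /cosh; field.
nra.
Qed.

(** This is the inequality on coth that makes the virial nonnegative. *)
Lemma tau_le_sqr x : 0 < x -> 2 * tau x <= x ^+ 2.
Proof.
move=> x0; rewrite tau_pos // mulrBr mulr1 lerBlDr mulrA ler_pdivrMr ?sinh_gt0 // -subr_ge0.
have -> : 0 = (0 ^+ 2 + 2) * sinh 0 - 2 * (0 * cosh 0) :> R by rewrite sinh0; ring.
apply: (@mono_le _ (fun t => (t ^+ 2 + 2) * sinh t - 2 * (t * cosh t)) (fun t => t ^+ 2 * cosh t)).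
- exact: ltW.
- move=> t _; have d1 := dsinh t; have d2 := dcosh t.
  by apply: deq; [der|rewrite /= expr1; ring].
- by move=> t _; have c1 := csinh; have c2 := ccosh; cnt.
- by move=> t _; rewrite mulr_ge0 ?sqr_ge0 // ltW // cosh_gt0.
Qed.

Lemma ctau : contin tau.
Proof.
move=> x; have [x0|x0|<-] := ltgtP 0 x.
- exact: dcont (dtau x0).
- apply: (@dcont _ _ _ 0); apply: (@dnear _ (fun=> 0)); last exact: dcst.
  near=> t; rewrite /tau ltNge (_ : t <= 0) //; apply: ltW; near: t; exact: lt_nbhsl.
- apply/cvgrPdist_lt => e e0; exists e => //= t; rewrite /ball_ /= sub0r normrN => te.
  rewrite [tau 0]/tau ltxx sub0r normrN ger0_norm ?tau_ge0 //.
  have [t0|t0] := ltP 0 t; last by rewrite /tau [0 < t]ltNge t0.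
  by apply: le_lt_trans te; rewrite gtr0_norm // tau_le.
Unshelve. all: by end_near. Qed.

Lemma positive_before (h h1 : R -> R) x : 0 < x -> (forall t, 0 < t -> dd h t (h1 t)) ->
  ct h1 x -> h x = 0 -> h1 x < 0 -> exists2 d, 0 < d < x & forall t, x - d < t < x -> 0 < h t.
Proof.
move=> x0 dh ch hx neg.
have [||d d0 hd] := @ct_pos _ (fun t => - h1 t) x.
- by apply: copp.
- by rewrite oppr_gt0.
pose e := Num.min d (x / 2).
have e0 : 0 < e by rewrite lt_min d0; lra.
have ed : e <= d by rewrite ge_min lexx.
have ex : e <= x / 2 by rewrite ge_min lexx orbT.
exists e; first by rewrite e0; lra.
move=> t /andP[et tx].
have [||c /andP[tc cx]] := @mvt _ h h1 t x tx.
- move=> s /andP[ts _]; apply: dh; lra.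
- move=> s /andP[ts _]; apply: (@dcont _ _ _ (h1 s)); apply: dh; lra.
have : 0 < - h1 c by apply: hd; rewrite ltr_norml; apply/andP; split; lra.
rewrite hx => h2 h3; have := mulr_gt0 h2 (_ : 0 < x - t); rewrite subr_gt0 => /(_ tx); lra.
Qed.

End Hyperbolic.

(** * Zeros of the regular solution at zero energy *)

Section Profile.
Variable R : realType.
Implicit Types (x t a b : R).

(** F and F1 stand for a solution f and its derivative, and g for f / sinh, all
    continued continuously to the left of 0. *)
Definition profile (F F1 g : R -> R) :=
  [/\ contin F, contin F1, contin g, F 0 = 0 & F x * F1 x @[x --> +oo] --> (0 : R)] /\
  [/\ (forall x, 0 < x -> dd F x (F1 x)),
      (forall x, 0 < x -> dd F1 x (- (g x ^+ 2 * F x))) &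
      (forall x, 0 < x -> F x = g x * sinh x)].

Lemma profileN F F1 g : profile F F1 g ->
  profile (fun x => - F x) (fun x => - F1 x) (fun x => - g x).
Proof.
move=> [[cF cF1 cg F0 lim] [dF dF1 gE]]; split; split.
- by move=> t; cnt.
- by move=> t; cnt.
- by move=> t; cnt.
- by rewrite F0 oppr0.
- by rewrite (_ : (fun x => _) = (fun x => F x * F1 x)) //; apply/funext => x; rewrite mulrNN.
- by move=> x x0; apply: dopp; exact: dF.
- by move=> x x0; apply: deq; [apply: dopp; exact: dF1|rewrite sqrrN; ring].
- by move=> x x0; rewrite gE //; ring.
Qed.

Variables F F1 g : R -> R.
Hypothesis hF : profile F F1 g.

Let cF : contin F. Proof. by case: hF => [[]]. Qed.
Let cF1 : contin F1. Proof. by case: hF => [[]]. Qed.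
Let cg : contin g. Proof. by case: hF => [[]]. Qed.
Let F0 : F 0 = 0. Proof. by case: hF => [[]]. Qed.
Let dF x : 0 < x -> dd F x (F1 x). Proof. by case: hF => [_ [h _ _]]; exact: h. Qed.
Let dF1 x : 0 < x -> dd F1 x (- (g x ^+ 2 * F x)).
Proof. by case: hF => [_ [_ h _]]; exact: h. Qed.
Let gE x : 0 < x -> F x = g x * sinh x. Proof. by case: hF => [_ [_ _ h]]; exact: h. Qed.

Let sinh_neq0 x : 0 < x -> sinh x != 0.
Proof. by move=> x0; rewrite gt_eqF // sinh_gt0. Qed.

Lemma dratio x : 0 < x -> dd g x ((F1 x - g x * cosh x) / sinh x).
Proof.
move=> x0; have s0 := sinh_neq0 x0.
apply: (@dnear _ (fun t => F t * (sinh t)^-1)).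
  near=> t; have t0 : 0 < t by near: t; exact: lt_nbhsr.
  by rewrite gE // mulfK // sinh_neq0.
apply: deq; first exact: dmul (dF x0) (dinv s0 (dsinh x)).
by rewrite gE //; field.
Unshelve. all: by end_near. Qed.

(** Minus the Wronskian of f and of the scaling field x f'; here g^2 F^2 is f^4
    / sinh^2. *)
Definition virial x := x * F1 x ^+ 2 - F x * F1 x + x * (g x ^+ 2 * F x ^+ 2).

Let S x := F x * (x * F1 x - tau x * F x).
Let S' x := F1 x * (x * F1 x - tau x * F x) + F x * (F1 x - x * (g x ^+ 2 * F x)
  - (sinh x * cosh x - x) / sinh x ^+ 2 * F x - tau x * F1 x).

Let tauF x : 0 < x -> tau x * F x = x * cosh x * g x - F x.
Proof. by move=> x0; rewrite tau_pos // gE //; field; exact: sinh_neq0. Qed.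

Let cvirial : contin virial. Proof. by move=> x; rewrite /virial; cnt. Qed.
Let cS : contin S. Proof. by move=> x; have ct := @ctau R; rewrite /S; cnt. Qed.

Let dvirial x : 0 < x -> dd virial x (2 * g x ^+ 2 * S x).
Proof.
move=> x0; have d1 := dF x0; have d2 := dF1 x0; have d3 := dratio x0.
rewrite /virial; apply: deq; first by der.
rewrite /= !expr1 /S tauF // gE //; field; exact: sinh_neq0.
Qed.

Let dS x : 0 < x -> dd S x (S' x).
Proof.
move=> x0; have d1 := dF x0; have d2 := dF1 x0; have d3 := dtau x0.
by rewrite /S /S'; apply: deq; [der|ring].
Qed.

Let cS' x : 0 < x -> ct S' x.
Proof.
move=> x0; have c1 := @ctau R; have c2 := @csinh R; have c3 := @ccosh R.
by rewrite /S'; cnt; apply: cinv; [rewrite expf_neq0 // sinh_neq0|cnt].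
Qed.

(** The derivative of the virial E is 2 g^2 S with S = F (x F' - tau F). As E
    vanishes at 0 and is nonnegative in the limit at infinity, a negative value
    would give a negative interior minimum, where F is nonzero and S is 0, so x
    F' = tau F. But then x S' = F^2 (2 tau - x^2) - x^2 g^2 F^2 is negative
    there: S is positive just before, and E increases towards its minimum. *)
Lemma virial_ge0 x : 0 <= x -> 0 <= virial x.
Proof.
move=> x0; rewrite leNgt; apply/negP => neg.
have [lim] : (F x * F1 x @[x --> +oo] --> (0 : R)) /\ True by case: hF => [[_ _ _ _ h] _].
have n0 : 0 < - virial x by lra.
have [N N0 hN] := cvgy_dist lim n0 => _.
(* E >= - F F1, so beyond M the virial exceeds its negative value at x *)
pose M := Num.max N (x + 1).
have NM : N <= M by rewrite le_max lexx.
have xM : x + 1 <= M by rewrite le_max lexx orbT.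
have M0 : 0 < M by lra.
have EM : virial x < virial M.
  have := hN M NM; rewrite subr0 ltr_norml => /andP[_ h].
  have h1 : 0 <= M * F1 M ^+ 2 by rewrite mulr_ge0 ?sqr_ge0 // ltW.
  have h2 : 0 <= M * (g M ^+ 2 * F M ^+ 2) by rewrite mulr_ge0 ?(ltW M0) // mulr_ge0 ?sqr_ge0.
  by rewrite {2}/virial; lra.
have [|X] := @EVT_min R virial 0 M (ltW M0); first by apply: within_of_for => t _.
rewrite in_itv /= => /andP[X0 XM] min.
have min' t : 0 <= t <= M -> virial X <= virial t by move=> tM; apply: min; rewrite in_itv.
have EX : virial X < 0.
  by apply: le_lt_trans neg; apply: min'; rewrite x0; lra.
have {}X0 : 0 < X.
  rewrite lt_neqAle X0 andbT; apply/eqP => e; move: EX; rewrite -e /virial F0; lra.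
have {}XM : X < M.
  rewrite lt_neqAle XM andbT; apply/eqP => e.
  have : virial X <= virial x by apply: min'; rewrite x0; lra.
  by rewrite e; lra.
have FX : F X != 0.
  apply/eqP => e; move: EX; rewrite /virial e.
  have : 0 <= X * F1 X ^+ 2 by rewrite mulr_ge0 ?sqr_ge0 // ltW.
  by lra.
have sq t : 0 < t -> S t != 0 -> 0 < 2 * g t ^+ 2.
  move=> t0 St; have gt : g t != 0 by apply: contra_neq St => e; rewrite /S gE // e !mul0r.
  by rewrite mulr_gt0 // lt_def sqr_ge0 sqrf_eq0 gt.
have noleft : ~ exists2 d, 0 < d < X & forall t, X - d < t < X -> 0 < S t.
  move=> [d /andP[d0 dX] hd].
  have : virial (X - d / 2) < virial X.
    apply: (@mono_lt _ virial (fun t => 2 * g t ^+ 2 * S t)); first lra.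
    - move=> t /andP[t1 _]; apply: dvirial; lra.
    - by move=> t _.
    - move=> t /andP[t1 t2]; have St : 0 < S t by apply: hd; apply/andP; split; lra.
      by rewrite mulr_gt0 // sq ?gt_eqF //; lra.
  rewrite ltNge min' //; apply/andP; split; lra.
have [SX|SX|SX] := ltgtP (S X) 0.
- have [||d d0 hd] := @ct_pos _ (fun t => - S t) X.
  + by apply: copp; exact: cS.
  + by rewrite oppr_gt0.
  pose e := Num.min d (M - X) / 2.
  have e0 : 0 < e by rewrite divr_gt0 // lt_min d0 subr_gt0.
  have [ed eM] : 2 * e <= d /\ 2 * e <= M - X.
    have -> : 2 * e = Num.min d (M - X) by rewrite /e; field.
    by split; rewrite ge_min lexx ?orbT.
  have : - virial X < - virial (X + e).
    apply: (@mono_lt _ (fun t => - virial t) (fun t => - (2 * g t ^+ 2 * S t))); first lra.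
    - move=> t /andP[t1 _]; apply: dopp; apply: dvirial; lra.
    - by move=> t _; apply: copp; exact: cvirial.
    - move=> t /andP[t1 t2]; have St : 0 < - S t.
        by apply: hd; rewrite gtr0_norm; lra.
      by rewrite -mulrN mulr_gt0 // sq ?lt_eqF //; lra.
  have : virial X <= virial (X + e) by apply: min'; apply/andP; split; lra.
  by lra.
- apply: noleft; have [d d0 hd] := ct_pos (@cS X) SX.
  exists (Num.min d (X / 2)).
    have : Num.min d (X / 2) <= X / 2 by rewrite ge_min lexx orbT.
    have : 0 < Num.min d (X / 2) by rewrite lt_min d0; lra.
    by move=> -> ?; lra.
  move=> t /andP[t1 t2]; apply: hd.
  have : Num.min d (X / 2) <= d by rewrite ge_min lexx.
  by rewrite ltr_norml => h; apply/andP; split; lra.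
- apply: noleft; apply: (@positive_before _ S S' X X0 dS (cS' X0) SX).
  have D0 : X * F1 X = tau X * F X.
    by move/eqP: SX; rewrite mulf_eq0 (negbTE FX) /= subr_eq0 => /eqP.
  have id : tau X * (1 - tau X) - X * ((sinh X * cosh X - X) / sinh X ^+ 2) = 2 * tau X - X ^+ 2.
    have := cosh2 X; rewrite tau_pos // => h; have s0 := sinh_neq0 X0.
    apply/eqP; rewrite -subr_eq0; apply/eqP.
    transitivity (X ^+ 2 * (1 + sinh X ^+ 2 - cosh X ^+ 2) / sinh X ^+ 2); first by field.
    by rewrite h subrr mulr0 mul0r.
  have : X * S' X = F X ^+ 2 * (2 * tau X - X ^+ 2) - X ^+ 2 * g X ^+ 2 * F X ^+ 2.
    rewrite -id /S' D0 subrr mulr0 add0r.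
    transitivity (F X * (X * F1 X * (1 - tau X) - X ^+ 2 * (g X ^+ 2 * F X) -
       X * ((sinh X * cosh X - X) / sinh X ^+ 2) * F X)); first by ring.
    by rewrite D0; ring.
  have F2 : 0 < F X ^+ 2 by rewrite lt_def sqr_ge0 sqrf_eq0 FX.
  have g2 : 0 < g X ^+ 2.
    have gX : g X != 0 by apply: contra_neq FX => e; rewrite gE // e mul0r.
    by rewrite lt_def sqr_ge0 sqrf_eq0 gX.
  have h1 : 0 <= F X ^+ 2 * (X ^+ 2 - 2 * tau X).
    by rewrite mulr_ge0 ?(ltW F2) // subr_ge0 tau_le_sqr.
  have h2 : 0 < X ^+ 2 * g X ^+ 2 * F X ^+ 2 by do 2! rewrite mulr_gt0 //; rewrite exprn_gt0.
  move=> h; rewrite -(pmulr_rlt0 _ X0) h; lra.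
Qed.

Section Crossing.
Variables z z1 : R -> R.
Hypothesis hz : sol (fun t => - (3 * g t ^+ 2)) z z1.
Hypotheses (z0 : z 0 = 0) (z10 : z1 0 = 1) (c0 : 0 < F1 0).

Let cz : contin z. Proof. by case: hz. Qed.
Let cz1 : contin z1. Proof. by case: hz. Qed.
Let dz x : 0 < x -> dd z x (z1 x). Proof. by case: hz => _ _ h _; exact: h. Qed.
Let dz1 x : 0 < x -> dd z1 x (- (3 * g x ^+ 2) * z x).
Proof. by case: hz => _ _ _ h; exact: h. Qed.

Let W x := z1 x * F x - z x * F1 x.
Let A x := z x * (F1 x - x * (g x ^+ 2 * F x)) - z1 x * (x * F1 x).

Let cW : contin W. Proof. by move=> x; rewrite /W; cnt. Qed.
Let dW x : 0 < x -> dd W x (- (2 * g x ^+ 2 * (z x * F x))).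
Proof.
move=> x0; have d1 := dz x0; have d2 := dz1 x0; have d3 := dF x0; have d4 := dF1 x0.
by rewrite /W; apply: deq; [der|ring].
Qed.
Let W0 : W 0 = 0. Proof. by rewrite /W z0 F0; ring. Qed.

Let W_decr a b : 0 <= a < b -> (forall t, a < t < b -> 0 < z t * F t) -> W b < W a.
Proof.
move=> /andP[a0 ab] h; rewrite -ltrN2.
apply: (@mono_lt _ (fun t => - W t) (fun t => - - (2 * g t ^+ 2 * (z t * F t)))) => //.
- move=> t /andP[at_ _]; apply: dopp; apply: dW; lra.
- by move=> t _; apply: copp; exact: cW.
move=> t tab; have zF := h t tab; rewrite opprK; apply: mulr_gt0 => //; apply: mulr_gt0 => //.
rewrite lt_def sqr_ge0 sqrf_eq0 andbT; apply/eqP => e; move: zF.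
by rewrite gE ?e ?mul0r ?mulr0 ?ltxx //; case/andP: tab; lra.
Qed.

Let virial_id x : W x = 0 -> A x * F x ^+ 2 = - (z x * F x * virial x).
Proof.
move=> h; have {}h : z1 x * F x = z x * F1 x by apply/eqP; rewrite -subr_eq0 -/(W x) h.
transitivity (z x * F x * (F1 x - x * (g x ^+ 2 * F x)) * F x - (z1 x * F x) * (x * F1 x) * F x).
  by rewrite /A; ring.
by rewrite h /virial; ring.
Qed.

(** At a first zero X of W, the scaling field gives A(X) < 0, and the identity A
    F^2 = - z F E shows that z F is positive just before X, where W therefore
    decreases; when F(X) = 0, the sign of z F before X is that of z'(X) F'(X).
    *)
Lemma wronskian_negative x : 0 < x -> W x < 0.
Proof.
move=> x0; rewrite ltNge; apply/negP => Wx.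
have [d1 d10 hd1] := sol_pos_near0 hz z0 z10.
have [d2 d20 hd2] := ct_pos (@cF1 0) c0.
pose d := Num.min d1 (d2 / 2).
have d0 : 0 < d by rewrite lt_min d10; lra.
have dd1 : d <= d1 by rewrite ge_min lexx.
have dd2 : d <= d2 / 2 by rewrite ge_min lexx orbT.
have Fp t : 0 < t <= d -> 0 < F t.
  move=> /andP[t0 td]; rewrite -F0; apply: (@mono_lt _ F F1) => //.
  - by move=> s /andP[s0 _]; exact: dF.
  - by move=> s /andP[s0 st]; apply: hd2; rewrite subr0 gtr0_norm //; lra.
have Wd t : 0 < t <= d -> W t < 0.
  move=> /andP[t0 td]; rewrite -W0; apply: W_decr; first by rewrite lexx.
  move=> s /andP[s0 st]; rewrite mulr_gt0 ?hd1 ?Fp //; apply/andP; split; lra.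
have dx : d < x by rewrite ltNge; apply/negP => xd; have := Wd x; rewrite x0 xd => /(_ isT); lra.
have [|X /andP[dX Xx] [WX hX]] := first_sign (ltW dx) (fun t _ => @cW t) _ Wx.
  by apply: Wd; rewrite d0 lexx.
have X0 : 0 < X by lra.
have WnX t : 0 < t < X -> W t < 0.
  move=> /andP[t0 tX]; have [td|dt] := leP t d; first by apply: Wd; rewrite t0.
  by apply: hX; rewrite (ltW dt).
have AX : A X < 0.
  have -> : A X = A X + tau X * W X by rewrite WX mulr0 addr0.
  have -> : 0 = A 0 + tau 0 * W 0 by rewrite W0 /A z0; ring.
  rewrite -ltrN2.
  apply: (@mono_lt _ (fun t => - (A t + tau t * W t))
    (fun t => - ((sinh t * cosh t - t) / sinh t ^+ 2 * W t))) => //.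
  - move=> t /andP[t0 _]; have e1 := dz t0; have e2 := dz1 t0; have e3 := dF t0.
    have e4 := dF1 t0; have e5 := dtau t0; have e6 := dW t0; have e7 := dratio t0.
    apply: dopp; rewrite /A; apply: deq; first by der.
    rewrite /= !expr1.
    transitivity ((sinh t * cosh t - t) / sinh t ^+ 2 * W t +
      (2 * g t ^+ 2 * z t * (t * cosh t * g t - F t) - 2 * g t ^+ 2 * z t * (tau t * F t))).
      by rewrite gE //; field; exact: sinh_neq0.
    by rewrite tauF //; ring.
  - by move=> t _; have ct := @ctau R; rewrite /A; cnt.
  - move=> t tX; rewrite oppr_gt0 pmulr_rlt0; first exact: WnX.
    by apply: tau'_gt0; case/andP: tX.
have [d' /andP[d'0 d'X] hd'] : exists2 d, 0 < d < X & forall t, X - d < t < X -> 0 < z t * F t.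
  have [FX|FX] := eqVneq (F X) 0; last first.
    have F2 : 0 < F X ^+ 2 by rewrite lt_def sqr_ge0 sqrf_eq0 FX.
    have zFX : 0 < z X * F X.
      have h : 0 < z X * F X * virial X by rewrite -oppr_lt0 -virial_id // pmulr_llt0.
      have v0 := virial_ge0 (ltW X0).
      by rewrite ltNge; apply/negP => /mulr_le0_ge0 /(_ v0); lra.
    have [|e e0 he] := @ct_pos _ (fun t => z t * F t) X _ zFX; first by cnt.
    exists (Num.min e (X / 2)).
      have : Num.min e (X / 2) <= X / 2 by rewrite ge_min lexx orbT.
      have : 0 < Num.min e (X / 2) by rewrite lt_min e0; lra.
      by move=> -> ?; lra.
    move=> t /andP[t1 t2]; apply: he.
    have : Num.min e (X / 2) <= e by rewrite ge_min lexx.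
    by rewrite ltr_norml => h; apply/andP; split; lra.
  have F1X : F1 X != 0.
    
    apply: contraTneq AX => e; have -> : A X = 0 by rewrite /A FX e; ring.
    by rewrite ltxx.
  have zX : z X = 0.
    move/eqP: WX; rewrite /W FX mulr0 sub0r oppr_eq0 mulf_eq0 (negbTE F1X) orbF.
    by move=> /eqP.
  have pos : 0 < z1 X * F1 X.
    by move: AX; rewrite /A zX mul0r sub0r oppr_lt0 mulrCA pmulr_rgt0.
  have z1X : z1 X != 0 by apply: contraTneq pos => ->; rewrite mul0r ltxx.
  have [||||e1 /andP[e10 e1X] h1] := @positive_before _ (fun t => - z1 X * z t) (fun t => - z1 X * z1 t) X X0.
  - by move=> t t0; have e1 := dz t0; apply: deq; [der|ring].
  - by cnt.
  - by rewrite zX mulr0.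
  - by rewrite mulNr oppr_lt0 -expr2 lt_def sqr_ge0 sqrf_eq0 z1X.
  have [||||e2 /andP[e20 e2X] h2] := @positive_before _ (fun t => - F1 X * F t) (fun t => - F1 X * F1 t) X X0.
  - by move=> t t0; have e2 := dF t0; apply: deq; [der|ring].
  - by cnt.
  - by rewrite FX mulr0.
  - by rewrite mulNr oppr_lt0 -expr2 lt_def sqr_ge0 sqrf_eq0 F1X.
  exists (Num.min e1 e2); first by rewrite lt_min e10 e20 gt_min e1X.
  move=> t /andP[t1 t2].
  have m1 : Num.min e1 e2 <= e1 by rewrite ge_min lexx.
  have m2 : Num.min e1 e2 <= e2 by rewrite ge_min lexx orbT.
  have k1 : 0 < - z1 X * z t by apply: h1; apply/andP; split; lra.
  have k2 : 0 < - F1 X * F t by apply: h2; apply/andP; split; lra.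
  rewrite -(pmulr_rgt0 _ pos).
  have -> : z1 X * F1 X * (z t * F t) = (- z1 X * z t) * (- F1 X * F t) by ring.
  exact: mulr_gt0.
have : W X < W (X - d' / 2).
  apply: W_decr; first by apply/andP; split; lra.
  by move=> t /andP[t1 t2]; apply: hd'; apply/andP; split; lra.
rewrite WX; have := WnX (X - d' / 2); rewrite (_ : 0 < X - d' / 2 < X); last first.
  by apply/andP; split; lra.
by move=> /(_ isT); lra.
Qed.

(** Otherwise z / F would be strictly decreasing between two of its zeros. *)
Lemma profile_zero_between a b : 0 < a < b -> z a = 0 -> z b = 0 -> exists2 x, a < x < b & F x = 0.
Proof.
move=> /andP[a0 ab] za zb; apply: contrapT => no.
have b0 : 0 < b by lra.
have nz x : a <= x <= b -> F x != 0.
  rewrite le_eqVlt => /andP[/predU1P[<- _|ax]].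
    by apply: contraTneq (wronskian_negative a0) => e; rewrite -leNgt /W za e; lra.
  rewrite le_eqVlt => /predU1P[->|xb].
    by apply: contraTneq (wronskian_negative b0) => e; rewrite -leNgt /W zb e; lra.
  by apply/eqP => e; apply: no; exists x => //; rewrite ax xb.
have : - (z a * (F a)^-1) < - (z b * (F b)^-1).
  apply: (@mono_lt _ (fun t => - (z t * (F t)^-1)) (fun t => - (W t / F t ^+ 2))) => //.
  - move=> t /andP[at_ tb]; have t0 : 0 < t by lra.
    have nt : F t != 0 by apply: nz; rewrite !ltW.
    by apply: dopp; apply: deq; [exact: dmul (dz t0) (dinv nt (dF t0))|rewrite /W; field].
  - by move=> t tab; cnt; apply: cinv; [exact: nz|exact: cF].
  - move=> t /andP[at_ tb]; rewrite oppr_gt0 ltr_pdivrMr; last first.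
      by rewrite lt_def sqr_ge0 sqrf_eq0 nz // !ltW.
    by rewrite mul0r; apply: wronskian_negative; lra.
by rewrite za zb !mul0r ltxx.
Qed.

End Crossing.
End Profile.

(** * Enumerating zeros *)

Section Enumeration.
Variable R : realType.
Implicit Types (A : set R) (n i : nat).

Lemma enumerate_positive A n : (forall x, A x -> 0 < x) -> (A #= `I_n)%card ->
  exists a : nat -> R, [/\ a 0%N = 0, (forall i, (i < n)%N -> a i < a i.+1) &
    forall i, (i < n)%N -> A (a i.+1)].
Proof.
move=> pos An.
have fA : finite_set A by exists n.
have sz := card_fset_set An.
pose s := sort <=%O (finmap.enum_fset (fset_set A)).
have sA x : (x \in s) -> A x.
  by rewrite mem_sort => h; rewrite -(fset_setK fA).
have ss : size s = n by rewrite size_sort.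
have srt : sorted <%O s by rewrite sort_lt_sorted finmap.fset_uniq.
have pth : path <%O 0 s.
  case: s sA {ss} srt => [//|y s] sA srt /=.
  have y0 : 0 < y by apply: pos; apply: sA; rewrite mem_head.
  by rewrite y0.
exists (nth 0 (0 :: s)); split => //.
- by move=> i ii; apply: (pathP 0 pth); rewrite ss.
- by move=> i ii /=; apply: sA; rewrite mem_nth ?ss.
Qed.

Lemma increasing_card A n (a : nat -> R) : (forall i, (i < n)%N -> a i < a i.+1) ->
  (forall i, (i <= n)%N -> A (a i)) -> ~ (A #= `I_n)%card.
Proof.
move=> inc aA An.
have lt i j : (i < j)%N -> (j <= n)%N -> a i < a j.
  elim: j => [//|j IH]; rewrite ltnS leq_eqVlt => /predU1P[->|ij] jn; first exact: inc.
  by apply: lt_trans (inc j jn); apply: IH => //; exact: ltnW.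
have inj : {in `I_n.+1 &, injective a}.
  move=> i j /set_mem /=; rewrite ltnS => iN /set_mem /=; rewrite ltnS => jN e.
  have [ij|ij|//] := ltngtP i j.
  - by have := lt i j ij jN; rewrite e ltxx.
  - by have := lt j i ij iN; rewrite e ltxx.
have h1 : (`I_n.+1 #<= A)%card.
  rewrite (card_le_eql (card_esym (inj_card_eq inj))); apply: subset_card_le.
  by move=> _ [i /= iN <-]; exact: aA.
by move: h1; rewrite (card_le_eqr An) card_le_II ltnn.
Qed.

End Enumeration.

(** * Continuation of a globally regular solution to the origin *)

Section SolutionProfile.
Variable R : realType.
Implicit Types (f h : R -> R) (x t : R).

Lemma contin_glue h (l : R) : (forall x, 0 < x -> ct h x) -> h x @[x --> 0^'+] --> l ->
  contin (fun x => if 0 < x then h x else l).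
Proof.
move=> ch lim x; have [x0|x0|<-] := ltgtP 0 x.
- rewrite /ct /prop_for /continuous_at x0.
  have c := ch x x0; apply: cvg_trans c; apply: near_eq_cvg.
  by near=> t; rewrite ifT //; near: t; exact: lt_nbhsr.
- apply: (@dcont _ _ _ 0); apply: (@dnear _ (fun=> l)); last exact: dcst.
  near=> t; rewrite [0 < t]ltNge (_ : t <= 0) //; apply: ltW; near: t; exact: lt_nbhsl.
- apply/cvgrPdist_lt => e e0; rewrite ltxx.
  have /cvgrPdist_lt /(_ e e0) [d /= d0 hd] := lim.
  exists d => //= t td; case: ifP => t0; first exact: hd.
  by rewrite subrr normr0.
Unshelve. all: by end_near. Qed.

(** By the mean value theorem of Cauchy, F(x) / sinh x is F1(t) / cosh t for
    some t between 0 and x. *)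
Lemma ratio_at_zero (F F1 : R -> R) : contin F -> contin F1 -> F 0 = 0 ->
  (forall x, 0 < x -> dd F x (F1 x)) -> F x / sinh x @[x --> 0^'+] --> F1 0.
Proof.
move=> cF cF1 F0 dF.
have ck : ct (fun t => F1 t * (cosh t)^-1) 0.
  by have cc := @ccosh R; cnt; apply: cinv; [rewrite gt_eqF // cosh_gt0|cnt].
apply/cvgrPdist_lt => e e0.
have /cvgrPdist_lt /(_ e e0) [d /= d0 hd] := ck.
exists d => //= x; rewrite /ball_ /= sub0r normrN => xd x0.
have s0 := sinh_gt0 x0.
have [||t /andP[t0 tx]] := @mvt _ (fun t => F t * sinh x - F x * sinh t)
    (fun t => F1 t * sinh x - F x * cosh t) 0 x x0.
- move=> t /andP[t0 _]; have d1 := dF t t0; have d2 := dsinh t.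
  by apply: deq; [der|ring].
- by move=> t _; have cc := @csinh R; cnt.
rewrite F0 sinh0 mul0r mulr0 !subrr subr0 => /esym/eqP.
rewrite mulf_eq0 (gt_eqF x0) orbF subr_eq0 => /eqP h.
have -> : F x / sinh x = F1 t * (cosh t)^-1.
  have ch : cosh t != 0 by rewrite gt_eqF // cosh_gt0.
  have -> : F x = F1 t * sinh x / cosh t by rewrite h mulfK.
  by field; rewrite ch gt_eqF.
have := hd t; rewrite cosh0 invr1 mulr1; apply.
by rewrite /ball_ /= sub0r normrN; move: xd; rewrite !gtr0_norm //; lra.
Qed.

Lemma contin_bounded_limit (F : R -> R) (b : R) : contin F -> F x @[x --> +oo] --> b ->
  exists2 B, 0 <= B & forall x, 0 <= x -> `|F x| <= B.
Proof.
move=> cF lim; have [N N0 hN] := cvgy_dist lim ltr01.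
have [M hM] := contin_bounded N cF.
have M0 : 0 <= M by apply: le_trans (hM 0 _); rewrite ?lexx.
exists (M + `|b| + 1); first by rewrite !addr_ge0.
move=> x x0; have [Nx|xN] := leP N x.
  have := hN x Nx; have := ler_normD (F x - b) b; rewrite subrK; lra.
have := hM x; rewrite x0 ltW // => /(_ isT); have := normr_ge0 b; lra.
Qed.

(** For x >= 1 the bound on g follows from that on F and from sinh x >= e^x / 4;
    on [0, 1] it follows from continuity. *)
Lemma regular_profile f : globally_regular f -> exists F F1 g B D,
  [/\ profile F F1 g, F1 0 != 0, (forall x, 0 < x -> F x = f x) &
      (forall x, 0 < x -> F1 x = derive1 f x)] /\
  [/\ F1 x @[x --> +oo] --> (0 : R), (forall x, 0 <= x -> `|F x| <= B),
      (forall x, 0 <= x -> g x ^+ 2 <= D * expR (- x) ^+ 2) &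
      (forall x, x <= 0 -> g x = g 0)].
Proof.
move=> [sm [ode [_ [lim0 [[c [c0 limc]] [[b limb] lim1]]]]]].
have df x : 0 < x -> dd f x (derive1 f x).
  move=> x0; have [/(_ x x0) h _] := sm 0%N.
  by rewrite derive1E; exact: derivableP.
have df1 x : 0 < x -> dd (derive1 f) x (- (f x ^+ 3 / sinh x ^+ 2)).
  move=> x0; have [/(_ x x0) h _] := sm 1%N.
  have e : derive1 (derive1 f) x = - (f x ^+ 3 / sinh x ^+ 2).
    by apply/eqP; rewrite -addr_eq0; apply/eqP; exact: ode x x0.
  by rewrite -e derive1E; exact: derivableP.
(* The values at and left of 0 are the right limits at 0. *)
pose F x := if 0 < x then f x else 0.
pose F1 x := if 0 < x then derive1 f x else c.
have FE x : 0 < x -> F x = f x by rewrite /F => ->.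
have F1E x : 0 < x -> F1 x = derive1 f x by rewrite /F1 => ->.
have F0 : F 0 = 0 by rewrite /F ltxx.
have F10 : F1 0 = c by rewrite /F1 ltxx.
have cF : contin F by apply: contin_glue => // x x0; exact: dcont (df x x0).
have cF1 : contin F1 by apply: contin_glue => // x x0; exact: dcont (df1 x x0).
have dF x : 0 < x -> dd F x (F1 x).
  move=> x0; rewrite F1E //; apply: dnear (df x x0).
  by near=> t; rewrite FE //; near: t; exact: lt_nbhsr.
pose h x := F x / sinh x.
pose g x := if 0 < x then h x else c.
have gE x : 0 < x -> F x = g x * sinh x.
  by move=> x0; rewrite /g x0 /h divfK // gt_eqF // sinh_gt0.
have cg : contin g.
  apply: contin_glue; last by rewrite -F10; exact: ratio_at_zero.
  move=> x x0; rewrite /h; have cs := @csinh R; cnt.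
  by apply: cinv; [rewrite gt_eqF // sinh_gt0|exact: cs].
have dF1 x : 0 < x -> dd F1 x (- (g x ^+ 2 * F x)).
  move=> x0; apply: (@deq _ _ _ (- (f x ^+ 3 / sinh x ^+ 2))).
    apply: dnear (df1 x x0).
    by near=> t; rewrite F1E //; near: t; exact: lt_nbhsr.
  rewrite -FE // gE //; field; rewrite gt_eqF //; exact: sinh_gt0.
have limF : F x @[x --> +oo] --> b.
  apply: cvg_trans limb; apply: near_eq_cvg; near=> x.
  have x0 : 0 < x by near: x; apply: nbhs_pinfty_gt; rewrite num_real.
  by rewrite FE.
have limF1 : F1 x @[x --> +oo] --> (0 : R).
  apply: cvg_trans lim1; apply: near_eq_cvg; near=> x.
  have x0 : 0 < x by near: x; apply: nbhs_pinfty_gt; rewrite num_real.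
  by rewrite F1E.
have [B B0 hB] := contin_bounded_limit cF limF.
have [M hM] := contin_bounded 1 cg.
have M0 : 0 <= M by apply: le_trans (hM 0 _); rewrite ?lexx ?ler01.
exists F, F1, g, B, (16 * B ^+ 2 + M ^+ 2 * expR 1 ^+ 2); split; split => //.
- split; split => //.
  have -> : 0 = b * 0 :> R by rewrite mulr0.
  exact: cvgM.
- by rewrite F10.
2: by move=> x x0; rewrite /g ltxx ltNge x0.
move=> x x0.
have -> : (16 * B ^+ 2 + M ^+ 2 * expR 1 ^+ 2) * expR (- x) ^+ 2 =
    16 * (B ^+ 2 * expR (- x) ^+ 2) + M ^+ 2 * expR (1 - x) ^+ 2 by rewrite expRD; ring.
have n1 : 0 <= B ^+ 2 * expR (- x) ^+ 2 by rewrite mulr_ge0 ?sqr_ge0.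
have n2 : 0 <= M ^+ 2 * expR (1 - x) ^+ 2 by rewrite mulr_ge0 ?sqr_ge0.
have [x1|x1] := leP 1 x.
  have xp : 0 < x by lra.
  suff : g x ^+ 2 <= 16 * (B ^+ 2 * expR (- x) ^+ 2) by lra.
  rewrite /g xp /h expr_div_n ler_pdivrMr ?exprn_gt0 ?sinh_gt0 //.
  have h1 : F x ^+ 2 <= B ^+ 2.
    by rewrite -[F x ^+ 2]real_normK ?num_real // ler_sqr ?nnegrE // hB.
  apply: (le_trans h1).
  have -> : 16 * (B ^+ 2 * expR (- x) ^+ 2) * sinh x ^+ 2 = B ^+ 2 * (4 * expR (- x) * sinh x) ^+ 2 by ring.
  rewrite ler_peMr ?sqr_ge0 //.
  have h2 : 1 <= 4 * expR (- x) * sinh x.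
    have := exp_le_sinh x1; have := expRxMexpNx_1 x; have := expR_gt0 (- x).
    move: (expR x) (expR (- x)) (sinh x) => a b' s p e k.
    have : 0 <= b' * (s - a / 4) by rewrite mulr_ge0 ?subr_ge0 // ltW.
    by move: e; lra.
  by rewrite exprn_ege1.
suff : g x ^+ 2 <= M ^+ 2 * expR (1 - x) ^+ 2 by lra.
have h1 : g x ^+ 2 <= M ^+ 2.
  rewrite -[g x ^+ 2]real_normK ?num_real // ler_sqr ?nnegrE //; apply: hM.
  by rewrite x0 ltW.
apply: (le_trans h1); rewrite ler_peMr ?sqr_ge0 // exprn_ege1 //.
have : expR 0 <= expR (1 - x) by rewrite ler_expR; lra.
by rewrite expR0.
Unshelve. all: by end_near. Qed.

End SolutionProfile.

(** * The linearized operator *)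

Section Linearization.
Variable R : realType.
Implicit Types (x t a b lam : R) (i j k : nat) (u : R -> R[i]).

Variables (f F F1 g : R -> R) (B D : R) (n : nat).
Hypothesis hF : profile F F1 g.
Hypothesis F10 : F1 0 != 0.
Hypothesis FE : forall x, 0 < x -> F x = f x.
Hypothesis F1E : forall x, 0 < x -> F1 x = derive1 f x.
Hypothesis limF1 : F1 x @[x --> +oo] --> (0 : R).
Hypothesis FB : forall x, 0 <= x -> `|F x| <= B.
Hypothesis gD : forall x, 0 <= x -> g x ^+ 2 <= D * expR (- x) ^+ 2.
Hypothesis g_left : forall x, x <= 0 -> g x = g 0.
Hypothesis zeros : (positive_zeros f #= `I_n)%card.

Let q t := - (3 * g t ^+ 2).

Let cF : contin F. Proof. by case: hF => [[]]. Qed.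
Let cF1 : contin F1. Proof. by case: hF => [[]]. Qed.
Let cg : contin g. Proof. by case: hF => [[]]. Qed.
Let F0 : F 0 = 0. Proof. by case: hF => [[]]. Qed.
Let dF x : 0 < x -> dd F x (F1 x). Proof. by case: hF => [_ [h _ _]]; exact: h. Qed.
Let dF1 x : 0 < x -> dd F1 x (- (g x ^+ 2 * F x)).
Proof. by case: hF => [_ [_ h _]]; exact: h. Qed.
Let gE x : 0 < x -> F x = g x * sinh x. Proof. by case: hF => [_ [_ _ h]]; exact: h. Qed.

Lemma potential_contin : contin q. Proof. by move=> x; rewrite /q; cnt. Qed.

Let D0 : 0 <= D.
Proof. by have := gD (lexx 0); rewrite oppr0 expR0 expr1n mulr1; apply: le_trans; exact: sqr_ge0. Qed.

Lemma potential_decay x : 0 <= x -> (1 + x ^+ 2) * `|q x| <= 12 * D * expR (- x).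
Proof.
move=> x0; have n3 : 0 <= 3 * g x ^+ 2 by rewrite mulr_ge0 ?sqr_ge0.
rewrite /q normrN (ger0_norm n3).
have h1 := gD x0.
have h2 : 1 + x ^+ 2 <= 4 * expR x.
  have h : 1 + x / 2 <= expR (x / 2) by exact: expR_ge1Dx.
  have e : expR x = expR (x / 2) ^+ 2 by rewrite expr2 -expRD; congr expR; lra.
  have : (1 + x / 2) ^+ 2 <= expR x by rewrite e ler_sqr ?nnegrE //; lra.
  nra.
apply: (@le_trans _ _ (4 * expR x * (3 * (D * expR (- x) ^+ 2)))).
  apply: ler_pM => //.
  - by rewrite addr_ge0 ?sqr_ge0.
  - by rewrite ler_pM2l.
have e := expRxMexpNx_1 x.
have -> : 4 * expR x * (3 * (D * expR (- x) ^+ 2)) =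
  12 * D * ((expR x * expR (- x)) * expR (- x)) by ring.
by rewrite e mul1r.
Qed.

Lemma potential_bounded x : `|q x| <= 12 * D.
Proof.
have pos t : 0 <= t -> `|q t| <= 12 * D.
  move=> t0; apply: (@le_trans _ _ ((1 + t ^+ 2) * `|q t|)).
    by rewrite ler_peMl // lerDl sqr_ge0.
  apply: (le_trans (potential_decay t0)); rewrite ler_piMr ?mulr_ge0 //.
  by rewrite -expR0 ler_expR; lra.
have [x0|x0] := leP 0 x; first exact: pos.
by rewrite /q g_left ?(ltW x0) //; exact: pos.
Qed.

Lemma potential_profile x : 0 < x -> potential f x = q x.
Proof.
move=> x0; rewrite /potential /q -FE // gE //; congr (- _).
by rewrite exprMn mulrA mulfK // expf_neq0 // gt_eqF // sinh_gt0.
Qed.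

Let cq := potential_contin.
Let qK := potential_bounded.
Let qC := potential_decay.
Let Vq := potential_profile.

Let xi x := sinh x * F1 x.
Let xi1 x := cosh x * F1 x - g x * F x ^+ 2.

Let sol_xi : sol (fun t => q t - - 1) xi xi1.
Proof.
have c1 := @csinh R; have c2 := @ccosh R.
split.
- by move=> t; rewrite /xi; cnt.
- by move=> t; rewrite /xi1; cnt.
- move=> x x0; have d1 := dsinh x; have d2 := dF1 x0.
  by rewrite /xi /xi1; apply: deq; [der|rewrite gE //; ring].
- move=> x x0; have d1 := dcosh x; have d2 := dF1 x0; have d3 := dF x0; have d4 := dratio hF x0.
  rewrite /xi /xi1; apply: deq; first by der.
  by rewrite /= !expr1 /q gE //; field; rewrite gt_eqF // sinh_gt0.
Qed.

Let xi0 : xi 0 = 0. Proof. by rewrite /xi sinh0 mul0r. Qed.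
Let xi10 : xi1 0 = F1 0.
Proof. by rewrite /xi1 cosh0 F0 expr0n /= mulr0 subr0 mul1r. Qed.

(** As F1' = - g^2 F is O(e^{-2x}) and F1 tends to 0, F1 is O(e^{-2x}) too. *)
Lemma gauge_L2 : L2 xi.
Proof.
have B0 : 0 <= B by apply: le_trans (FB (lexx 0)).
have dec x : 0 <= x -> `|F1 x| <= D * B / 2 * expR (- 2 * x).
  apply: (@exp_decay _ F1 (fun x => - (g x ^+ 2 * F x))) => //.
  move=> t t0; rewrite normrN normrM ger0_norm ?sqr_ge0 //.
  have -> : expR (- 2 * t) = expR (- t) ^+ 2 by rewrite expr2 -expRD; congr expR; lra.
  have t1 := ltW t0; rewrite [D * B * _]mulrAC.
  by apply: ler_pM; [exact: sqr_ge0|exact: normr_ge0|exact: gD|exact: FB].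
have cxi : contin xi by case: sol_xi.
have cx2 : contin (fun t => xi t ^+ 2) by move=> t; cnt.
pose M := (D * B / 2) ^+ 2.
have le x : 0 <= x -> xi x ^+ 2 <= M * expR (- 2 * x).
  move=> x0; rewrite -[xi x ^+ 2]real_normK ?num_real // /xi normrM.
  have s0 : 0 <= sinh x by apply: le_trans (sinh_ge x0).
  have -> : M * expR (- 2 * x) = (expR x * (D * B / 2 * expR (- 2 * x))) ^+ 2.
    have e1 : expR (- 2 * x) = expR (- x) ^+ 2 by rewrite expr2 -expRD; congr expR; lra.
    have e := expRxMexpNx_1 x; rewrite e1 /M.
    transitivity ((D * B / 2) ^+ 2 * (expR (- x) * (expR x * expR (- x))) ^+ 2).
      by rewrite e mulr1; field.
    by field.
  have p1 : 0 <= D * B / 2 by rewrite divr_ge0 // mulr_ge0.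
  have p2 : 0 <= expR x * (D * B / 2 * expR (- 2 * x)).
    by rewrite mulr_ge0 ?expR_ge0 // mulr_ge0 ?expR_ge0.
  have p3 : 0 <= `|sinh x| * `|F1 x| by rewrite mulr_ge0.
  rewrite ler_sqr ?nnegrE //.
  by apply: ler_pM => //; [rewrite ger0_norm // sinh_le_exp|exact: dec].
split; first exact: (measurable_contin (@measurable_half R) cxi).
have cexp2 : contin (fun t : R => M * expR (- 2 * t)) by move=> t; cnt.
apply: (@integrable_of_bound _ _ (M / 2)).
- exact: (measurable_contin (@measurable_half R) cx2).
- exact: contin_locint.
- by move=> t _; exact: sqr_ge0.
move=> x x0; apply: (@le_trans _ _ (prim (fun t => M * expR (- 2 * t)) x)).
  apply: prim_le; [exact: contin_locint|exact: contin_locint|].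
  by move=> t /andP[t0 _]; apply: le; exact: ltW.
have ce : contin (fun t : R => expR (- 2 * t)) by move=> t; cnt.
rewrite primZ; last exact: contin_locint.
rewrite prim_expR ?oppr_eq0 ?pnatr_eq0 // ler_wpM2l ?sqr_ge0 //.
have := expR_gt0 (- 2 * x); move: (expR _) => e e0.
have -> : (e - 1) / - 2 = (1 - e) / 2 by field.
lra.
Qed.

(** Rolle between 0 and the consecutive zeros of f. *)
Lemma derivative_zeros : exists b : nat -> R,
  [/\ b 0%N = 0, (forall i, (i < n)%N -> b i < b i.+1) & forall i, (i <= n)%N -> xi (b i) = 0].
Proof.
have pos x : positive_zeros f x -> 0 < x by case.
have [a [a0 inc za]] := enumerate_positive pos zeros.
have Fa i : (i <= n)%N -> 0 <= a i /\ F (a i) = 0.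
  case: i => [|i] ii; first by rewrite a0 lexx F0.
  by have [p z] := za i ii; rewrite ltW // FE.
have /choice [b hb] : forall i, exists x, (i < n)%N -> a i < x < a i.+1 /\ F1 x = 0.
  move=> i; have [ii|_] := ltnP i n; last by exists 0.
  have [p1 z1] := Fa i (ltnW ii); have [p2 z2] := Fa i.+1 ii.
  have [||x ax] := @mvt _ F F1 (a i) (a i.+1) (inc i ii).
  - by move=> t /andP[at_ _]; apply: dF; lra.
  - by move=> t _.
  rewrite z1 z2 subrr => /esym/eqP; rewrite mulf_eq0 subr_eq0 (gt_eqF (inc i ii)) orbF => /eqP h.
  by exists x.
exists (fun i => if i is j.+1 then b j else 0); split => //.
- case=> [|i] ii; first by have [/andP[h _] _] := hb 0%N ii; rewrite a0 in h.
  have [/andP[_ h1] _] := hb i (ltnW ii); have [/andP[h2 _] _] := hb i.+1 ii.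
  exact: lt_trans h1 h2.
- case=> [|i] ii; first exact: xi0.
  by have [_ h] := hb i ii; rewrite /xi h mulr0.
Qed.

(** If f'(0) < 0, pass to - f, a solution with the same potential. *)
Lemma zero_energy_zeros z z1 a b : sol q z z1 -> z 0 = 0 -> z1 0 = 1 -> 0 < a < b ->
  z a = 0 -> z b = 0 -> exists2 x, a < x < b & f x = 0.
Proof.
move=> sz z0 z10 ab za zb.
suff : exists2 x, a < x < b & F x = 0.
  move=> [x xab Fx]; exists x => //; rewrite -FE //.
  by case/andP: ab => a0 _; case/andP: xab => ax _; exact: lt_trans ax.
have [c0|c0] := ltP 0 (F1 0).
  exact: (profile_zero_between hF sz z0 z10 c0 ab za zb).
have c0' : 0 < - F1 0 by rewrite oppr_gt0 lt_neqAle F10.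
have sz' : sol (fun t => - (3 * (- g t) ^+ 2)) z z1.
  by rewrite (_ : (fun t => _) = q) //; apply/funext => t; rewrite sqrrN.
have [x xab /eqP] := profile_zero_between (profileN hF) sz' z0 z10 c0' ab za zb.
by rewrite oppr_eq0 => /eqP; exists x.
Qed.

Section Counting.
Variables th rho : R -> R -> R.
Hypothesis hp : forall lam, pruefer q lam (th lam) (rho lam).
Local Notation y := (regular th rho).
Local Notation L := (linearized_operator f).

Lemma xi_regular x : 0 <= x -> xi x = F1 0 * y (- 1) x.
Proof.
move=> x0; rewrite -xi10.
exact: (sol_unique qK sol_xi xi0 (regular_sol hp (- 1)) (regular0 hp _) (regular'0 hp _) x0).
Qed.

Lemma regular_L2 : L2 (y (- 1)).
Proof.
apply: (L2_eq _ (L2Z (F1 0)^-1 gauge_L2)) => x x0.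
by rewrite xi_regular // mulKf.
Qed.

Lemma reaches_gauge : reaches th n (- 1).
Proof.
have [b [b0 inc zb]] := derivative_zeros.
have pos i : (i <= n)%N -> 0 <= b i.
  elim: i => [|i IH] ii; first by rewrite b0.
  by apply: (le_trans (IH (ltnW ii))); apply: ltW; exact: inc.
apply: (zeros_reach qK hp b0 inc) => i ii.
have /eqP := zb i ii; rewrite xi_regular ?pos // mulf_eq0 (negbTE F10) /=.
by move=> /eqP.
Qed.

(** The n + 2 positive zeros of the regular solution would enclose n + 1 zeros
    of f. *)
Lemma not_reaches_zero : ~ reaches th n.+2 0.
Proof.
move=> /(reach_zeros qK hp) [a [a0 inc za]].
have sz : sol q (y 0) (regular' th rho 0).
  have := regular_sol hp 0; rewrite (_ : (fun t => q t - 0) = q) //.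
  by apply/funext => t; rewrite subr0.
have pos i : (i < n.+2)%N -> 0 < a i.+1.
  by move=> ii; apply: le_lt_trans (inc i ii); have [_] := za i (ltnW ii).
have /choice [x hx] : forall i, exists x, (i <= n)%N -> a i.+1 < x < a i.+2 /\ f x = 0.
  move=> i; have [ii|_] := leqP i n; last by exists 0.
  have ii2 : (i.+1 < n.+2)%N by rewrite ltnS.
  have [|||||x xab fx] := @zero_energy_zeros (y 0) (regular' th rho 0) (a i.+1) (a i.+2) sz.
  - exact: regular0 hp 0.
  - exact: regular'0 hp 0.
  - by rewrite inc // pos // ltnW.
  - by have [] := za i.+1 (ltnW ii2).
  - by have [] := za i.+2 ii2.
  by exists x.
apply: (@increasing_card _ (positive_zeros f) n x _ _ zeros).
- move=> i ii; have [/andP[_ h1] _] := hx i (ltnW ii); have [/andP[h2 _] _] := hx i.+1 ii.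
  exact: lt_trans h1 h2.
- move=> i ii; have [/andP[h1 _] fx] := hx i ii; split => //.
  by apply: lt_trans h1; apply: pos; rewrite ltnS (leq_trans ii).
Qed.

(** As -1 is an eigenvalue, 0 would reach n + 2. *)
Lemma not_reaches_gauge : ~ reaches th n.+1 (- 1).
Proof.
by move=> h; apply: not_reaches_zero; apply: (reaches_step cq qK hp _ regular_L2 h); rewrite ltrN10.
Qed.

Lemma count_below_gauge : ([set lam | L2 (y lam) /\ (lam < - 1)%R] #= `I_n)%card.
Proof.
apply: (count_eigenvalues cq qK hp).
  move=> k kn; apply: (threshold_eigenvalue qK qC hp); first by rewrite ltrN10.
  exact: reaches_le kn reaches_gauge.
move=> lam l1 Ll h; apply: not_reaches_gauge; exact: (reaches_step cq qK hp l1 Ll h).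
Qed.

Lemma count_negative : ([set lam | L2 (y lam) /\ (lam < 0)%R] #= `I_n.+1)%card.
Proof.
apply: (count_eigenvalues cq qK hp).
  move=> k; rewrite ltnS leq_eqVlt => /predU1P[->|kn].
    exists (- 1); split; [by rewrite ltrN10|exact: regular_L2|exact: reaches_gauge|exact: not_reaches_gauge].
  have [||lam [l1 Ll r nr]] := threshold_eigenvalue qK qC hp (k := k) (nu := - 1).
  - by rewrite ltrN10.
  - exact: reaches_le kn reaches_gauge.
  by exists lam; split => //; apply: lt_trans l1 _; rewrite ltrN10.
move=> lam l1 Ll h; apply: not_reaches_zero; exact: (reaches_step cq qK hp l1 Ll h).
Qed.

Lemma complex_eigenvalues nu :
  [set lambda : R[i] | (eigenvalue_of L lambda /\ lambda < nu +i* 0)%R] =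
  (fun a => a +i* 0) @` [set lam | L2 (y lam) /\ (lam < nu)%R].
Proof.
have evP a : eigenvalue_of L (a +i* 0) <-> L2 (y a).
  exact: (eigenvalueP cq qK Vq (regular_sol hp a) (regular0 hp a) (regular'0 hp a)).
apply/seteqP; split => [[a b] /= [ev]|_ [a /= [La an] <-]].
  rewrite complex_lt0 => /andP[/eqP b0 an]; exists a; last by rewrite b0.
  by split => //; apply/evP; rewrite -b0.
by split; [exact/evP|rewrite complex_lt0 eqxx].
Qed.

Lemma card_complex_eigenvalues nu k : ([set lam | L2 (y lam) /\ (lam < nu)%R] #= `I_k)%card ->
  ([set lambda : R[i] | (eigenvalue_of L lambda /\ lambda < nu +i* 0)%R] #= `I_k)%card.
Proof.
move=> h; rewrite complex_eigenvalues; apply: card_eq_trans h.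
by apply: inj_card_eq => a b _ _ [].
Qed.

Lemma gauge_eigenfunction u : eigenfunction L ((- 1) +i* 0) u <->
  exists c : R[i], c != 0 /\ forall x, 0 <= x -> u x = c * (gauge_mode f x)%:C.
Proof.
have ge x : 0 <= x -> gauge_mode f x = F1 0 * y (- 1) x.
  rewrite le_eqVlt => /predU1P[<-|x0].
    by rewrite /gauge_mode sinh0 mul0r (regular0 hp) mulr0.
  by rewrite -xi_regular ?ltW // /gauge_mode /xi F1E.
have cC : ((F1 0)%:C : R[i]) != 0.
  by apply/eqP => /(congr1 (@complex.Re R)) /= e; move/eqP: F10; apply.
have mC a b : ((a * b)%:C : R[i]) = a%:C * b%:C by exact: rmorphM.
split.
  move=> hu; have [_ [c [c0 hc]]] := eigenfunction_multiple cq qK Vq hu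
    (regular_sol hp _) (regular0 hp _) (regular'0 hp _).
  exists (c / (F1 0)%:C); split; first by rewrite mulf_neq0 // invr_eq0.
  by move=> x x0; rewrite hc // ge // mC [RHS]mulrA divfK.
move=> [c [c0 hc]].
apply: (multiple_eigenfunction (c := c * (F1 0)%:C) cq qK Vq (regular_sol hp _) (regular0 hp _)
  (regular'0 hp _) regular_L2); first by rewrite mulf_neq0.
by move=> x x0; rewrite hc // ge // mC [LHS]mulrA.
Qed.

End Counting.

Theorem linearized_spectrum : let L := linearized_operator f in
  [/\ self_adjoint L,
      continuous_spectrum L = [set lambda : R[i] | 0 <= lambda],
      ([set lambda : R[i] | (eigenvalue_of L lambda /\ lambda < 0)%R] #= `I_n.+1)%card,
      (forall u, eigenfunction L (- 1) u <->
         exists c : R[i], c != 0 /\ forall x, 0 <= x -> u x = c * (gauge_mode f x)%:C) &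
      ([set lambda : R[i] | (eigenvalue_of L lambda /\ lambda < - 1)%R] #= `I_n)%card] /\
  (forall lambda : R[i], eigenvalue_of L lambda -> lambda < 0).
Proof.
move=> L.
have /choice [th /choice [rho hp]] := pruefer_exists cq qK.
have e0 : (0 : R[i]) = 0 +i* 0 by [].
have e1 : (- 1 : R[i]) = (- 1) +i* 0 by apply/eqP; rewrite eq_complex /= oppr0 !eqxx.
split; first split.
- exact: (dirichlet_self_adjoint cq qK Vq).
- exact: (dirichlet_continuous_spectrum cq qK qC Vq).
- rewrite e0; exact: (card_complex_eigenvalues hp (count_negative hp)).
- rewrite e1; exact: (gauge_eigenfunction hp).
- rewrite e1; exact: (card_complex_eigenvalues hp (count_below_gauge hp)).
move=> [a b] ev; have b0 := eigenvalue_real cq qK Vq ev.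
rewrite e0 complex_lt0 b0 eqxx /= ltNge; apply/negP => a0.
by apply: (nonneg_not_eigenvalue cq qK qC Vq a0); rewrite -b0.
Qed.

End Linearization.

(** * The spectrum for a globally regular solution, and the explicit one *)

Section Conclusion.
Variable R : realType.
Implicit Types (x t a b : R) (u : R -> R[i]).

Theorem spectrum_of_regular (n : nat) (f : R -> R) : globally_regular f ->
  (positive_zeros f #= `I_n)%card -> let L := linearized_operator f in
  [/\ self_adjoint L,
      continuous_spectrum L = [set lambda : R[i] | 0 <= lambda],
      ([set lambda : R[i] | (eigenvalue_of L lambda /\ lambda < 0)%R] #= `I_n.+1)%card,
      (forall u, eigenfunction L (- 1) u <->
         exists c : R[i], c != 0 /\ forall x, 0 <= x -> u x = c * (gauge_mode f x)%:C) &
      ([set lambda : R[i] | (eigenvalue_of L lambda /\ lambda < - 1)%R] #= `I_n)%card] /\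
  (forall lambda : R[i], eigenvalue_of L lambda -> lambda < 0).
Proof.
move=> /regular_profile [F [F1 [g [B [D [[h1 h2 h3 h4] [h5 h6 h7 h8]]]]]]] hz.
exact: (linearized_spectrum h1 h2 h3 h4 h5 h6 h7 h8 hz).
Qed.

Lemma gauge_is_eigenfunction (f : R -> R) (L := linearized_operator f) :
  (forall u, eigenfunction L (- 1) u <->
     exists c : R[i], c != 0 /\ forall x, 0 <= x -> u x = c * (gauge_mode f x)%:C) ->
  eigenfunction L (- 1) (fun x => (gauge_mode f x)%:C).
Proof. by move=> h; apply/h; exists 1; split; [exact: oner_neq0|move=> x _; rewrite mul1r]. Qed.

Lemma card1_unique (T : Type) (A : set T) : (A #= `I_1)%card -> forall x y : T, A x -> A y -> x = y.
Proof.
move=> /card_set_bijP [h [fn inj _]] x y Ax Ay.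
apply: inj; rewrite ?inE //; have := fn _ Ax; have := fn _ Ay => /=.
by rewrite !ltnS !leqn0 => /eqP -> /eqP ->.
Qed.

Let ch0 x : cosh x != 0. Proof. by rewrite gt_eqF // cosh_gt0. Qed.

Lemma sech2 x : 1 - tanh x ^+ 2 = (cosh x ^+ 2)^-1.
Proof.
have := cosh2 x; rewrite /tanh => h; apply/eqP; rewrite -subr_eq0; apply/eqP.
transitivity ((cosh x ^+ 2 - (1 + sinh x ^+ 2)) / cosh x ^+ 2); first by field.
by rewrite h subrr mul0r.
Qed.

Lemma dtanh x : dd (@tanh R) x (1 - tanh x ^+ 2).
Proof.
apply: deq; first exact: dmul (dsinh x) (dinv (ch0 x) (dcosh x)).
by rewrite /tanh; field.
Qed.

(** As tanh' = 1 - tanh^2, polynomials in tanh are closed under derivation,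
    which gives the smoothness of the explicit solution. *)
Lemma dhorner_tanh (p : {poly R}) x :
  dd (fun t => p.[tanh t]) x (p^`() * (1 - 'X^2)).[tanh x].
Proof.
elim/poly_ind: p => [|p c IH].
  by rewrite (_ : (fun t => _) = fun=> 0); [rewrite linear0 mul0r horner0; exact: dcst|apply/funext => t; rewrite horner0].
rewrite (_ : (fun t => _) = fun t => p.[tanh t] * tanh t + c); last first.
  by apply/funext => t; rewrite hornerMXaddC.
have d1 := dtanh x; apply: deq; first by der.
by move: (tanh x) => T; rewrite derivD derivM derivX derivC addr0 mulr1 !hornerE; ring.
Qed.

Lemma derive1_dd (f : R -> R) x a : dd f x a -> derive1 f x = a.
Proof. by move=> h; rewrite derive1E; exact: derive_val. Qed.

Lemma derive1n_horner_tanh k (p : {poly R}) : exists r : {poly R},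
  derive1n k (fun x => p.[tanh x]) = fun x => r.[tanh x].
Proof.
elim: k => [|k [r hr]]; first by exists p.
exists (r^`() * (1 - 'X^2)); rewrite derive1nS hr; apply/funext => x.
exact: derive1_dd (dhorner_tanh r x).
Qed.

Lemma tanh_lim : tanh x @[x --> +oo] --> (1 : R).
Proof.
apply: dist_cvgy => e e0; exists e^-1 => x ex.
have x0 : 0 < x by apply: lt_le_trans ex; rewrite invr_gt0.
have -> : tanh x - 1 = - (expR (- x) / cosh x).
  have h : cosh x = sinh x + expR (- x) by rewrite /sinh /cosh; field.
  have -> : expR (- x) = cosh x - sinh x by rewrite h; ring.
  by rewrite /tanh; field.
rewrite normrN ger0_norm; last by rewrite divr_ge0 ?expR_ge0 // ltW // cosh_gt0.
rewrite ltr_pdivrMr ?cosh_gt0 //; apply: (@lt_le_trans _ _ e); last first.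
  by rewrite ler_peMr ?cosh_ge1 // ltW.
have h : 1 + x <= expR x by exact: expR_ge1Dx.
rewrite expRN -[e]invrK ltf_pV2 ?posrE ?invr_gt0 ?expR_gt0 //; lra.
Qed.

Let f0 x := Num.sqrt 2 * tanh x.

Let df0 x : dd f0 x (Num.sqrt 2 * (1 - tanh x ^+ 2)).
Proof. by have d1 := dtanh x; rewrite /f0; apply: deq; [der|ring]. Qed.

Let d1f0 : derive1 f0 = fun x => Num.sqrt 2 * (1 - tanh x ^+ 2).
Proof. by apply/funext => x; exact: derive1_dd (df0 x). Qed.

Let sqrt2_sqr : Num.sqrt 2 ^+ 2 = 2 :> R. Proof. by rewrite sqr_sqrtr. Qed.

Lemma soliton_regular : globally_regular f0.
Proof.
have right (h : R -> R) (l : R) : contin h -> h 0 = l -> h x @[x --> 0^'+] --> l.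
  by move=> ch <-; apply: cvg_at_right_filter; exact: ch.
have ctanh : contin (@tanh R) by move=> x; exact: dcont (dtanh x).
have t0 : tanh (0 : R) = 0 by rewrite /tanh sinh0 mul0r.
split; [|split; [|split; [|split; [|split; [|split]]]]].
- move=> k; have e : f0 = fun x => ((Num.sqrt 2)%:P * 'X).[tanh x].
    by apply/funext => x; rewrite hornerM hornerC hornerX.
  have [r hr] := derive1n_horner_tanh k ((Num.sqrt 2)%:P * 'X).
  rewrite e hr; split; first by move=> x _; case: (dhorner_tanh r x).
  by apply: cvgP; apply: right erefl => x; exact: dcont (dhorner_tanh r x).
- move=> x x0; have sx : sinh x != 0 by rewrite gt_eqF // sinh_gt0.
  have -> : derive1n 2 f0 x = Num.sqrt 2 * - (2 * tanh x * (1 - tanh x ^+ 2)).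
    rewrite derive1nS derive1n1 d1f0; apply: derive1_dd.
    by have d1 := dtanh x; apply: deq; [der|rewrite /= expr1; ring].
  rewrite sech2 /f0 [(_ * tanh x) ^+ 3]exprMn [Num.sqrt 2 ^+ 3]exprSr sqrt2_sqr /tanh; field.
  by rewrite sx ch0.
- by rewrite /f0 t0 mulr0.
- by apply: right => [x|]; [exact: dcont (df0 x)|rewrite /f0 t0 mulr0].
- exists (Num.sqrt 2); split; first by rewrite gt_eqF // sqrtr_gt0.
  by rewrite d1f0; apply: right => [x|]; [cnt|rewrite t0 expr0n /= subr0 mulr1].
- exists (Num.sqrt 2 * 1); apply: cvgM; [exact: cvg_cst|exact: tanh_lim].
- rewrite d1f0; have -> : (0 : R) = Num.sqrt 2 * (1 - 1 * 1) by rewrite mulr1 subrr mulr0.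
  apply: cvgM; first exact: cvg_cst.
  by apply: cvgB; [exact: cvg_cst|apply: cvgM; exact: tanh_lim].
Qed.

Lemma soliton_zeros : (positive_zeros f0 #= `I_0)%card.
Proof.
rewrite II0 card_eq0; apply/eqP/seteqP; split => // x [x0] /eqP.
rewrite mulf_eq0 sqrtr_eq0 leNgt ltr0n /= /tanh mulf_eq0 invr_eq0 (negbTE (ch0 x)) orbF.
by rewrite gt_eqF // sinh_gt0.
Qed.

Lemma soliton_potential x : 0 < x -> potential f0 x = - (6 / cosh x ^+ 2).
Proof.
move=> x0; have sx : sinh x != 0 by rewrite gt_eqF // sinh_gt0.
by rewrite /potential /f0 exprMn sqrt2_sqr /tanh; field; rewrite sx ch0.
Qed.

Lemma soliton_gauge x : gauge_mode f0 x = Num.sqrt 2 * (sinh x / cosh x ^+ 2).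
Proof. by rewrite /gauge_mode d1f0 sech2; ring. Qed.

Lemma soliton_eigenfunctions (lambda : R[i]) u :
  eigenfunction (linearized_operator f0) lambda u <->
  lambda = - 1 /\ (exists c : R[i], c != 0 /\
    forall x, 0 <= x -> u x = c * (sinh x / cosh x ^+ 2)%:C).
Proof.
have [[_ _ one gauge _] neg] := spectrum_of_regular soliton_regular soliton_zeros.
have mC a b : ((a * b)%:C : R[i]) = a%:C * b%:C by exact: rmorphM.
have s2 : ((Num.sqrt 2)%:C : R[i]) != 0.
  apply/eqP => /(congr1 (@complex.Re R)) /= /eqP; rewrite sqrtr_eq0 leNgt ltr0n //.
split.
  move=> hu; have ev : eigenvalue_of (linearized_operator f0) lambda by exists u.
  have e1 : lambda = - 1.
    have ev1 : eigenvalue_of (linearized_operator f0) (- 1).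
      by exists (fun x => (gauge_mode f0 x)%:C); exact: gauge_is_eigenfunction.
    by apply: (card1_unique one); split => //; exact: neg.
  split => //; move: hu; rewrite e1 => /gauge [c [c0 hc]].
  exists (c * (Num.sqrt 2)%:C); split; first by rewrite mulf_neq0.
  by move=> x x0; rewrite hc // soliton_gauge (mC (Num.sqrt 2)) [LHS]mulrA.
move=> [-> [c [c0 hc]]]; apply/gauge; exists (c / (Num.sqrt 2)%:C).
split; first by rewrite mulf_neq0 // invr_eq0.
by move=> x x0; rewrite hc // soliton_gauge (mC (Num.sqrt 2)) [RHS]mulrA divfK.
Qed.

End Conclusion.

Theorem mainTheorem2 (R : realType) :
  (forall (n : nat) (f : R -> R),
     globally_regular f ->
     (positive_zeros f #= `I_n)%card ->
     let L := linearized_operator f in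
     [/\ self_adjoint L,
         continuous_spectrum L = [set lambda : R[i] | 0 <= lambda],
         ([set lambda : R[i] | (eigenvalue_of L lambda /\ lambda < 0)%R] #= `I_n.+1)%card,
         eigenfunction L (- 1) (fun x => (gauge_mode f x)%:C) &
         ([set lambda : R[i] | (eigenvalue_of L lambda /\ lambda < - 1)%R] #= `I_n)%card]) /\
  (let f0 : R -> R := fun x => Num.sqrt 2 * tanh x in
   [/\ globally_regular f0 /\ (positive_zeros f0 #= `I_0)%card,
       forall x : R, 0 < x -> potential f0 x = - (6 / cosh x ^+ 2),
       forall x : R, gauge_mode f0 x = Num.sqrt 2 * (sinh x / cosh x ^+ 2) &
       forall (lambda : R[i]) (xi : R -> R[i]),
         eigenfunction (linearized_operator f0) lambda xi <->
         lambda = - 1 /\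
         (exists c : R[i], c != 0 /\
            forall x : R, 0 <= x -> xi x = c * (sinh x / cosh x ^+ 2)%:C)]).
Proof.
split=> [n f hf hz L|f0].
  have [[sa cs neg gauge below] _] := spectrum_of_regular hf hz.
  by split=> //; exact: gauge_is_eigenfunction.
split.
- by split; [exact: soliton_regular|exact: soliton_zeros].
- exact: soliton_potential.
- exact: soliton_gauge.
- exact: soliton_eigenfunctions.
Qed.
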